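(* Let $T$ be a complete NIP theory with monster model $\mathfrak{C}$, let $\tilde{G}$ be a definable group of $T$, and let $G\leqslant\tilde{G}$ be a type-definable subgroup (over a small parameter set) which is dp-minimal and which admits a global distal type f-generic for $G$. For $a\in G^{00}$ let $v(a)=[a,G^{00}]=\{[a,g]:g\in G^{00}\}$ (a set of commutators), and order the set of values $\{[a,G^{00}]:a\in G^{00}\}$ by reverse inclusion. Then the induced map $v$ on $G^{00}/Z(G^{00})$ makes $(G^{00}/Z(G^{00}),v)$ a plain valued group.
   Context: ''Small'' and ''bounded'' mean of cardinality less than the degree of saturation of $\mathfrak{C}$. A type-definable group $G$ is identified with the abstract group $G(\mathfrak{C})$. $G^{00}$ is the smallest subgroup of $G$ of bounded index that is type-definable over a small set (it exists since $T$ is NIP, and is normal in $G$). Conventions: $[a,b]=a^{-1}b^{-1}ab$, $a^b=b^{-1}ab$. The map $v$ is constant on cosets of $Z(G^{00})$, so it is well defined on $G^{00}/Z(G^{00})$. (It is the restriction of the valuation $a\mapsto[a,G^{00}]$ on $G/C_G(G^{00})$, using $C_G(G^{00})\cap G^{00}=Z(G^{00})$.) Valued groups: let $(\mathcal{P},\leqslant)$ be a totally ordered set with a greatest element. A $\mathcal{P}$-valued group structure on a group $H$ is a surjective map $v:H\to\mathcal{P}$ such that (1) $v(a)=\max\mathcal{P}$ if and only if $a=1$; (2) $v(a^g)<v(b^g)$ for all $g,a,b\in H$ with $v(a)<v(b)$; (3) $v(a)=v(a^{-1})$ for all $a\in H$; (4) $v(ab)\geqslant\min\{v(a),v(b)\}$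 for all $a,b\in H$. The valued group $(H,v)$ is plain if in addition $v([a,b])>\max\{v(a),v(b)\}$ for all $a,b\in H\setminus\{1\}$. Here $\mathcal{P}$ is the set of values $\{[a,G^{00}]:a\in G^{00}\}$ under reverse inclusion. Dp-minimal: sequences $I_1,I_2$ are mutually indiscernible over $B$ if each is indiscernible over $B$ together with the other. $G$ is dp-minimal if for some (equivalently any) small set $B$ over which $G$ is type-defined, for any infinite sequences $I_1,I_2$ mutually indiscernible over $B$ and any $a\in G$, one of $I_1,I_2$ is indiscernible over $B\cup\{a\}$. f-generic: a partial type $\pi(x)$ over a small set, concentrated on $\tilde{G}$, is (left) f-generic for $G$ if, for any small model $M$ over which $\pi$ and $G$ are type-definable, no left translate of $\pi(x)\wedge G(x)$ by an element of $G$ forks over $M$. A global type is f-generic for $G$ if all its restrictions to small sets are. (Known fact: a global type concentrated on $G$ is f-generic for $G$ iff it is invariant under left translation by $G^{00}(\mathfrak{C})$.) The f-generic type in the hypothesis is concentrated on $G$. Distal: types $p(x),r(y)$ over $B$ are weakly orthogonal, $p\perp^w r$, if $p(x)\wedge r(y)$ determines a unique complete type over $B$. A global type $p$ invariant over a small set $B$ is distal if for every tuple $c$ and every Morley sequence $I=(a_i)_{i\in\omega}$ of $p$ over $B\cup\{c\}$ (i.e. $a_i\models p|_{(B,c,a_{<i})}$), $\mathrm{tp}(c/B,I)\perp^w p|_{(B,I)}$ (this does not depend on the choice of $B$). *)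

(* Defs.v *)
From HB Require Import structures.
From mathcomp Require Import all_boot generic_quotient.
From mathcomp Require Import boolp classical_sets functions cardinality.

Set Implicit Arguments.
Unset Strict Implicit.
Unset Printing Implicit Defensive.

Local Open Scope classical_set_scope.
Local Open Scope card_scope.

Record language := Language {
  fsym : Type;
  rsym : Type;
  farity : fsym -> nat;
  rarity : rsym -> nat
}.

Inductive term (L : language) (V : Type) : Type :=
| TVar of V
| TApp (f : fsym L) of ('I_(farity f) -> term L V).

(* [formula L V] is the type of L-formulas with free variables in [V]; the
   variable bound by [FAll] is the [None] of [option V]. *)
Inductive formula (L : language) (V : Type) : Type :=
| FFalse
| FEq of term L V & term L V
| FRel (r : rsym L) of ('I_(rarity r) -> term L V)
| FImp of formula L V & formula L V
| FAll of formula L (option V).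

Arguments FFalse {L V}.

Definition FNot L (V : Type) (phi : formula L V) := FImp phi FFalse.

Fixpoint tfv L (V : Type) (t : term L V) : set V :=
  match t with
  | TVar v => [set v]
  | TApp f ts => [set v | exists i, tfv (ts i) v]
  end.

Fixpoint fv L (V : Type) (phi : formula L V) : set V :=
  match phi with
  | FFalse => set0
  | FEq t u => tfv t `|` tfv u
  | FRel r ts => [set v | exists i, tfv (ts i) v]
  | FImp phi1 phi2 => fv phi1 `|` fv phi2
  | FAll phi1 => [set v | fv phi1 (Some v)]
  end.

Fixpoint trename L (V W : Type) (s : V -> W) (t : term L V) : term L W :=
  match t with
  | TVar v => TVar L (s v)
  | TApp f ts => TApp (fun i => trename s (ts i))
  end.

Fixpoint frename L (V W : Type) (s : V -> W) (phi : formula L V) : formula L W :=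
  match phi with
  | FFalse => FFalse
  | FEq t u => FEq (trename s t) (trename s u)
  | FRel r ts => FRel (fun i => trename s (ts i))
  | FImp phi1 phi2 => FImp (frename s phi1) (frename s phi2)
  | FAll phi1 => FAll (frename (omap s) phi1)
  end.

Record structure (L : language) := Structure {
  dom :> Type;
  dom_inh : inhabited dom;
  fint : forall f : fsym L, ('I_(farity f) -> dom) -> dom;
  rint : forall r : rsym L, ('I_(rarity r) -> dom) -> Prop
}.

Fixpoint teval L (M : structure L) (V : Type) (e : V -> M) (t : term L V) : M :=
  match t with
  | TVar v => e v
  | TApp f ts => fint (fun i => teval e (ts i))
  end.

Definition env_cons (M V : Type) (x : M) (e : V -> M) (o : option V) : M :=
  if o is Some v then e v else x.

Fixpoint sat L (M : structure L) (V : Type) (phi : formula L V) : (V -> M) -> Prop :=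
  match phi with
  | FFalse => fun=> False
  | FEq t u => fun e => teval e t = teval e u
  | FRel r ts => fun e => rint (fun i => teval e (ts i))
  | FImp phi1 phi2 => fun e => sat phi1 e -> sat phi2 e
  | FAll phi1 => fun e => forall x : M, sat phi1 (env_cons x e)
  end.

Definition theory (L : language) := set (formula L void).

Definition satS L (M : structure L) (s : formula L void) : Prop :=
  sat s (of_void M).

Definition models L (M : structure L) (T : theory L) : Prop := T `<=` satS M.

Definition entails L (T : theory L) (s : formula L void) : Prop :=
  forall M : structure L, models M T -> satS M s.

Definition complete_theory L (T : theory L) : Prop :=
  (exists M : structure L, models M T) /\
  forall s, entails T s \/ entails T (FNot s).

Definition tcat (M V W : Type) (a : V -> M) (b : W -> M) (s : V + W) : M :=
  match s with inl v => a v | inr w => b w end.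

Definition has_IP L (M : structure L) (V W : Type) (phi : formula L (V + W)) : Prop :=
  exists (a : nat -> V -> M) (b : set nat -> W -> M),
    forall i S, sat phi (tcat (a i) (b S)) <-> S i.

Definition NIP L (T : theory L) : Prop :=
  forall M : structure L, models M T ->
  forall m n (phi : formula L ('I_m + 'I_n)), ~ has_IP M phi.

Definition elementary L (M N : structure L) (j : M -> N) : Prop :=
  forall n (phi : formula L 'I_n) (e : 'I_n -> M), sat phi e <-> sat phi (j \o e).

Definition elementary_substructure L (C : structure L) (M : set C) : Prop :=
  exists (N : structure L) (j : N -> C), elementary j /\ range j = M.

Definition automorphism L (C : structure L) (s : C -> C) : Prop :=
  [/\ bijective s,
      forall (f : fsym L) t, s (fint (f := f) t) = fint (f := f) (s \o t) &
      forall (r : rsym L) t, rint (r := r) (s \o t) <-> rint (r := r) t].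

Definition partial_elementary L (C : structure L) (A : set C) (f : C -> C) :=
  forall phi : formula L A, sat phi (fun x : A => val x) <->
                            sat phi (fun x : A => f (val x)).

Section LCFormulas.
Variables (L : language) (C : structure L).

(* An L(C)-formula in the free variables [V]: a parameter is an [inr]. *)
Definition pformula (V : Type) := formula L (V + C).

Definition psat (V : Type) (phi : pformula V) (a : V -> C) : Prop := sat phi (tcat a id).

Definition over (V : Type) (A : set C) : set (pformula V) :=
  [set phi | forall c, fv phi (inr c) -> A c].

Definition realizes (V : Type) (a : V -> C) (S : set (pformula V)) : Prop :=
  forall phi, S phi -> psat phi a.

Definition finitely_satisfiable (V : Type) (S : set (pformula V)) : Prop :=
  forall F, F `<=` S -> finite_set F -> exists a, realizes a F.

Definition tp (V : Type) (A : set C) (a : V -> C) : set (pformula V) :=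
  [set phi | over A phi /\ psat phi a].

Definition definable (V : Type) (A : set C) (X : set (V -> C)) : Prop :=
  exists phi : pformula V, over A phi /\ X = [set a | psat phi a].

Definition type_definable (V : Type) (A : set C) (X : set (V -> C)) : Prop :=
  exists S : set (pformula V), S `<=` over A /\ X = [set a | realizes a S].

Definition global_type (V : Type) (p : set (pformula V)) : Prop :=
  finitely_satisfiable p /\ forall phi, p phi \/ p (FNot phi).

Definition restr (V : Type) (p : set (pformula V)) (A : set C) : set (pformula V) :=
  p `&` over A.

Definition invariant_type (V : Type) (B : set C) (p : set (pformula V)) : Prop :=
  forall s : C -> C, automorphism s -> (forall b, B b -> s b = b) ->
  forall phi,
    p phi <->
    p (frename (fun x => match x with inl v => inl v | inr c => inr (s c) end) phi).

Definition elts (V : Type) (I : nat -> V -> C) : set C := \bigcup_i range (I i).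

Definition subtuple (V : Type) (I : nat -> V -> C) n (k : 'I_n -> nat) (x : 'I_n * V) : C :=
  I (k x.1) x.2.

Definition indiscernible (V : Type) (A : set C) (I : nat -> V -> C) : Prop :=
  forall n (k l : 'I_n -> nat),
    {homo k : i j / (i < j)%N} -> {homo l : i j / (i < j)%N} ->
    tp A (subtuple I k) = tp A (subtuple I l).

Definition mutually_indiscernible (V W : Type) (B : set C)
    (I1 : nat -> V -> C) (I2 : nat -> W -> C) : Prop :=
  indiscernible (B `|` elts I2) I1 /\ indiscernible (B `|` elts I1) I2.

Definition morley_sequence (V : Type) (p : set (pformula V)) (A : set C)
    (I : nat -> V -> C) : Prop :=
  forall i,
    realizes (I i) (restr p (A `|` \bigcup_(j in [set j | (j < i)%N]) range (I j))).

(* [p] and [r] are meant to be complete types over a small set [B], so that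
   the complete types over [B] containing p(x) /\ r(y) are those of the
   realizations in the monster model. *)
Definition weakly_orthogonal (V W : Type) (B : set C)
    (p : set (pformula V)) (r : set (pformula W)) : Prop :=
  forall a a' b b', realizes a p -> realizes a' p -> realizes b r -> realizes b' r ->
    tp B (tcat a b) = tp B (tcat a' b').

(* [D] is defined by an instance phi(x, b_0) that divides over [A]. *)
Definition divides (V : Type) (A : set C) (D : set (V -> C)) : Prop :=
  exists k (phi : formula L (V + 'I_k)) (b : nat -> 'I_k -> C),
    [/\ D = [set a | sat phi (tcat a (b 0))],
        indiscernible A b &
        ~ exists a, forall i, sat phi (tcat a (b i))].

(* Forking over [A] of a partial type over a small set, given by the set [X]
   of its realizations in the monster model. *)
Definition forks (V : Type) (A : set C) (X : set (V -> C)) : Prop :=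
  exists m (D : 'I_m -> set (V -> C)),
    (forall j, divides A (D j)) /\ X `<=` \bigcup_j D j.

(* "Small" and "bounded": of cardinality less than the degree of saturation,
   which is given as the cardinality of the type [kappa]. *)
Definition small (kappa T : Type) (A : set T) : Prop :=
  (A #<= [set: kappa]) /\ ~ ([set: kappa] #<= A).

Definition strong_limit (kappa : Type) : Prop :=
  forall X : set kappa, small kappa X -> small kappa [set Y | Y `<=` X].

Definition saturated (kappa : Type) : Prop :=
  forall (A : set C) (S : set (pformula unit)), small kappa A -> S `<=` over A ->
    finitely_satisfiable S -> exists a, realizes a S.

Definition strongly_homogeneous (kappa : Type) : Prop :=
  forall (A : set C) (f : C -> C), small kappa A -> partial_elementary A f ->
    exists s, automorphism s /\ forall a, A a -> s a = f a.

(* |kappa| is a strong limit cardinal greater than |T|, the cardinality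
   |L| + aleph_0 of [formula L nat]. *)
Definition monster (kappa : Type) (T : theory L) : Prop :=
  [/\ models C T, strong_limit kappa, small kappa [set: formula L nat],
      saturated kappa & strongly_homogeneous kappa].

Definition distal (kappa : Type) (V : Type) (p : set (pformula V)) : Prop :=
  exists B : set C,
    [/\ small kappa B, invariant_type B p &
        forall m (c : 'I_m -> C) (I : nat -> V -> C),
          morley_sequence p (B `|` range c) I ->
          weakly_orthogonal (B `|` elts I)
            (tp (B `|` elts I) c) (restr p (B `|` elts I))].

End LCFormulas.

Arguments monster {L} C kappa T.

Local Open Scope quotient_scope.
Local Open Scope group_scope.

Record subgroup (gT : groupType) := Subgroup {
  sg_set :> set gT;
  sg_closed : group_closed (fun x => x \in sg_set)
}.

Definition sg_type (gT : groupType) (H : subgroup gT) : Type :=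
  {x : gT | x \in (H : set gT)}.

Section SubgroupType.
Variables (gT : groupType) (H : subgroup gT).
HB.instance Definition _ := Choice.on (sg_type H).
HB.instance Definition _ := SubType.on (sg_type H).
HB.instance Definition _ :=
  SubChoice_isSubGroup.Build gT (fun x => x \in (H : set gT)) (sg_type H)
    (sg_closed H).
End SubgroupType.

Record normal_subgroup (gT : groupType) := NormalSubgroup {
  nsg_sub :> subgroup gT;
  nsg_normal : forall x g : gT, x \in (nsg_sub : set gT) ->
                                x ^ g \in (nsg_sub : set gT)
}.

Section Quotient.
Variables (gT : groupType) (N : normal_subgroup gT).

Local Lemma nsg1 : 1 \in (N : set gT).
Proof. exact: (sg_closed N).1. Qed.

Local Lemma nsgV x : x \in (N : set gT) -> x^-1 \in (N : set gT).
Proof. exact: (group_closedV (sg_closed N)). Qed.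

Local Lemma nsgM x y :
  x \in (N : set gT) -> y \in (N : set gT) -> x * y \in (N : set gT).
Proof. exact: (group_closedM (sg_closed N)). Qed.

Definition coset_rel (x y : gT) : bool := x^-1 * y \in (N : set gT).

Local Lemma coset_refl : reflexive coset_rel.
Proof. by move=> x; rewrite /coset_rel mulVg nsg1. Qed.

Local Lemma coset_sym : symmetric coset_rel.
Proof.
by move=> x y; rewrite /coset_rel; apply/idP/idP => /nsgV; rewrite invgM invgK.
Qed.

Local Lemma coset_trans : transitive coset_rel.
Proof.
move=> y x z xy yz; rewrite /coset_rel.
by have := nsgM xy yz; rewrite mulgA -(mulgA x^-1) mulgV mulg1.
Qed.

Canonical coset_equiv := EquivRel coset_rel coset_refl coset_sym coset_trans.

Definition quotient : Type := {eq_quot coset_equiv}.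
HB.instance Definition _ := Choice.on quotient.
HB.instance Definition _ := EqQuotient.on quotient.

Definition coset (x : gT) : quotient := \pi_quotient x.

Lemma coset_eqP x y : coset x = coset y <-> x^-1 * y \in (N : set gT).
Proof. by split=> [/eqmodP|xy]; last exact/eqmodP. Qed.

Lemma coset_repr (u : quotient) : coset (repr u) = u.
Proof. exact: reprK. Qed.

Definition quot_mul (u v : quotient) : quotient := coset (repr u * repr v).
Definition quot_inv (u : quotient) : quotient := coset (repr u)^-1.

Lemma cosetM x y : quot_mul (coset x) (coset y) = coset (x * y).
Proof.
apply/coset_eqP; rewrite invgM.
set y' := repr _; set x' := repr _.
have /coset_eqP xx' : coset x' = coset x by exact: coset_repr.
have /coset_eqP yy' : coset y' = coset y by exact: coset_repr.
have := nsgM (nsg_normal y xx') yy'.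
have := nsgM yy' (nsg_normal y xx').
by rewrite /conjg !mulgA -(mulgA _ y y^-1) mulgV mulg1.
Qed.

Lemma cosetV x : quot_inv (coset x) = coset x^-1.
Proof.
apply/coset_eqP; rewrite invgK; set x' := repr _.
have /coset_eqP xx' : coset x = coset x' by rewrite /x' [in RHS]coset_repr.
have := nsg_normal x^-1 xx'.
by rewrite /conjg invgK !mulgA mulgV mul1g.
Qed.

Local Lemma quot_mulA : associative quot_mul.
Proof.
move=> u v w; rewrite -(coset_repr u) -(coset_repr v) -(coset_repr w).
by rewrite !cosetM mulgA.
Qed.

Local Lemma quot_mul1 : left_id (coset 1) quot_mul.
Proof. by move=> u; rewrite -(coset_repr u) cosetM mul1g. Qed.

Local Lemma quot_1mul : right_id (coset 1) quot_mul.
Proof. by move=> u; rewrite -(coset_repr u) cosetM mulg1. Qed.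

Local Lemma quot_mulV : left_inverse (coset 1) quot_inv quot_mul.
Proof. by move=> u; rewrite -(coset_repr u) cosetV cosetM mulVg. Qed.

Local Lemma quot_Vmul : right_inverse (coset 1) quot_inv quot_mul.
Proof. by move=> u; rewrite -(coset_repr u) cosetV cosetM mulgV. Qed.

HB.instance Definition _ := isGroup.Build quotient
  quot_mulA quot_mul1 quot_1mul quot_mulV quot_Vmul.

End Quotient.

Section Center.
Variable gT : groupType.

Definition center_set : set gT := [set z | forall g, commute z g].

Local Lemma center_closed : group_closed (fun x => x \in center_set).
Proof.
split=> [|x y /set_mem cx /set_mem cy]; apply/mem_set => g; rewrite /commute.
  by rewrite mulg1 mul1g.
rewrite -mulgA; have -> : y^-1 * g = g * y^-1.
  by apply: (mulgI y); rewrite mulgA mulgV mul1g mulgA cy -mulgA mulgV mulg1.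
by rewrite !mulgA cx.
Qed.

Local Lemma center_normal (x g : gT) :
  x \in center_set -> x ^ g \in center_set.
Proof.
move=> /[dup] cx /set_mem xg.
by rewrite /conjg (xg g) mulgA mulVg mul1g.
Qed.

Definition center : normal_subgroup gT :=
  @NormalSubgroup gT (Subgroup center_closed) center_normal.

End Center.

Section Valued.
Variables (H : groupType) (Q : Type) (P : set Q) (le : Q -> Q -> Prop).

Definition olt (x y : Q) : Prop := le x y /\ x <> y.
Definition omin (x y : Q) : Q := if `[< le x y >] then x else y.
Definition omax (x y : Q) : Q := if `[< le x y >] then y else x.

(* [le] is only required to be a total order on the set of values [P];
   [vg_max] provides the greatest element of [P]. *)
Record valued_group (v : H -> Q) : Prop := ValuedGroup {
  vg_le_refl : forall x, P x -> le x x;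
  vg_le_anti : forall x y, P x -> P y -> le x y -> le y x -> x = y;
  vg_le_trans : forall x y z, P x -> P y -> P z -> le x y -> le y z -> le x z;
  vg_le_total : forall x y, P x -> P y -> le x y \/ le y x;
  vg_surj : range v = P;
  vg_max : exists m, [/\ P m, forall x, P x -> le x m & forall a, v a = m <-> a = 1];
  vg_conj : forall g a b, olt (v a) (v b) -> olt (v (a ^ g)) (v (b ^ g));
  vg_inv : forall a, v a = v a^-1;
  vg_mul : forall a b, le (omin (v a) (v b)) (v (a * b))
}.

Definition plain_valued_group (v : H -> Q) : Prop :=
  valued_group v /\
  forall a b, a <> 1 -> b <> 1 -> olt (omax (v a) (v b)) (v [~ a, b]).

End Valued.

Section CommutatorValuation.
Variable K : groupType.

(* [a, K] is the bare set of commutators, not the subgroup it generates. *)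
Definition comms (a : K) : set K := [set [~ a, g] | g in [set: K]].

(* Independent of the representative of the coset: see [comms_quotE]. *)
Definition comms_quot (u : quotient (center K)) : set K := comms (repr u).

Lemma comms_quotE a : comms_quot (coset (center K) a) = comms a.
Proof.
rewrite /comms_quot; set a' := repr _.
have /coset_eqP/set_mem zc : coset (center K) a = coset (center K) a'.
  by rewrite /a' coset_repr.
suff E g : [~ a', g] = [~ a, g] by congr image; apply/funext.
have -> : a' = a * (a^-1 * a') by rewrite mulgA mulgV mul1g.
move: (a^-1 * a') zc => z zc.
rewrite /commg /conjg invgM -!mulgA (zc g).
by apply: (mulgI z); rewrite [LHS]mulgA mulgV mul1g [RHS]zc -!mulgA.
Qed.

End CommutatorValuation.

Section DefinableGroups.
Variables (L : language) (C : structure L).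

Definition mul_graph (gT : groupType) n (emb : gT -> 'I_n -> C) :
    set ('I_n + ('I_n + 'I_n) -> C) :=
  [set z | exists a b, z = tcat (emb a) (tcat (emb b) (emb (a * b)))].

Definition group_definable_over (A : set C) (gT : groupType) n
    (emb : gT -> 'I_n -> C) : Prop :=
  definable A (range emb) /\ definable A (mul_graph emb).

(* A group together with an identification of its elements with those of a
   definable set of n-tuples, its multiplication being definable. *)
Record definable_group := DefinableGroup {
  dg_sort :> groupType;
  dg_dim : nat;
  dg_emb : dg_sort -> 'I_dg_dim -> C;
  dg_emb_inj : injective dg_emb;
  dg_definable : group_definable_over [set: C] dg_emb
}.

Variables (kappa : Type) (Gt : definable_group).

Local Notation emb := (@dg_emb Gt).
Local Notation ptype := (set (pformula C 'I_(dg_dim Gt))).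

(* [A] is required to define the ambient group law as well. *)
Definition type_defined_over (G : set Gt) (A : set C) : Prop :=
  group_definable_over A emb /\ type_definable A (emb @` G).

Definition small_type_definable (G : set Gt) : Prop :=
  exists A, small kappa A /\ type_defined_over G A.

Definition dp_minimal (G : set Gt) : Prop :=
  exists B : set C,
    [/\ small kappa B, type_defined_over G B &
        forall m n (I1 : nat -> 'I_m -> C) (I2 : nat -> 'I_n -> C),
          mutually_indiscernible B I1 I2 ->
          forall a, G a ->
            indiscernible (B `|` range (emb a)) I1 \/
            indiscernible (B `|` range (emb a)) I2].

Definition concentrated_on (G : set Gt) (p : ptype) : Prop :=
  exists A (S : ptype),
    [/\ small kappa A, S `<=` over A,
        emb @` G = [set x | realizes x S] & S `<=` p].

(* Over a small set, a partial type and its set of realizations are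
   interchangeable; the conjunct G(x) already confines the translates to the
   ambient definable group. *)
Definition f_generic_partial (G : set Gt) (S : ptype) : Prop :=
  forall M : set C,
    small kappa M -> elementary_substructure M ->
    type_definable M [set x | realizes x S] -> type_defined_over G M ->
    forall g, G g ->
      ~ forks M (emb @` [set g * h | h in [set h | G h /\ realizes (emb h) S]]).

Definition f_generic (G : set Gt) (p : ptype) : Prop :=
  forall A : set C, small kappa A -> f_generic_partial G (restr p A).

Definition left_cosets (G H : set Gt) : set (set Gt) :=
  [set [set a * h | h in H] | a in G].

Definition type_definable_bounded_index (G H : set Gt) : Prop :=
  [/\ H `<=` G, small_type_definable H & small kappa (left_cosets G H)].

Definition is_G00 (G H : subgroup Gt) : Prop :=
  type_definable_bounded_index G H /\
  forall H' : subgroup Gt, type_definable_bounded_index G H' -> H `<=` H'.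

End DefinableGroups.

(* Main.v *)
From mathcomp Require Import all_boot.
From mathcomp Require Import boolp classical_sets functions cardinality filter.
Require Import Defs.

(* Write E_b for the conjugacy class of b in G00, and call x generic over A if x j0
   realizes p over A, where p is the distal f-generic type and j0 is a fixed
   realization of p.

   Distality is used as follows: a realization of p over a Morley sequence J of p over
   A is a realization over A and J.  With f-genericity this yields that the stabilizer
   of p is type-definable of bounded index, hence contains G00; so genericity is
   invariant under left translation by G00.  Dp-minimality is used as follows: if I1
   is a Morley sequence over A and I2 is one over A and I1, then for each c in G one of
   I1, I2 is indiscernible over A and c.  Applied to the averages of the powers of a
   and b and to the product of their first terms, it gives that a power of one of a, b
   commutes with the other; in particular any element of G00 commutes with a power of
   each generic.

   Let D be the group generated by the b^u b^-v where u, v are such that a tail of a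
   Morley sequence L is a Morley sequence over u, over v.  The element b^-(w z) b^u
   shows that D is normalized by the generics z over L; the element b^-x b^y shows that
   D b^y is contained in E_b for suitable y.  As b^(k x) b^-(l x) lies in D for k, l in
   G00, conjugating by y = x z gives b^k b^-l b in E_b.  So [b,G00] is a normal subgroup
   of G00, and the element b^-x a^y shows that these subgroups form a chain.  Finally
   u = [a,b] lies in [a,G00], and [u,G00] = [a,G00] would give u^-1 = u^-1 u^h. *)

Set Implicit Arguments.
Unset Strict Implicit.
Unset Printing Implicit Defensive.

Local Open Scope classical_set_scope.
Local Open Scope card_scope.

(** * Formulas *)

Section Syntax.
Variable L : language.

(** Two obstacles shape the argument. First, the realizations of p need not lie in G00: over a set
    naming coset representatives they fill part of a single right coset of G00. Multiplying on the
    right by the inverse of j0 brings them into G00 and does not interfere with left translation,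
    the only translation under which genericity is known to be invariant. Second, the automorphism
    supplied by dp-minimality fixes the parameters and c but moves everything else, so little is
    known of the images. What survives is that an image is generic over A and that L is still a
    Morley sequence over A and the image; D is built from exactly this information. Distality makes
    it sufficient: an element generic over a tail of L is generic over A, u and this tail as soon as
    the tail is a Morley sequence over A and u. Dp-minimality gives only one of two inclusions
    between D and a conjugate of D; commuting powers restore the other. Morley sequences are first
    treated abstractly, for a group of permutations and a genericity relation, so that averages of
    sequences, coheirs, p and its translate by j0 share one calculus. *)

Lemma teval_rename (M : structure L) V W (s : V -> W) (t : term L V) (e : W -> M) :
  teval e (trename s t) = teval (e \o s) t.
Proof.
by elim: t => //= f ts IH; congr fint; apply/funext => i; exact: IH.
Qed.

Lemma sat_rename (M : structure L) V W (s : V -> W) (phi : formula L V) (e : W -> M) :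
  sat (frename s phi) e <-> sat phi (e \o s).
Proof.
elim: phi W s e => //= [U t u|U r ts|U phi1 IH1 phi2 IH2|U phi IH] W s e.
- by rewrite !teval_rename.
- suff -> : (fun i => teval e (trename s (ts i))) = (fun i => teval (e \o s) (ts i)) by [].
  by apply/funext => i; rewrite teval_rename.
- by split=> H /IH1/H/IH2.
- have E x : env_cons x e \o omap s = env_cons x (e \o s) by apply/funext => -[].
  by split=> H x; [rewrite -E; apply/IH|apply/IH; rewrite E].
Qed.

Lemma teval_ext_fv (M : structure L) V (t : term L V) (e e' : V -> M) :
  (forall v, tfv t v -> e v = e' v) -> teval e t = teval e' t.
Proof.
elim: t => /= [v|f ts IH] H; first exact: H.
by congr fint; apply/funext => i; apply: IH => v tv; apply: H; exists i.
Qed.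

Lemma sat_ext_fv (M : structure L) V (phi : formula L V) (e e' : V -> M) :
  (forall v, fv phi v -> e v = e' v) -> sat phi e <-> sat phi e'.
Proof.
elim: phi e e' => //= [U t u|U r ts|U phi1 IH1 phi2 IH2|U phi IH] e e' H.
- by rewrite (@teval_ext_fv _ _ t e e') ?(@teval_ext_fv _ _ u e e') // => v uv;
    apply: H; [right|left].
- suff -> : (fun i => teval e (ts i)) = (fun i => teval e' (ts i)) by [].
  by apply/funext => i; apply: teval_ext_fv => v tv; apply: H; exists i.
- have := IH1 e e' (fun v h => H v (or_introl h)).
  by have := IH2 e e' (fun v h => H v (or_intror h)); tauto.
- have E x : sat phi (env_cons x e) <-> sat phi (env_cons x e').
    by apply: IH => -[v|] //= fvv; apply: H.
  by split=> K x; apply/E.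
Qed.

Lemma tfv_finite V (t : term L V) : finite_set (tfv t).
Proof.
elim: t => /= [v|f ts IH]; first exact: finite_set1.
have -> : [set v | exists i, tfv (ts i) v] = \bigcup_i tfv (ts i).
  by apply/seteqP; split=> v [i] => [vi|_ vi]; exists i.
by apply: bigcup_finite => //.
Qed.

Lemma fv_finite V (phi : formula L V) : finite_set (fv phi).
Proof.
elim: phi => //= [U t u|U r ts|U phi1 IH1 phi2 IH2|U phi IH].
- by rewrite finite_setU; split; exact: tfv_finite.
- have -> : [set v | exists i, tfv (ts i) v] = \bigcup_i tfv (ts i).
    by apply/seteqP; split=> v [i] => [vi|_ vi]; exists i.
  by apply: bigcup_finite => // i _; exact: tfv_finite.
- by rewrite finite_setU.
- by apply: (@finite_preimage _ _ (fv phi) Some) => // x y _ _ [].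
Qed.

Lemma tfv_rename V W (s : V -> W) (t : term L V) : tfv (trename s t) `<=` s @` tfv t.
Proof.
elim: t => /= [v|f ts IH] w; first by move->; exists v.
by move=> [i /IH [v vi <-]]; exists v => //; exists i.
Qed.

Lemma fv_rename V W (s : V -> W) (phi : formula L V) : fv (frename s phi) `<=` s @` fv phi.
Proof.
elim: phi W s => [U|U t u|U r ts|U phi1 IH1 phi2 IH2|U phi IH] W s w /=.
- by [].
- by move=> [] h; have [v ? <-] := tfv_rename h; exists v => //; [left|right].
- by move=> [i h]; have [v vi <-] := tfv_rename h; exists v => //; exists i.
- by move=> [h|h]; [have [v ? <-] := IH1 _ _ _ h|have [v ? <-] := IH2 _ _ _ h];
    exists v => //; [left|right].
- by move=> h; have [[v|] //= fvv [<-]] := IH _ _ _ h; exists v.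
Qed.

Lemma finite_set_ord_range T (A : set T) :
  finite_set A -> exists n (d : 'I_n -> T), A = range d.
Proof.
move=> fA.
have [s As] : exists s : seq {classic T}, A = [set` s] by apply/finite_seqP.
exists (size s), (fun i => tnth (in_tuple s) i); rewrite As; apply/seteqP; split=> x /=.
  by move/(@tnthP _ _ (in_tuple s)) => [i ->]; exists i.
by move=> [i _ <-]; exact: (mem_tnth i (in_tuple s)).
Qed.

Lemma aut_sat (C : structure L) (s : C -> C) V (phi : formula L V) (e : V -> C) :
  automorphism s -> sat phi (s \o e) <-> sat phi e.
Proof.
move=> [[s' sK s'K] sf sr].
have te U (t : term L U) (g : U -> C) : teval (s \o g) t = s (teval g t).
  by elim: t => //= f ts IH; rewrite sf; congr fint; apply/funext => i; rewrite IH.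
elim: phi e => //= [U t u|U r ts|U phi1 IH1 phi2 IH2|U phi IH] e.
- by rewrite !te; split=> [/(can_inj sK)|->].
- rewrite -(sr r (fun i => teval e (ts i))); suff -> : (fun i => teval (s \o e) (ts i)) = s \o (fun i => teval e (ts i)) by [].
  by apply/funext => i; rewrite te.
- by rewrite IH1 IH2.
- have E (x : C) : s \o env_cons x e = env_cons (s x) (s \o e) by apply/funext => -[].
  split=> K x; first by apply/IH; rewrite E.
  by rewrite -(s'K x) -E; apply/IH.
Qed.

Lemma aut_id (C : structure L) : automorphism (idfun : C -> C).
Proof. by split=> //; exists idfun. Qed.

Lemma aut_comp (C : structure L) (s t : C -> C) :
  automorphism s -> automorphism t -> automorphism (s \o t).
Proof.
move=> [bs sf sr] [bt tf tr]; split; first exact: bij_comp.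
- by move=> f x /=; rewrite tf sf.
- by move=> r x; rewrite -(tr r x) -(sr r (t \o x)).
Qed.

Lemma aut_inv (C : structure L) (s : C -> C) :
  automorphism s -> exists t, [/\ automorphism t, cancel s t & cancel t s].
Proof.
move=> [[t sK tK] sf sr]; exists t; split=> //.
have E n (x : 'I_n -> C) : s \o (t \o x) = x by apply/funext => i /=; rewrite tK.
split; first by exists s.
- by move=> f x; apply: (can_inj sK); rewrite tK sf E.
- by move=> r x; rewrite -sr E.
Qed.

Definition FEx (V : Type) (phi : formula L (option V)) : formula L V := FNot (FAll (FNot phi)).

Lemma sat_ex (M : structure L) V (phi : formula L (option V)) (e : V -> M) :
  sat (FEx phi) e <-> exists x, sat phi (env_cons x e).
Proof.
split=> /= [H|[x xP] H]; last exact: (H x).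
by apply: contrapT => nH; apply: H => x xP; apply: nH; exists x.
Qed.

Definition FAnd (V : Type) (phi psi : formula L V) : formula L V := FNot (FImp phi (FNot psi)).

Lemma sat_and (M : structure L) V (phi psi : formula L V) (e : V -> M) :
  sat (FAnd phi psi) e <-> sat phi e /\ sat psi e.
Proof. by rewrite /=; case: (pselect (sat phi e)); case: (pselect (sat psi e)); tauto. Qed.

Definition of_I0 (T : Type) (i : 'I_0) : T := match notF (ltn_ord i) with end.

Definition shiftvar n (V : Type) (x : V + 'I_n.+1) : option V + 'I_n :=
  match x with
  | inl v => inl (Some v)
  | inr i => if unlift ord0 i is Some j then inr j else inl None
  end.

(** The outermost quantifier binds index 0, which [shiftvar] turns into the [None] of [option V];
    the other indices move down by one. *)
Fixpoint FExn n : forall V : Type, formula L (V + 'I_n) -> formula L V :=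
  match n with
  | 0 => fun (V : Type) phi => frename (fun x : V + 'I_0 =>
           match x with inl v => v | inr i => of_I0 V i end) phi
  | n'.+1 => fun (V : Type) phi => FEx (FExn (frename (@shiftvar n' V) phi))
  end.

Lemma sat_exn (M : structure L) n (V : Type) (phi : formula L (V + 'I_n)) (e : V -> M) :
  sat (FExn phi) e <-> exists b, sat phi (tcat e b).
Proof.
elim: n V phi e => [|n IH] V phi e.
  rewrite /= sat_rename; have E (b : 'I_0 -> M) :
    e \o (fun x => match x with inl v => v | inr i => of_I0 V i end)
     = tcat e b by apply/funext => -[v|[]].
  split=> [|[b]]; last by rewrite (E b).
  by move=> H; exists (of_I0 M); rewrite -E.
rewrite [FExn phi]/= sat_ex; split=> [[x /IH[b]]|[b bP]].
  rewrite sat_rename => H; exists (fun i => if unlift ord0 i is Some j then b j else x).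
  apply: (iffLR (sat_ext_fv _) H) => -[v|i] _ //=.
  by case: (unlift ord0 i).
exists (b ord0); apply/IH; exists (fun j => b (lift ord0 j)); rewrite sat_rename.
apply: (iffLR (sat_ext_fv _) bP) => -[v|i] _ //=.
by case: unliftP => [j ->|->].
Qed.

Lemma trelabel V W (R : V -> W -> Prop) (t : term L V) :
  (forall v, tfv t v -> exists w, R v w) ->
  exists u : term L W, forall (M : structure L) (e : V -> M) e',
    (forall v w, R v w -> e v = e' w) -> teval e t = teval e' u.
Proof.
elim: t => /= [v|f ts IH] H.
  have [w vw] := H v erefl; exists (TVar L w) => M e e' K /=; exact: K.
have /choice[us usP] : forall i, exists u : term L W, forall (M : structure L) (e : V -> M) e',
    (forall v w, R v w -> e v = e' w) -> teval e (ts i) = teval e' u.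
  by move=> i; apply: IH => v vi; apply: H; exists i.
exists (TApp us) => M e e' K /=; congr fint; apply/funext => i; exact: usP.
Qed.

(* Renaming along a relation: only the variables that occur need an image. *)
Lemma relabel V W (R : V -> W -> Prop) (phi : formula L V) :
  (forall v, fv phi v -> exists w, R v w) ->
  exists psi : formula L W, forall (M : structure L) (e : V -> M) e',
    (forall v w, R v w -> e v = e' w) -> sat phi e <-> sat psi e'.
Proof.
elim: phi W R => [U|U t u|U r ts|U phi1 IH1 phi2 IH2|U phi IH] W R /= H.
- by exists FFalse.
- have [|t' t'P] := @trelabel _ _ R t; first by move=> v vt; apply: H; left.
  have [|u' u'P] := @trelabel _ _ R u; first by move=> v vt; apply: H; right.
  by exists (FEq t' u') => M e e' K /=; rewrite (t'P _ _ _ K) (u'P _ _ _ K).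
- have /choice[us usP] : forall i, exists u : term L W, forall (M : structure L) (e : U -> M) e',
    (forall v w, R v w -> e v = e' w) -> teval e (ts i) = teval e' u.
    by move=> i; apply: trelabel => v vi; apply: H; exists i.
  exists (FRel us) => M e e' K /=.
  suff -> : (fun i => teval e (ts i)) = (fun i => teval e' (us i)) by [].
  by apply/funext => i; exact: usP.
- have [|p1 p1P] := IH1 W R; first by move=> v vt; apply: H; left.
  have [|p2 p2P] := IH2 W R; first by move=> v vt; apply: H; right.
  by exists (FImp p1 p2) => M e e' K /=; rewrite (p1P _ _ _ K) (p2P _ _ _ K).
- pose R' (x : option U) (y : option W) :=
    match x, y with Some v, Some w => R v w | None, None => True | _, _ => False end.
  have [|psi psiP] := IH (option W) R'.
    by move=> [v /H[w vw]|_]; [exists (Some w)|exists None].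
  exists (FAll psi) => M e e' K /=.
  have E x : sat phi (env_cons x e) <-> sat psi (env_cons x e').
    by apply: psiP => -[v|] [w|] //=; exact: K.
  by split=> h x; apply/E.
Qed.

(** A formula mentions finitely many parameters. Pulling them out as a tuple leaves a formula
    without parameters, the form in which [divides] takes formulas; distality and dp-minimality also
    speak of finite tuples. *)
Lemma finite_params V (W : Type) (phi : formula L (V + W)) :
  exists k (psi : formula L (V + 'I_k)) (d : 'I_k -> W),
   (forall i, fv phi (inr (d i))) /\
   forall (M : structure L) (e : V -> M) (c : W -> M),
     sat phi (tcat e c) <-> sat psi (tcat e (c \o d)).
Proof.
have fW : finite_set [set w | fv phi (inr w)].
  apply: (@finite_preimage _ _ (fv phi) inr); last exact: fv_finite.
  by move=> x y _ _ [].
have [k [d dE]] := finite_set_ord_range fW.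
pose R (x : V + W) (y : V + 'I_k) :=
  match x, y with inl v, inl w => v = w | inr w, inr i => w = d i | _, _ => False end.
have [|psi psiP] := @relabel _ _ R phi.
  move=> [v _|w fw]; first by exists (inl v).
  have : range d w by rewrite -dE.
  by move=> [i _ <-]; exists (inr i).
exists k, psi, d; split=> [i|M e c].
  by have : range d (d i); [exists i|rewrite -dE].
by apply: psiP => -[v|w] [v'|i] //= ->.
Qed.

End Syntax.

(** * Definable sets and types *)

Definition fixes T (A : set T) (s : T -> T) : Prop := forall c, A c -> s c = c.

Section Definability.
Variables (L : language) (C : structure L).
Implicit Types (A B : set C).

Definition move_params (s : C -> C) V (x : V + C) : V + C :=
  match x with inl v => inl v | inr c => inr (s c) end.

Lemma psat_move V (phi : pformula C V) (s : C -> C) (a : V -> C) :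
  automorphism s -> psat (frename (move_params s (V := V)) phi) (s \o a) <-> psat phi a.
Proof.
move=> hs; rewrite /psat sat_rename -(aut_sat phi (tcat a id) hs).
by apply: sat_ext_fv => -[v|c].
Qed.

Lemma psat_aut V A (phi : pformula C V) (s : C -> C) (a : V -> C) :
  automorphism s -> fixes A s -> over A phi -> psat phi (s \o a) <-> psat phi a.
Proof.
move=> hs sA oA; rewrite /psat -(aut_sat phi (tcat a id) hs).
by apply: sat_ext_fv => -[v|c] //= /oA/sA.
Qed.

Lemma over_mono V A B (phi : pformula C V) : A `<=` B -> over A phi -> over B phi.
Proof. by move=> AB o c /o/AB. Qed.

Lemma definable_mono V A B (X : set (V -> C)) : A `<=` B -> definable A X -> definable B X.
Proof. by move=> AB [phi [o E]]; exists phi; split=> //; apply: over_mono o. Qed.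

Lemma definable_aut V A (X : set (V -> C)) (s : C -> C) (a : V -> C) :
  automorphism s -> fixes A s -> definable A X -> X (s \o a) <-> X a.
Proof. by move=> hs sA [phi [o ->]]; apply: psat_aut o. Qed.

Lemma type_definable_aut V A (X : set (V -> C)) (s : C -> C) (a : V -> C) :
  automorphism s -> fixes A s -> type_definable A X -> X (s \o a) <-> X a.
Proof.
move=> hs sA [S [SA ->]]; split=> H phi Sphi.
  by apply/(psat_aut _ hs sA (SA _ Sphi)); exact: H.
by apply/(psat_aut _ hs sA (SA _ Sphi)); exact: H.
Qed.

Lemma definable_params V A (X : set (V -> C)) :
  definable A X <-> exists k (phi : formula L (V + 'I_k)) (d : 'I_k -> C),
    range d `<=` A /\ X = [set a | sat phi (tcat a d)].
Proof.
split=> [[phi [o ->]]|[k [phi [d [dA ->]]]]].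
  have [k [psi [d [dP H]]]] := finite_params phi.
  exists k, psi, d; split=> [_ [i _ <-]|]; first exact/o/dP.
  by apply/seteqP; split=> a /=; have [h1 h2] := H C a id; [exact: h1|exact: h2].
pose t (x : V + 'I_k) : V + C := match x with inl v => inl v | inr i => inr (d i) end.
exists (frename t phi); split=> [c h|].
  by have [[v|i] //= _ [<-]] := fv_rename h; apply: dA; exists i.
apply/seteqP; split=> a /=; rewrite /psat sat_rename => H.
  by apply: (iffLR (sat_ext_fv _) H) => -[v|i].
by apply: (iffLR (sat_ext_fv _) H) => -[v|i].
Qed.

Lemma definable_not V A (X : set (V -> C)) : definable A X -> definable A (~` X).
Proof.
move=> [phi [o ->]]; exists (FNot phi); split=> //.
by move=> c [|] //; exact: o.
Qed.

Lemma definable_and V A (X Y : set (V -> C)) :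
  definable A X -> definable A Y -> definable A (X `&` Y).
Proof.
move=> [phi [o ->]] [psi [o' ->]]; exists (FAnd phi psi); split=> [c|].
  by rewrite /FAnd /= => -[[/o|[/o'|[]]]|[]].
by apply/seteqP; split=> a; rewrite /= /psat => /sat_and.
Qed.

Lemma definable_setT V A : definable A [set: V -> C].
Proof.
exists (FNot FFalse); split=> [c [|] []|].
by apply/seteqP; split=> a // _.
Qed.

Lemma definable_subst V W (t : V -> W + C) A (X : set (V -> C)) :
  (forall v c, t v = inr c -> A c) -> definable A X ->
  definable A [set b | X (fun v => match t v with inl w => b w | inr c => c end)].
Proof.
move=> tA [phi [o ->]].
pose t' (x : V + C) : W + C := match x with inl v => t v | inr c => inr c end.
exists (frename t' phi); split=> [c h|].
  by have [[v|c'] //=] := fv_rename h => [_ /tA|/o ? [<-]].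
have E b (v : V) : tcat b id (t v) = match t v with inl w => b w | inr c => c end.
  by case: (t v).
apply/seteqP; split=> b /=; rewrite /psat sat_rename => H.
  by apply: (iffLR (sat_ext_fv _) H) => -[v|i] //= _; rewrite E.
by apply: (iffLR (sat_ext_fv _) H) => -[v|i] //= _; rewrite E.
Qed.

Lemma definable_rename V W (t : V -> W) A (X : set (V -> C)) :
  definable A X -> definable A [set b : W -> C | X (b \o t)].
Proof. by move=> dX; apply: (@definable_subst V W (fun v => inl (t v)) A X). Qed.

Lemma definable_plug V W A (X : set (V + W -> C)) (d : W -> C) :
  range d `<=` A -> definable A X -> definable A [set b | X (tcat b d)].
Proof.
move=> dA dX; pose t (x : V + W) : V + C := match x with inl v => inl v | inr w => inr (d w) end.
have -> : [set b | X (tcat b d)] =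
  [set b | X (fun v => match t v with inl w => b w | inr c => c end)].
  by congr mkset; apply/funext => b; congr X; apply/funext => -[v|w].
by apply: definable_subst dX => -[v|w] //= c [<-]; apply: dA; exists w.
Qed.

Lemma definable_eqv V A (v w : V) : definable A [set a : V -> C | a v = a w].
Proof.
exists (FEq (TVar _ (inl v)) (TVar _ (inl w))); split=> // c [] //.
Qed.

Lemma definable_exn n V A (X : set (V + 'I_n -> C)) :
  definable A X -> definable A [set a | exists b, X (tcat a b)].
Proof.
move/definable_params => [k [phi [d [dA ->]]]]; apply/definable_params.
pose t (x : V + 'I_n + 'I_k) : V + 'I_k + 'I_n := match x with
  | inl (inl v) => inl (inl v) | inl (inr i) => inr i | inr j => inl (inr j) end.
exists k, (FExn (frename t phi)), d; split=> //; apply/seteqP; split=> a /=.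
  move=> [b H]; apply/sat_exn; exists b; rewrite sat_rename.
  by apply: (iffLR (sat_ext_fv _) H) => -[[v|i]|j].
move/sat_exn => [b]; rewrite sat_rename => H; exists b.
by apply: (iffLR (sat_ext_fv _) H) => -[[v|i]|j].
Qed.

Lemma tpP V A (a b : V -> C) :
  tp A a = tp A b <-> forall X, definable A X -> X a -> X b.
Proof.
split=> [E X [phi [o ->]] aX|H].
  by have : tp A a phi by []; rewrite E => -[].
apply/seteqP; split=> phi [o aP]; split=> //.
  by apply: (H [set a | psat phi a]) => //; exists phi.
apply: contrapT => nP; suff: psat (FNot phi) b by exact.
apply: (H [set a | psat (FNot phi) a]) => //; exists (FNot phi); split=> // c [|] //.
exact: o.
Qed.

Lemma tp_aut V A (s : C -> C) (a : V -> C) :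
  automorphism s -> fixes A s -> tp A (s \o a) = tp A a.
Proof. by move=> hs sA; apply/tpP => X dX /(definable_aut _ hs sA dX). Qed.

Lemma tp_rename V W A (t : V -> W) (a b : W -> C) :
  tp A a = tp A b -> tp A (a \o t) = tp A (b \o t).
Proof. by move=> /tpP H; apply/tpP => X /(definable_rename t); exact: H. Qed.

End Definability.

(** * Conjugacy of tuples with the same type *)

Section Homogeneity.
Variables (L : language) (C : structure L) (kappa : Type).
Hypothesis homC : strongly_homogeneous C kappa.

(** Strong homogeneity extends partial elementary maps, so the identity on [A] and the assignment of
    [b] to [a] are merged into one map [f]. It is well defined because equalities between two
    coordinates, or between a coordinate and an element of [A], are part of the type. *)
Lemma tp_conj V A (a b : V -> C) :
  small kappa (A `|` range a) -> tp A a = tp A b ->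
  exists s, [/\ automorphism s, fixes A s & s \o a = b].
Proof.
move=> sm /tpP ab.
have ab' (phi : pformula C V) : over A phi -> psat phi a -> psat phi b.
  by move=> o; apply: (ab [set a | psat phi a]); exists phi.
pose isv c v := a v = c.
pose f c := if pselect (exists v, a v = c) is left h then b (projT1 (cid h)) else c.
have bE v w : a v = a w -> b v = b w.
  by move=> E; apply: (ab [set a | a v = a w]) => //; exact: definable_eqv.
have fa v : f (a v) = b v.
  rewrite /f; case: pselect => [h|[]]; last by exists v.
  by case: cid => w /= /bE.
have fA c : A c -> f c = c.
  move=> Ac; rewrite /f; case: pselect => // h; case: cid => v /= E.
  apply: (ab' (FEq (TVar _ (inl v)) (TVar _ (inr c)))) => // c' [|[->]] //.
have pe : partial_elementary (A `|` range a) f.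
  move=> phi.
  (* An element that is both in [A] and a coordinate of [a] is read as a coordinate, the same choice
     as in [f]. *)
  pose t (x : A `|` range a) : V + C :=
    if pselect (exists v, a v = val x) is left h then inl (projT1 (cid h)) else inr (val x).
  have oA : over A (frename t phi).
    move=> c h; have [x _] := fv_rename h; rewrite /t; case: pselect => // nh [<-].
    by case: (set_mem (valP x)) => // -[v _ E]; case: nh; exists v.
  have E1 : psat (frename t phi) a <-> sat phi (fun x : A `|` range a => val x).
    rewrite /psat sat_rename; apply: sat_ext_fv => x _ /=; rewrite /t.
    by case: pselect => //= h; case: cid.
  have E2 : psat (frename t phi) b <-> sat phi (fun x : A `|` range a => f (val x)).
    rewrite /psat sat_rename; apply: sat_ext_fv => x _ /=; rewrite /t /f.
    by case: pselect.
  split; first by move/E1/(ab' _ oA)/E2.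
  move=> H; apply: contrapT => nH; suff: psat (FNot (frename t phi)) b by apply; apply/E2.
  by apply: ab' => [c [|]// /oA|/E1].
have [s [hs sE]] := homC sm pe; exists s; split=> //.
  by move=> c Ac; rewrite sE ?fA //; left.
by apply/funext => v /=; rewrite sE ?fa //; right; exists v.
Qed.

End Homogeneity.

(** * Small sets *)

Lemma card_le_fun T U (A : set T) (B : set U) (f : T -> U) :
  (forall x, A x -> B (f x)) -> (forall x y, A x -> A y -> f x = f y -> x = y) ->
  A #<= B.
Proof.
move=> fAB finj.
have /andP[_ h'] : (f @` A #<= A) && (A #<= f @` A).
  by rewrite -card_eq_le inj_card_eq // => x y /set_mem Ax /set_mem Ay; exact: finj.
by apply: card_le_trans h' _; apply: subset_card_le => _ [x Ax <-]; exact: fAB.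
Qed.

Lemma card_le_funP T U (u0 : U) (A : set T) (B : set U) :
  A #<= B -> exists f : T -> U,
    (forall x, A x -> B (f x)) /\ (forall x y, A x -> A y -> f x = f y -> x = y).
Proof.
move=> /card_leP[F].
exists (fun x => if pselect (A x) is left h then val (F (exist _ x (mem_set h))) else u0).
split=> [x Ax|x y Ax Ay].
  by case: pselect => // h; exact: set_valP.
case: pselect => // hx; case: pselect => // hy /val_inj E.
have /(congr1 val) := inj (in_setT _) (in_setT _) E.
by [].
Qed.

(** Zorn's lemma on partial injections, seen as sets of pairs: a maximal one is defined on all of
    [A] or reaches all of [B]. *)
Lemma card_le_total T U (A : set T) (B : set U) : A #<= B \/ B #<= A.
Proof.
pose P (R : set (T * U)) := (R `<=` A `*` B) /\
  forall x y, R x -> R y -> x.1 = y.1 <-> x.2 = y.2.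
have [|R [[RAB Rinj] Rmax]] := @Zorn_bigcup (T * U)%type P.
  move=> F FP Ftot; split=> [x [R /FP [h _]]|x y [R FR Rx] [S FS Sy]]; first exact: h.
  case: (Ftot _ _ FR FS) => RS.
    by case: (FP _ FS) => _; apply => //; exact: RS.
  by case: (FP _ FR) => _; apply => //; exact: RS.
have [Atot|/existsNP[a]] := pselect (forall a, A a -> exists b, R (a, b)).
  left; have [a0|nA] := pselect (exists a, A a); last first.
    have -> : A = set0 by apply/seteqP; split=> // a Aa; apply: nA; exists a.
    exact: card_ge0.
  have /choice[f fP] : forall a, exists b, A a -> R (a, b).
    move=> a; have [/Atot[b]|nAa] := pselect (A a); first by exists b.
    by case: a0 => a' /Atot [b _]; exists b.
  apply: (@card_le_fun _ _ _ _ f) => [x Ax|x y Ax Ay E].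
    by have [] := RAB _ (fP _ Ax).
  exact: (iffRL (Rinj _ _ (fP _ Ax) (fP _ Ay)) E).
move=> /not_implyP[Aa na]; right.
have Btot b : B b -> exists a, R (a, b).
  move=> Bb; apply: contrapT => nb.
  apply: (Rmax (R `|` [set (a, b)])); last first.
    split=> [x [/RAB//|->//]|x y].
    move=> [Rx|->] [Ry|->] //=; first exact: Rinj.
      split=> E; [case: na; exists x.2; rewrite -E; by case: x Rx {E}|].
      by case: nb; exists x.1; rewrite -E; case: x Rx {E}.
    split=> E; [case: na; exists y.2; rewrite E; by case: y Ry {E}|].
    by case: nb; exists y.1; rewrite E; case: y Ry {E}.
  split; first by left.
  by move=> h; case: na; exists b; apply: h; right.
have [b0|nB] := pselect (exists b, B b); last first.
  have -> : B = set0 by apply/seteqP; split=> // b Bb; apply: nB; exists b.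
  exact: card_ge0.
have /choice[f fP] : forall b, exists a, B b -> R (a, b).
  move=> b; have [/Btot[c]|nBb] := pselect (B b); first by exists c.
  by exists a.
apply: (@card_le_fun _ _ _ _ f) => [x Bx|x y Bx By E].
  by have [] := RAB _ (fP _ Bx).
exact: (iffLR (Rinj _ _ (fP _ Bx) (fP _ By)) E).
Qed.

Section Small.
Variable kappa : Type.
Hypothesis SL : strong_limit kappa.
Hypothesis smallN : small kappa [set: nat].

Lemma small_le T U (A : set T) (B : set U) : A #<= B -> small kappa B -> small kappa A.
Proof.
move=> AB [Bk kB]; split; first exact: card_le_trans AB Bk.
by move=> kA; apply: kB; exact: card_le_trans kA AB.
Qed.

Lemma small_sub T (A B : set T) : A `<=` B -> small kappa B -> small kappa A.
Proof. by move=> AB; apply: small_le; exact: subset_card_le. Qed.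

Lemma small_image T U (f : T -> U) (A : set T) : small kappa A -> small kappa (f @` A).
Proof. by apply: small_le; exact: card_image_le. Qed.

Lemma small_countable T (A : set T) : countable A -> small kappa A.
Proof. by move=> cA; apply: small_le smallN. Qed.

Lemma small_range T U (f : T -> U) : countable [set: T] -> small kappa (range f).
Proof. by move=> cT; apply/small_image/small_countable. Qed.

Lemma small_pow T (A : set T) : small kappa A -> small kappa [set Y | Y `<=` A].
Proof.
move=> smA; have [Ak _] := smA.
have [k0 _] : exists k : kappa, True.
  apply: contrapT => nk; case: smallN => _; apply.
  have -> : [set: kappa] = set0 by apply/seteqP; split=> // k _; apply: nk; exists k.
  exact: card_ge0.
have [f [_ finj]] := card_le_funP k0 Ak.
apply: small_le (SL (small_image f smA)).
apply: (@card_le_fun _ _ _ _ (fun Y => f @` Y)) => [Y YA|Y Z YA ZA E].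
  by move=> _ [y Yy <-]; exists y => //; exact: YA.
apply/seteqP; split=> y Yy.
  have : (f @` Y) (f y) by exists y.
  by rewrite E => -[z Zz /finj <-]; [|exact: ZA|exact: YA].
have : (f @` Z) (f y) by exists y.
by rewrite -E => -[z Zz /finj <-]; [|exact: YA|exact: ZA].
Qed.

(** Kuratowski pairs embed the square in the double power set, so the strong limit hypothesis is
    enough, for finite sets as well as infinite ones. *)
Lemma small_square T (A : set T) : small kappa A -> small kappa (A `*` A).
Proof.
move=> smA; apply: small_le (small_pow (small_pow smA)).
apply: (@card_le_fun _ _ _ _ (fun x => [set [set x.1]; [set x.1; x.2]])).
  by move=> [x y] [/= Ax Ay] Y [] -> z; [move->|move=> [] ->].
move=> [x y] [z w] /= _ _ E.
have E1 : [set z] = [set x] \/ [set z] = [set x; y].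
  have : [set [set z]; [set z; w]] [set z] by left.
  by rewrite -E => -[]; [left|right].
have xz : x = z.
  case: E1 => E1; first by have : [set x] x by []; rewrite -E1.
  have : [set x; y] x by left.
  by rewrite -E1 => ->.
rewrite -xz in E *; congr pair.
have : [set [set x]; [set x; w]] [set x; y] by rewrite -E; right.
have : [set [set x]; [set x; y]] [set x; w] by rewrite E; right.
move=> [] E2 [] E3.
- have : [set x; w] w by right.
  have : [set x; y] y by right.
  by rewrite E2 E3 => -> ->.
- have : [set x; w] w by right.
  have : [set x; y] y by right.
  by rewrite E3 E2 => -> ->.
- have : [set x; w] w by right.
  have : [set x; y] y by right.
  by rewrite E2 E3 => -> ->.
- have yw : [set x; w] y by rewrite -E3; right.
  have wy : [set x; y] w by rewrite -E2; right.
  by case: yw => [yx|//]; case: wy => [wx|//]; rewrite yx wx.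
Qed.

Lemma small_setX T U (A : set T) (B : set U) :
  small kappa A -> small kappa B -> small kappa (A `*` B).
Proof.
move=> smA smB.
have [[a0 Aa0]|nA] := pselect (exists a, A a); last first.
  apply: small_le smA; suff -> : A `*` B = set0 by exact: card_ge0.
  by apply/seteqP; split=> // -[x y] [/= Ax _]; apply: nA; exists x.
have [[b0 Bb0]|nB] := pselect (exists b, B b); last first.
  apply: small_le smA; suff -> : A `*` B = set0 by exact: card_ge0.
  by apply/seteqP; split=> // -[x y] [/= _ Bx]; apply: nB; exists y.
case: (card_le_total A B) => [/(card_le_funP b0)|/(card_le_funP a0)] [f [fB finj]].
  apply: small_le (small_square smB).
  apply: (@card_le_fun _ _ _ _ (fun x => (f x.1, x.2))).
    by move=> [x y] [/= Ax By]; split=> //=; exact: fB.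
  by move=> [x y] [z w] [/= Ax By] [/= Az Bw] [/finj -> // ->].
apply: small_le (small_square smA).
apply: (@card_le_fun _ _ _ _ (fun x => (x.1, f x.2))).
  by move=> [x y] [/= Ax By]; split=> //=; exact: fB.
by move=> [x y] [z w] [/= Ax By] [/= Az Bw] [-> /finj ->].
Qed.

Lemma small_sum T U : small kappa [set: T] -> small kappa [set: U] ->
  small kappa [set: T + U].
Proof.
move=> smT smU.
have smo V : small kappa [set: V] -> small kappa [set: option V].
  move=> smV; apply: small_le (small_pow smV).
  apply: (@card_le_fun _ _ _ _ (fun o => if o is Some v then [set v] else set0)) => // -[x|] [y|] _ _ //.
  - move=> /= E; have : [set y] x by rewrite -E.
    by move=> ->.
  - by move=> /= E; have : set0 x by rewrite -E.
  - by move=> /= E; have : set0 y by rewrite E.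
apply: small_le (small_setX (smo _ smT) (smo _ smU)).
apply: (@card_le_fun _ _ _ _ (fun z =>
  match z with inl x => (Some x, None) | inr y => (None, Some y) end)) => //.
by move=> [x|x] [y|y] _ _ //= [->].
Qed.

Lemma small_setT T (A : set T) : small kappa [set: A] <-> small kappa A.
Proof.
split; apply: small_le.
  by have := card_setT_sym A; rewrite card_eq_le => /andP[].
by have := card_setT A; rewrite card_eq_le => /andP[].
Qed.

Lemma small_setU T (A B : set T) : small kappa A -> small kappa B -> small kappa (A `|` B).
Proof.
move=> smA smB; have smS : small kappa [set: A + B] by apply: small_sum; apply/small_setT.
apply: small_sub (small_image (fun z : A + B => match z with inl x => val x | inr y => val y end) smS).
by move=> x [Ax|Bx]; [exists (inl (exist _ x (mem_set Ax)))|exists (inr (exist _ x (mem_set Bx)))].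
Qed.

Lemma small_seq T : small kappa [set: T] -> small kappa [set: seq T].
Proof.
move=> smT; apply: small_le (small_pow (small_setX smallN smT)).
apply: (@card_le_fun _ _ _ _ (fun s => [set x | onth s x.1 = Some x.2])) => // s t _ _ E.
have H n : onth s n = onth t n.
  case sn : (onth s n) => [x|]; first by have : [set x | onth s x.1 = Some x.2] (n, x) by []; rewrite E /= => ->.
  case tn : (onth t n) => [x|] //.
  by have : [set x | onth t x.1 = Some x.2] (n, x) by []; rewrite -E /= sn.
elim: s t H {E} => [|x s IH] [|y t] H //.
- by have := H 0.
- by have := H 0.
by have /= [->] := H 0; congr cons; apply: IH => n; exact: (H n.+1).
Qed.

End Small.

(** * Elementary substructures *)

Section LoewenheimSkolem.
Variables (L : language) (C : structure L) (kappa : Type).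
Hypothesis SL : strong_limit kappa.
Hypothesis smallL : small kappa [set: formula L nat].

Lemma small_nat : small kappa [set: nat].
Proof.
apply: small_le smallL.
by apply: (@card_le_fun _ _ _ _ (fun n => FEq (TVar L n) (TVar L n))) => // m n _ _ [].
Qed.

(** Variable 0 is the witness and variable n + 1 reads entry n of [s]. Beyond the end of [s] the
    value is [c0], so that a finite list is an environment for all variables. *)
Definition skolem (c0 : C) (phi : formula L nat) (s : seq C) : C :=
  let e x n := if n is n'.+1 then nth c0 s n' else x in
  if pselect (exists x, sat phi (e x)) is left h then projT1 (cid h) else c0.

Lemma skolemP c0 phi s x :
  sat phi (fun n => if n is n'.+1 then nth c0 s n' else x) ->
  sat phi (fun n => if n is n'.+1 then nth c0 s n' else skolem c0 phi s).
Proof.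
move=> h; rewrite /skolem; case: pselect => [h'|[]]; last by exists x.
by case: cid.
Qed.

(* The terms of the Skolem language: an application lists the defining formula
   and then the arguments. *)
Fixpoint sk_eval (c0 : C) (A : set C) (t : GenTree.tree (A + formula L nat)) : C :=
  match t with
  | GenTree.Leaf (inl a) => val a
  | GenTree.Node _ (GenTree.Leaf (inr phi) :: ts) =>
      skolem c0 phi (map (@sk_eval c0 A) ts)
  | _ => c0
  end.

Lemma small_tree T : small kappa [set: T] -> small kappa [set: GenTree.tree T].
Proof.
move=> smT; apply: small_le (small_seq SL small_nat (small_sum SL small_nat small_nat smT)).
apply: (@card_le_fun _ _ _ _ (@GenTree.encode T)) => // x y _ _.
exact: (pcan_inj (GenTree.codeK T)).
Qed.

Lemma tarski_vaught (M : set C) (c0 : C) : M c0 ->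
  (forall phi s, (forall i, M (nth c0 s i)) -> M (skolem c0 phi s)) ->
  elementary_substructure M.
Proof.
move=> Mc0 Msk.
(* Formulas may have variables in any type, whereas [skolem] wants natural numbers: the free
   variables of [phi] are numbered from 1, and 0 is kept for the witness. *)
have wit V (phi : formula L (option V)) (e : V -> C) x : (forall v, M (e v)) ->
    sat phi (env_cons x e) -> exists y, M y /\ sat phi (env_cons y e).
  move=> Me h; have [n [d dE]] := finite_set_ord_range (fv_finite phi).
  pose R (o : option V) (m : nat) := match o, m with
    | None, 0 => True
    | Some v, m'.+1 => exists2 i : 'I_n, d i = Some v & m' = i
    | _, _ => False end.
  have [|psi psiP] := @relabel L _ _ R phi.
    move=> [v|] fo; last by exists 0.
    by move: fo; rewrite dE => -[i _ iv]; exists i.+1, i.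
  pose s := [seq (if d i is Some v then e v else c0) | i <- enum 'I_n].
  have sP v m : R (Some v) m.+1 -> e v = nth c0 s m.
    move=> [i iv ->]; rewrite (nth_map i) ?size_enum_ord // nth_ord_enum.
    by rewrite iv.
  have E y : sat phi (env_cons y e) <-> sat psi (fun k => if k is k'.+1 then nth c0 s k' else y).
    by apply: psiP => -[v|] [|m] // /sP.
  exists (skolem c0 psi s); split; last by apply/E/(@skolemP _ _ _ x)/E.
  apply: Msk => i; have [si|si] := ltnP i (size s); last by rewrite nth_default.
  have si' : i < n by rewrite size_map size_enum_ord in si.
  rewrite (nth_map (Ordinal si')) ?size_enum_ord //.
  by case: (d _).
(* Closure under function symbols is itself an instance of [wit], for the formula that equates the
   witness with the value. *)
have Mf (f : Defs.fsym L) (t : 'I_(farity f) -> M) : M (fint (fun i => val (t i))).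
  pose phi : formula L (option 'I_(farity f)) :=
    FEq (TVar L None) (TApp (fun i => TVar L (Some i))).
  have Mt i : M (val (t i)) by exact: set_valP.
  have h : sat phi (env_cons (fint (fun i => val (t i))) (fun i => val (t i))) by [].
  have [y [My yE]] := wit _ phi _ _ Mt h.
  by rewrite /= in yE; rewrite -yE.
pose N := @Structure L M (inhabits (exist _ c0 (mem_set Mc0)))
  (fun f t => exist _ (fint (fun i => val (t i))) (mem_set (Mf f t)))
  (fun r t => rint (fun i => val (t i))).
exists N, (fun x : M => val x); split; last first.
  apply/seteqP; split=> [_ [x _ <-]|x Mx]; first exact: set_valP.
  by exists (exist _ x (mem_set Mx)).
have te V (t : term L V) (e : V -> N) : val (teval e t : M) = teval (fun v => val (e v : M)) t.
  by elim: t => //= f ts IH; congr fint; apply/funext => i; exact: IH.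
have el V (phi : formula L V) (e : V -> N) : sat phi e <-> sat phi (fun v => val (e v : M)).
  elim: phi e => [U|U t u|U r ts|U phi1 IH1 phi2 IH2|U phi IH] e /=.
  - by [].
  - by rewrite -!te; split=> [->//|/val_inj].
  - suff -> : (fun i => val (teval e (ts i) : M)) = (fun i => teval (fun v => val (e v : M)) (ts i)) by [].
    by apply/funext => i.
  - by rewrite IH1 IH2.
  - have E (x : N) : (fun v => val (env_cons x e v : M)) = env_cons (val (x : M)) (fun v => val (e v : M)).
      by apply/funext => -[].
    split=> H x; last by apply/IH; rewrite E.
    apply: contrapT => nx.
    have Me v : M (val (e v : M)) by exact: set_valP.
    have [y [My]] := wit _ (FNot phi) _ _ Me nx.
    apply; have := H (exist _ y (mem_set My)).
    by move/IH; rewrite E.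
by move=> n phi e; exact: el.
Qed.

Lemma loewenheim_skolem (A : set C) : small kappa A ->
  exists M, [/\ A `<=` M, small kappa M & elementary_substructure M].
Proof.
move=> smA; have [c0] := dom_inh C.
exists (range (@sk_eval c0 A)); split.
- by move=> a Aa; exists (GenTree.Leaf (inl (exist _ a (mem_set Aa)))).
- apply: small_image; apply: small_tree; apply: (small_sum SL small_nat) => //.
  by apply/small_setT.
apply: (@tarski_vaught _ c0).
  by exists (GenTree.Node 0 [::]).
move=> phi s sM.
have /choice[t tP] : forall i, exists t, @sk_eval c0 A t = nth c0 s i.
  by move=> i; have [t _ <-] := sM i; exists t.
exists (GenTree.Node 0 (GenTree.Leaf (inr phi) :: [seq t i | i <- iota 0 (size s)])) => //=.
congr skolem; rewrite -map_comp; apply: (@eq_from_nth _ c0); rewrite size_map size_iota //.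
by move=> i si; rewrite (nth_map 0) ?size_iota //= nth_iota // tP.
Qed.

Lemma elementary_sat (M N : structure L) (j : M -> N) V (phi : formula L V) (e : V -> M) :
  elementary j -> sat phi e <-> sat phi (j \o e).
Proof.
move=> el; have [n [d dE]] := finite_set_ord_range (fv_finite phi).
have [|psi psiP] := @relabel L _ _ (fun v i => d i = v) phi.
  by move=> v; rewrite dE => -[i _ <-]; exists i.
rewrite (psiP _ e (e \o d)) => [|v i <-//].
by rewrite (psiP _ (j \o e) (j \o (e \o d))) => [|v i <-//].
Qed.

Lemma elementary_witness (M : set C) n (X : set ('I_n -> C)) :
  elementary_substructure M -> definable M X -> X !=set0 ->
  exists a, X a /\ range a `<=` M.
Proof.
move=> [N [j [el jM]]] /definable_params [k [phi [d [dM ->]]]] [a aX].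
have /choice[d' d'E] : forall i, exists x, j x = d i.
  by move=> i; have : M (d i) by [apply: dM; exists i]; rewrite -jM => -[x _ <-]; exists x.
have dE : d = j \o d' by apply/funext => i /=; rewrite d'E.
pose t (x : 'I_n + 'I_k) : 'I_k + 'I_n := match x with inl i => inr i | inr i => inl i end.
have : sat (FExn (frename t phi)) d.
  apply/sat_exn; exists a; rewrite sat_rename.
  by apply: (iffLR (sat_ext_fv _) aX) => -[].
rewrite dE => /(iffRL (elementary_sat _ _ el))/sat_exn [b]; rewrite sat_rename => H.
exists (j \o b); split; last by move=> _ [i _ <-]; rewrite -jM; exists (b i).
have := iffLR (elementary_sat _ _ el) H.
by apply: (iffLR (sat_ext_fv _)) => -[].
Qed.

End LoewenheimSkolem.

(** * Global types *)

Section Saturation.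
Variables (L : language) (C : structure L) (kappa : Type).
Hypothesis SL : strong_limit kappa.
Hypothesis smallN : small kappa [set: nat].
Hypothesis satC : saturated C kappa.

Definition directed V (F : set (set (V -> C))) :=
  forall X Y, F X -> F Y -> exists Z, F Z /\ Z `<=` X `&` Y.

Lemma saturated1 (A : set C) (F : set (set (unit -> C))) :
  small kappa A -> (forall X, F X -> definable A X) -> (forall X, F X -> X !=set0) ->
  directed F -> exists a, forall X, F X -> X a.
Proof.
move=> smA Fdef Fne Fdir; have [c0] := dom_inh C.
have [[X0 FX0]|nF] := pselect (exists X, F X); last first.
  by exists (fun=> c0) => X FX; case: nF; exists X.
pose S := [set phi | over A phi /\ F [set a | psat phi a]].
have [| |a aS] := satC (S := S) smA; first by move=> phi [].
  move=> K KS /finite_set_ord_range [n [d dK]].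
  suff [X [FX XK]] : exists X, F X /\ forall a, X a -> forall i, psat (d i) a.
    have [a aX] := Fne _ FX; exists a => phi; rewrite dK => -[i _ <-].
    exact: (XK a aX).
  have {KS} : forall i, F [set a | psat (d i) a].
    by move=> i; have /KS [] : K (d i) by [rewrite dK; exists i].
  elim: n d {dK} => [|n IH] d dF; first by exists X0; split=> // a _ [].
  have [X [FX XK]] := IH (d \o lift ord0) (fun i => dF _).
  have [Z [FZ ZX]] := Fdir _ _ FX (dF ord0).
  exists Z; split=> // a /ZX [/XK h h0] i.
  by case: (unliftP ord0 i) => [j ->|->//]; exact: h.
exists a => X FX; have [phi [o E]] := Fdef _ FX.
by rewrite E; apply: (aS phi); split=> //; rewrite -E.
Qed.

Definition ocons n (x : C) (b : 'I_n -> C) (i : 'I_n.+1) : C :=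
  if unlift ord0 i is Some j then b j else x.

Lemma ocons_eta n (a : 'I_n.+1 -> C) : ocons (a ord0) (a \o lift ord0) = a.
Proof. by apply/funext => i; rewrite /ocons; case: unliftP => [j ->|->]. Qed.

Lemma definable_ocons n (A : set C) (X : set ('I_n.+1 -> C)) :
  definable A X -> definable A [set u : unit + 'I_n -> C | X (ocons (u (inl tt)) (u \o inr))].
Proof.
pose t (i : 'I_n.+1) : unit + 'I_n := if unlift ord0 i is Some j then inr j else inl tt.
move/(definable_rename t); congr definable.
apply/funext => u; congr X; apply/funext => i; rewrite /ocons /t /=.
by case: (unlift _ _).
Qed.

(** Saturation concerns a single variable, so the coordinates are found one at a time: [u] realizes
    the projections of the family, and the remaining coordinates are sought in the fibres over [u],
    now an additional parameter. Directedness passes to projections and fibres. *)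
Lemma saturatedn n (A : set C) (F : set (set ('I_n -> C))) :
  small kappa A -> (forall X, F X -> definable A X) -> (forall X, F X -> X !=set0) ->
  directed F -> exists a, forall X, F X -> X a.
Proof.
elim: n A F => [|n IH] A F smA Fdef Fne Fdir.
  exists (of_I0 C) => X /Fne [a aX]; suff -> : of_I0 C = a by [].
  by apply/funext => -[].
pose p1 (X : set ('I_n.+1 -> C)) := [set u : unit -> C | exists b, X (ocons (u tt) b)].
have [| | |u uF] := @saturated1 A (p1 @` F) smA.
- move=> _ [X FX <-].
  have := definable_exn (definable_ocons (Fdef _ FX)).
  congr definable; apply/funext => u; apply/propext; split=> -[b bX]; exists b;
    by move: bX; congr X; congr ocons.
- move=> _ [X /Fne [a aX] <-]; exists (fun=> a ord0), (a \o lift ord0).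
  by rewrite ocons_eta.
- move=> _ _ [X FX <-] [Y FY <-]; have [Z [FZ ZXY]] := Fdir _ _ FX FY.
  exists (p1 Z); split; first by exists Z.
  by move=> u [b /ZXY [bX bY]]; split; exists b.
pose p2 (X : set ('I_n.+1 -> C)) := [set b | X (ocons (u tt) b)].
have [| | | |b bF] := IH (A `|` [set u tt]) (p2 @` F).
- apply: small_setU => //; apply: small_countable => //; exact: countable1.
- move=> _ [X FX <-].
  pose sw (x : unit + 'I_n) : 'I_n + unit := match x with inl y => inr y | inr y => inl y end.
  have := definable_rename sw (definable_ocons (definable_mono (@subsetUl _ A [set u tt]) (Fdef _ FX))).
  move/(@definable_plug _ _ _ _ _ _ u); have h : range u `<=` A `|` [set u tt].
    by move=> _ [[] _ <-]; right.
  by move/(_ h); congr definable.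
- by move=> _ [X FX <-]; have : p1 X u by [apply: uF; exists X].
- move=> _ _ [X FX <-] [Y FY <-]; have [Z [FZ ZXY]] := Fdir _ _ FX FY.
  exists (p2 Z); split; first by exists Z.
  by move=> b /ZXY.
by exists (ocons (u tt) b) => X FX; apply: (bF (p2 X)); exists X.
Qed.

End Saturation.

(** * Global types as ultrafilters of definable sets *)

Section GlobalTypes.
Variables (L : language) (C : structure L).

(* A global complete type is handled as the ultrafilter of the definable sets it contains. *)
Record gtype V (P : set (set (V -> C))) : Prop := Gtype {
  gt_def : forall X, P X -> definable setT X;
  gt_ne : forall X, P X -> X !=set0;
  gt_and : forall X Y, P X -> P Y -> P (X `&` Y);
  gt_compl : forall X, definable setT X -> P X \/ P (~` X)
}.

Definition ginv V (B : set C) (P : set (set (V -> C))) : Prop :=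
  forall s, automorphism s -> fixes B s -> forall X, P X -> P [set a | X (s \o a)].

Definition real V (P : set (set (V -> C))) (A : set C) (x : V -> C) : Prop :=
  forall X, definable A X -> P X -> X x.

Lemma definable_setTS V A (X : set (V -> C)) : definable A X -> definable setT X.
Proof. exact: definable_mono. Qed.

Lemma definable_pre_aut V A (X : set (V -> C)) s t : automorphism s -> cancel s t ->
  cancel t s -> definable A X -> definable (t @` A) [set a | X (s \o a)].
Proof.
move=> hs sK tK /definable_params [k [phi [d [dA ->]]]]; apply/definable_params.
exists k, phi, (t \o d); split=> [_ [i _ <-]|].
  by exists (d i) => //; apply: dA; exists i.
have E a : tcat (s \o a) d = s \o tcat a (t \o d).
  by apply/funext => -[v|i] //=; rewrite tK.
by apply/seteqP; split=> a /=; rewrite E => /(aut_sat _ _ hs).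
Qed.

Lemma real_mono V (P : set (set (V -> C))) A A' x : A' `<=` A -> real P A x -> real P A' x.
Proof. by move=> AA rx X /(definable_mono AA); exact: rx. Qed.

Lemma real_tp V (P : set (set (V -> C))) A x y : gtype P -> real P A x -> real P A y ->
  tp A x = tp A y.
Proof.
move=> gP rx ry; apply/tpP => X dX xX.
case: (gt_compl gP (definable_setTS dX)) => PX; first exact: ry.
by have := rx _ (definable_not dX) PX.
Qed.

Lemma real_aut V (P : set (set (V -> C))) A B x s : ginv B P -> automorphism s -> fixes B s ->
  real P A x -> real P (s @` A) (s \o x).
Proof.
move=> iP hs sB rx X dX PX.
have [t [ht sK tK]] := aut_inv hs.
have := rx [set a | X (s \o a)]; apply; last exact: iP.
have := definable_pre_aut hs sK tK dX; congr definable.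
apply/seteqP; split=> [_ [_ [a Aa <-] <-]|a Aa]; first by rewrite sK.
by exists (s a); [exists a|rewrite sK].
Qed.

Lemma real_ex n (kappa : Type) (P : set (set ('I_n -> C))) A :
  strong_limit kappa -> small kappa [set: nat] -> saturated C kappa ->
  gtype P -> small kappa A -> exists x, real P A x.
Proof.
move=> SL smN sC gP smA.
have [|||x xP] := @saturatedn _ _ _ SL smN sC n A [set X | definable A X /\ P X] smA.
- by move=> X [].
- by move=> X [_]; exact: gt_ne.
- move=> X Y [dX PX] [dY PY]; exists (X `&` Y); split=> //.
  by split; [exact: definable_and|exact: gt_and].
by exists x => X dX PX; exact: xP.
Qed.

(** The average type along an ultrafilter. The index type is arbitrary because coheirs of a type
    over a model arise as averages indexed by all tuples of the model. *)
Definition avtype V I (U : set_system I) (a : I -> V -> C) : set (set (V -> C)) :=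
  [set X | definable setT X /\ U [set i | X (a i)]].

Lemma avtype_gtype V I (U : set_system I) (a : I -> V -> C) :
  UltraFilter U -> gtype (avtype U a).
Proof.
move=> uU; split.
- by move=> X [].
- by move=> X [_ /filter_ex [i]]; exists (a i).
- move=> X Y [dX UX] [dY UY]; split; first exact: definable_and.
  exact: filterI UX UY.
- move=> X dX; case: (in_ultra_setVsetC [set i | X (a i)] uU) => h; first by left.
  by right; split=> //; exact: definable_not.
Qed.

Lemma avtype_inv V I (U : set_system I) (a : I -> V -> C) (B : set C) :
  UltraFilter U -> (forall i, range (a i) `<=` B) -> ginv B (avtype U a).
Proof.
move=> uU aB s hs sB X [dX UX]; split.
  have [t [ht sK tK]] := aut_inv hs.
  exact: definable_setTS (definable_pre_aut hs sK tK dX).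
apply: filterS UX => i /=; suff -> : s \o a i = a i by [].
by apply/funext => v /=; apply: sB; apply: (aB i); exists v.
Qed.

Definition ptype V (p : set (pformula C V)) : set (set (V -> C)) :=
  [set X | exists phi, p phi /\ X = [set a | psat phi a]].

Lemma finite_set3 T (x y z : T) : finite_set [set x; y; z].
Proof. by rewrite !finite_setU; do !split; exact: finite_set1. Qed.

Lemma ptype_mem V (p : set (pformula C V)) phi : global_type p ->
  ptype p [set a | psat phi a] -> p phi.
Proof.
move=> [fs cp] [psi [ppsi E]]; case: (cp phi) => // pn.
(* The second [psi] only brings the pair to the shape of [finite_set3]. *)
have [|a aP] := fs [set psi; FNot phi; psi] _ (finite_set3 _ _ _).
  by move=> c [[->|->]|->].
have h1 : psat psi a by apply: aP; left; left.
have : psat (FNot phi) a by apply: aP; left; right.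
by case; have : [set a | psat phi a] a by rewrite E.
Qed.

Lemma ptype_gtype V (p : set (pformula C V)) : global_type p -> gtype (ptype p).
Proof.
move=> gp; have [fs cp] := gp.
have ne X : ptype p X -> X !=set0.
  move=> [phi [pphi ->]]; have [|a aP] := fs [set phi] _ (finite_set1 _); first by move=> _ ->.
  by exists a; exact: aP.
split=> //.
- by move=> X [phi [_ ->]]; exists phi.
- move=> X Y [phi [pphi ->]] [psi [ppsi ->]].
  have E : [set a | psat phi a] `&` [set a | psat psi a] = [set a | psat (FAnd phi psi) a].
    by apply/seteqP; split=> a; rewrite /psat /= => /(@sat_and L C _ phi psi).
  case: (cp (FAnd phi psi)) => pn; first by exists (FAnd phi psi).
  have [|a aP] := fs [set phi; psi; FNot (FAnd phi psi)] _ (finite_set3 _ _ _).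
    by move=> c [[->|->]|->].
  have h1 : psat phi a by apply: aP; left; left.
  have h2 : psat psi a by apply: aP; left; right.
  have : psat (FNot (FAnd phi psi)) a by apply: aP; right.
  by case; apply/sat_and.
- move=> X [phi [_ ->]]; case: (cp phi) => h; first by left; exists phi.
  by right; exists (FNot phi).
Qed.

Lemma ptype_real V (p : set (pformula C V)) A x : global_type p ->
  real (ptype p) A x <-> realizes x (restr p A).
Proof.
move=> gp; split=> rx.
  by move=> phi [pphi o]; apply: (rx [set a | psat phi a]); exists phi.
move=> X [phi [o ->]] pX; apply: rx; split=> //; exact: ptype_mem pX.
Qed.

Lemma ptype_inv V (p : set (pformula C V)) B : global_type p -> invariant_type B p ->
  ginv B (ptype p).
Proof.
move=> gp ip s hs sB X [phi [pphi ->]].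
have [t [ht sK tK]] := aut_inv hs.
have tB : fixes B t by move=> b Bb; rewrite -{1}(sB _ Bb) sK.
exists (frename (move_params t (V := V)) phi); split.
  have := iffLR (ip t ht tB phi) pphi.
  by congr p; congr frename; apply/funext => -[].
have E a : t \o (s \o a) = a by apply/funext => v /=; rewrite sK.
by apply/seteqP; split=> a /=; have := psat_move phi (s \o a) ht;
  rewrite E => -[h1 h2]; [exact: h2|exact: h1].
Qed.

End GlobalTypes.

(** * Morley sequences *)

Ltac subs := let z := fresh "z" in move=> z; rewrite /setU /mkset /=; tauto.

(** What the calculus of Morley sequences takes from the monster model. [as_seq] stands for
    homogeneity together with the finiteness of formulas: countable sequences are conjugate over a
    small set once all their initial segments are. *)
Record autsys (kappa X : Type) (Aut : set (X -> X)) : Prop := Autsys {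
  as_limit : strong_limit kappa;
  as_nat : small kappa [set: nat];
  as_id : Aut id;
  as_comp : forall s t, Aut s -> Aut t -> Aut (s \o t);
  as_inv : forall s, Aut s -> exists t, [/\ Aut t, cancel s t & cancel t s];
  as_seq : forall A (f g : nat -> X), small kappa A ->
    (forall n, exists s, [/\ Aut s, fixes A s & forall i, i < n -> s (f i) = g i]) ->
    exists s, [/\ Aut s, fixes A s & forall i, s (f i) = g i]
}.

Section Calculus.
Variables (kappa X : Type) (Aut : set (X -> X)).
Local Notation sm := (small kappa).
Hypothesis AS : autsys kappa Aut.
Let SL := as_limit AS.
Let smallN := as_nat AS.
Let AutI := as_id AS.
Let AutM := as_comp AS.
Let AutV := as_inv AS.
Let Aut_seq := as_seq AS.

Definition conj_over (A : set X) I (f g : I -> X) : Prop :=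
  exists s, [/\ Aut s, fixes A s & forall i, s (f i) = g i].

(* [R A x] stands for "x realizes over A" a global type invariant under [Aut]. *)
Record grel (R : set X -> X -> Prop) : Prop := Grel {
  g_mono : forall A A' x, A' `<=` A -> R A x -> R A' x;
  g_ex : forall A, sm A -> exists x, R A x;
  g_uniq : forall A x y, sm A -> R A x -> R A y ->
    exists s, [/\ Aut s, fixes A s & s x = y];
  g_aut : forall s A x, Aut s -> R A x -> R (s @` A) (s x)
}.

Definition before (I : nat -> X) n : set X := [set x | exists2 j, j < n & I j = x].

Definition morley (R : set X -> X -> Prop) (A : set X) (I : nat -> X) : Prop :=
  forall i, R (A `|` before I i) (I i).

Definition indisc (A : set X) (I : nat -> X) : Prop :=
  forall n (k l : 'I_n -> nat),
    {homo k : i j / i < j} -> {homo l : i j / i < j} -> conj_over A (I \o k) (I \o l).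

Lemma before_range I n : before I n `<=` range I.
Proof. by move=> _ [j _ <-]; exists j. Qed.

Lemma before_image (s : X -> X) I n : s @` before I n = before (s \o I) n.
Proof.
apply/seteqP; split=> [_ [_ [j jn <-] <-]|_ [j jn <-]]; first by exists j.
by exists (I j) => //; exists j.
Qed.

Lemma small_seqrange (I : nat -> X) : sm (range I).
Proof. by apply: small_range => //; exact: countableP. Qed.

Lemma small_before (I : nat -> X) n : sm (before I n).
Proof. exact: small_sub (@before_range I n) (small_seqrange I). Qed.

Lemma small_set1 T (x : T) : sm [set x].
Proof. by apply: small_countable => //; exact: countable1. Qed.

Section OneRelation.
Variable R : set X -> X -> Prop.
Hypothesis gR : grel R.

Lemma mor_mono A A' I : A' `<=` A -> morley R A I -> morley R A' I.
Proof. by move=> AA' mI i; apply: g_mono (mI i) => //; exact: setSU. Qed.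

Lemma mor_aut s A I : Aut s -> morley R A I -> morley R (s @` A) (s \o I).
Proof. by move=> hs mI i; rewrite -before_image -image_setU; exact: (g_aut gR hs (mI i)). Qed.

Lemma step_elt s A x y : Aut s -> sm A -> R A x -> R (s @` A) y ->
  exists s', [/\ Aut s', (forall a, A a -> s' a = s a) & s' x = y].
Proof.
move=> hs smA rx ry.
have [t [ht tA tx]] := g_uniq gR (small_image s smA) (g_aut gR hs rx) ry.
exists (t \o s); split=> //; first exact: AutM.
by move=> a Aa /=; apply: tA; exists a.
Qed.

(** The automorphisms found for longer and longer initial segments have no limit; only their values
    on [A] and [I] cohere, and [as_seq] turns this into a single automorphism. *)
Lemma step_seq s A I J : Aut s -> sm A -> morley R A I -> morley R (s @` A) J ->
  exists s', [/\ Aut s', (forall a, A a -> s' a = s a) & forall i, s' (I i) = J i].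
Proof.
move=> hs smA mI mJ.
have fin n : exists s', [/\ Aut s', (forall a, A a -> s' a = s a) &
    forall i, i < n -> s' (I i) = J i].
  elim: n => [|n [s' [hs' s'A s'I]]]; first by exists s.
  have rJ : R (s' @` (A `|` before I n)) (J n).
    apply: g_mono (mJ n) => // _ [a [Aa|[j jn <-]] <-].
      by left; exists a => //; rewrite s'A.
    by right; rewrite s'I //; exists j.
  have [t [ht tA tn]] := step_elt hs' (small_setU SL smallN smA (small_before I n)) (mI n) rJ.
  exists t; split=> // [a Aa|i]; first by rewrite tA ?s'A //; left.
  rewrite ltnS leq_eqVlt => /orP[/eqP ->//|lt_in].
  by rewrite tA ?s'I //; right; exists i.
(* Composing with the inverse of [s] reduces to automorphisms that fix the image of [A], as [as_seq]
   demands. *)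
have [s1 [hs1 sK s1K]] := AutV hs.
have [n|t [ht tA tE]] := @Aut_seq (s @` A) (s \o I) J (small_image s smA).
  have [t [ht tA tI]] := fin n; exists (t \o s1); split; first exact: AutM.
    by move=> _ [a Aa <-] /=; rewrite sK tA.
  by move=> i lt_in /=; rewrite sK tI.
exists (t \o s); split; [exact: AutM| |exact: tE].
by move=> a Aa /=; rewrite tA //; exists a.
Qed.

Lemma mor_ex A : sm A -> exists I, morley R A I.
Proof.
move=> smA.
have /choice [ch chP] : forall B, exists x, sm B -> R B x.
  move=> B; have [smB|nB] := pselect (sm B).
    by have [x rx] := g_ex gR smB; exists x.
  by have [x _] := g_ex gR smA; exists x.
pose F := fix F n := if n is n'.+1 then F n' `|` [set ch (A `|` F n')] else set0.
exists (fun n => ch (A `|` F n)) => n; set I := fun n => _.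
have E m : before I m = F m.
  elim: m => [|m IH]; first by apply/seteqP; split=> // x [].
  rewrite /= -IH; apply/seteqP; split=> x.
    move=> [j]; rewrite ltnS leq_eqVlt => /orP[/eqP -> <-|lt_jm <-].
      by right; rewrite /I IH.
    by left; exists j.
  move=> [[j jm <-]|->]; first by exists j => //; exact: ltnW.
  by exists m => //; rewrite /I IH.
rewrite E; apply: chP; apply: small_setU => //.
by rewrite -E; exact: small_before.
Qed.

Lemma mor_sub A I (k : nat -> nat) : {homo k : i j / i < j} -> morley R A I -> morley R A (I \o k).
Proof.
move=> kinc mI i; apply: g_mono (mI (k i)) => //; apply: setUS => _ [j ji <-].
by exists (k j) => //; exact: kinc.
Qed.

Lemma mor_drop A I m : morley R A I -> morley R (A `|` before I m) (fun i => I (m + i)).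
Proof.
move=> mI i; apply: g_mono (mI (m + i)) => // x [[Ax|[j jm <-]]|[j ji <-]].
- by left.
- by right; exists j => //; rewrite (leq_trans jm) // leq_addr.
- by right; exists (m + j) => //; rewrite ltn_add2l.
Qed.

Lemma mor_cons A x I : R A x -> morley R (A `|` [set x]) I ->
  morley R A (fun i => if i is j.+1 then I j else x).
Proof.
move=> rx mI [|i]; first by apply: g_mono rx => // y [//|[j]]; rewrite ltn0.
apply: g_mono (mI i) => // y [Ay|[[|j] ji <-]]; first by left; left.
  by left; right.
by right; exists j.
Qed.

Lemma mor_cat A I J m : morley R A I -> morley R (A `|` range I) J ->
  morley R A (fun i => if i < m then I i else J (i - m)).
Proof.
move=> mI mJ i; case: ifP => im.
  apply: g_mono (mI i) => //; apply: setUS => _ [j ji <-]; rewrite (ltn_trans ji im).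
  by exists j.
apply: g_mono (mJ (i - m)) => // y [Ay|[j ji <-]]; first by left; left.
case: ifP => jm; first by left; right; exists j.
by right; exists (j - m) => //; apply: ltn_sub2r => //; rewrite (leq_ltn_trans _ ji) // leqNgt jm.
Qed.

Lemma ord_homo_extend n (k : 'I_n -> nat) : {homo k : i j / i < j} ->
  exists K : nat -> nat, {homo K : i j / i < j} /\ forall i : 'I_n, K i = k i.
Proof.
move=> kinc; pose b := \max_(i < n) k i.
exists (fun i => if insub i is Some j then k j else (b + i).+1); split=> [i j ij|i].
  case: insubP => [i' _ iE|ni]; case: insubP => [j' _ jE|nj].
  - by apply: kinc; rewrite iE jE.
  - by rewrite ltnS; apply: leq_trans (leq_addr _ _); exact: (leq_bigmax i').
  - by case/negP: ni; apply: ltn_trans ij _; rewrite -jE; exact: ltn_ord.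
  - by rewrite ltnS ltn_add2l.
by rewrite valK.
Qed.

(** Genericity over [A] extends to its definable closure: an element generic over [A] and [B] is
    moved to [x] by an automorphism fixing [A], which therefore fixes [B]. *)
Lemma gen_dcl A B x : sm A -> sm B -> (forall s, Aut s -> fixes A s -> fixes B s) ->
  R A x -> R (A `|` B) x.
Proof.
move=> smA smB AB rx; have [y ry] := g_ex gR (small_setU SL smallN smA smB).
have ry' : R A y by apply: g_mono ry => //; exact: subsetUl.
have [s [hs sA sy]] := g_uniq gR smA ry' rx.
have := g_aut gR hs ry; rewrite sy; congr R.
apply/seteqP; split=> [_ [z [Az|Bz] <-]|z [Az|Bz]].
- by rewrite sA //; left.
- by rewrite (AB _ hs sA) //; right.
- by exists z; [left|rewrite sA].
- by exists z; [right|rewrite (AB _ hs sA)].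
Qed.

Lemma mor_dcl A B I : sm A -> sm B -> (forall s, Aut s -> fixes A s -> fixes B s) ->
  morley R A I -> morley R (A `|` B) I.
Proof.
move=> smA smB AB mI i.
apply: (g_mono gR (A := A `|` before I i `|` B)); first by subs.
apply: gen_dcl (mI i) => //; first by apply: small_setU => //; exact: small_before.
by move=> s hs sA; apply: AB => // a Aa; apply: sA; left.
Qed.

Lemma mor_indisc A I : sm A -> morley R A I -> indisc A I.
Proof.
move=> smA mI n k l /ord_homo_extend [K [Kinc KE]] /ord_homo_extend [M [Minc ME]].
have mM : morley R (id @` A) (I \o M) by rewrite image_id; exact: mor_sub.
have [s [hs sA sI]] := step_seq AutI smA (mor_sub Kinc mI) mM.
by exists s; split=> // i; rewrite /= -KE -ME; exact: sI.
Qed.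

End OneRelation.

(* Elements that are generic over A can be kept fixed by the automorphisms that
   move subsets of A inside A. *)
Definition stationary (A Z : set X) : Prop := forall s E, Aut s -> E `<=` A -> s @` E `<=` A ->
  exists s', [/\ Aut s', (forall e, E e -> s' e = s e) & fixes Z s'].

(** The global type is invariant under all of [Aut], so the image of [z] under [s] can be moved back
    to [z] over the image of [E]. *)
Lemma stationary_elt R A z : grel R -> sm A -> R A z -> stationary A [set z].
Proof.
move=> gR smA rz s E hs EA sEA.
have [|||s' [hs' s'E s'z]] := @step_elt R gR s E z z hs; first exact: small_sub smA.
- exact: g_mono rz.
- exact: g_mono rz.
by exists s'; split=> // _ ->.
Qed.

Lemma stationary_seq R A I : grel R -> sm A -> morley R A I -> stationary A (range I).
Proof.
move=> gR smA mI s E hs EA sEA.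
have [|||s' [hs' s'E s'z]] := @step_seq R gR s E I I hs; first exact: small_sub smA.
- exact: mor_mono mI.
- exact: mor_mono mI.
by exists s'; split=> // _ [i _ <-].
Qed.

Lemma stationary_setU A Z W : stationary A Z -> stationary (A `|` Z) W -> stationary A (Z `|` W).
Proof.
move=> stZ stW s E hs EA sEA.
have [s' [hs' s'E s'Z]] := stZ s E hs EA sEA.
have [||t [ht tE tW]] := stW s' (E `|` Z) hs'; first exact: setSU.
  move=> _ [e [Ee|Ze] <-]; last by right; rewrite s'Z.
  by left; apply: sEA; exists e; rewrite ?s'E.
exists t; split=> // [e Ee|z [Zz|Wz]]; last exact: tW.
  by rewrite tE ?s'E //; left.
by rewrite tE ?s'Z //; right.
Qed.

(** The automorphism matching two finite parts of [I] sends a part of [A] and [I] into [A] and [I];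
    stationarity corrects it so as to fix [Z]. *)
Lemma indisc_stat A I Z : indisc A I -> stationary (A `|` range I) Z -> indisc (A `|` Z) I.
Proof.
move=> ind st n k l kinc linc; have [s [hs sA sI]] := ind n k l kinc linc.
have [||t [ht tE tZ]] := st s (A `|` range (I \o k)) hs.
- by apply: setUS => _ [i _ <-]; exists (k i).
- move=> _ [e [Ae|[i _ <-]] <-]; first by left; rewrite sA.
  by right; rewrite sI; exists (l i).
exists t; split=> // [x [Ax|Zx]|i]; first by rewrite tE ?sA //; left.
- exact: tZ.
- by rewrite tE ?sI //; right; exists i.
Qed.

Lemma indisc_mono A A' I : A' `<=` A -> indisc A I -> indisc A' I.
Proof.
move=> AA ind n k l kinc linc; have [s [hs sA sI]] := ind n k l kinc linc.
by exists s; split=> // x /AA/sA.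
Qed.

Lemma mor_mutual R1 R2 A I1 I2 Z : grel R1 -> grel R2 -> sm A ->
  morley R1 A I1 -> morley R2 (A `|` range I1) I2 -> stationary (A `|` range I1 `|` range I2) Z ->
  indisc (A `|` Z `|` range I2) I1 /\ indisc (A `|` Z `|` range I1) I2.
Proof.
move=> g1 g2 smA m1 m2 st; split.
  apply: (@indisc_mono (A `|` (range I2 `|` Z))); first by subs.
  apply: indisc_stat; first exact: (mor_indisc g1).
  apply: stationary_setU => //; apply: stationary_seq g2 _ m2.
  by apply: small_setU => //; exact: small_seqrange.
apply: (@indisc_mono (A `|` range I1 `|` Z)); first by subs.
apply: indisc_stat => //; apply: (mor_indisc g2) => //.
by apply: small_setU => //; exact: small_seqrange.
Qed.

Lemma indisc1 A I i j : indisc A I -> exists s, [/\ Aut s, fixes A s & s (I i) = I j].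
Proof.
move=> ind; have [||s [hs sA sI]] := ind 1 (fun=> i) (fun=> j).
- by move=> [[|?] ?] [[|?] ?].
- by move=> [[|?] ?] [[|?] ?].
by exists s; split=> //; exact: (sI ord0).
Qed.

End Calculus.

(** * Conjugates by generic elements *)

Section Span.
Local Open Scope group_scope.
Variable gT : groupType.
Implicit Types (S T : set gT) (x y z : gT).

(** Only products are taken. The generating sets used below are closed under inverses, and then this
    is the generated subgroup ([span_inv]). *)
Inductive span S : gT -> Prop :=
| Span1 : span S 1
| SpanM x y : span S x -> S y -> span S (x * y).

Lemma span_gen S x : S x -> span S x.
Proof. by move=> Sx; rewrite -(mul1g x); apply: SpanM => //; exact: Span1. Qed.

Lemma span_mul S x y : span S x -> span S y -> span S (x * y).
Proof.
move=> sx sy; elim: {y} sy => [|y z sy IH Sz]; first by rewrite mulg1.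
by rewrite mulgA; exact: SpanM.
Qed.

Lemma span_inv S x : (forall y, S y -> S y^-1) -> span S x -> span S x^-1.
Proof.
move=> SV sx; elim: {x} sx => [|x y sx IH Sy]; first by rewrite invg1; exact: Span1.
by rewrite invgM; apply: span_mul => //; apply/span_gen/SV.
Qed.

Lemma span_conj S T x z : (forall y, S y -> span T (y ^ z)) -> span S x -> span T (x ^ z).
Proof.
move=> ST sx; elim: {x} sx => [|x y sx IH Sy]; first by rewrite conj1g; exact: Span1.
by rewrite conjMg; apply: span_mul => //; exact: ST.
Qed.

(** The way a fixed element is exploited: if c is the quotient of a conjugate on one side by a
    conjugate on the other, an automorphism fixing c turns a difference on one side into a
    difference on the other. *)
Lemma eqVM x y z t : x^-1 * y = z^-1 * t -> y * t^-1 = x * z^-1.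
Proof.
by move=> E; apply: (mulgI x^-1); rewrite mulgA E mulgK mulKg.
Qed.

Lemma divg_chain x y z : x * z^-1 = (x * y^-1) * (z * y^-1)^-1.
Proof. by rewrite invgM invgK mulgA mulgVK. Qed.

Lemma mulg_chain d x y z t : d * (x * z^-1) * t = d * (x * y^-1 * (y * z^-1 * t)).
Proof. by rewrite !mulgA mulgVK. Qed.

End Span.

Section GroupPart.
Local Open Scope group_scope.
Variables (kappa : Type) (gT : groupType) (Aut : set (gT -> gT)).
Local Notation sm := (small kappa).
Hypothesis AS : autsys kappa Aut.
Hypothesis AutG : forall s, Aut s -> {morph s : x y / x * y}.
Variable gen : set gT -> gT -> Prop.
Hypothesis gG : grel kappa Aut gen.
Variable K : set gT.
Hypothesis KM : forall x y, K x -> K y -> K (x * y).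
Hypothesis KV : forall x, K x -> K x^-1.
Hypothesis genK : forall A x, gen A x -> K x.
Hypothesis genL : forall A k x, sm A -> K k -> A k -> gen A x -> gen A (k * x).
Hypothesis genT : forall A J x, sm A -> morley gen A J -> gen (range J) x ->
  gen (A `|` range J) x.
Hypothesis dpK : forall A I1 I2 c, sm A -> indisc Aut (A `|` range I2) I1 ->
  indisc Aut (A `|` range I1) I2 -> K c ->
  indisc Aut (A `|` [set c]) I1 \/ indisc Aut (A `|` [set c]) I2.
Hypothesis powK : forall x y, K x -> K y ->
  exists n, commute (x ^+ n.+1) y \/ commute (y ^+ n.+1) x.

Let SL := as_limit AS.
Let smallN := as_nat AS.
Let AutI := as_id AS.

Local Notation mor := (morley gen).

Implicit Types A B : set gT.

Lemma smU A B : sm A -> sm B -> sm (A `|` B).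
Proof. exact: small_setU. Qed.

Lemma smU1 A (x : gT) : sm A -> sm (A `|` [set x]).
Proof. by move=> smA; apply: smU => //; exact: (small_set1 AS). Qed.

Lemma smUr A (I : nat -> gT) : sm A -> sm (A `|` range I).
Proof. by move=> smA; apply: smU => //; exact: (small_seqrange AS). Qed.

Hint Resolve smU1 smUr : core.

Lemma aut1 s : Aut s -> s 1 = 1.
Proof. by move=> /AutG sM; apply: (mulgI (s 1)); rewrite -sM !mulg1. Qed.

Lemma autV s x : Aut s -> s x^-1 = (s x)^-1.
Proof.
move=> hs; apply: (mulgI (s x)); rewrite -(AutG hs) !mulgV; exact: aut1.
Qed.

Lemma autJ s x y : Aut s -> s (x ^ y) = s x ^ s y.
Proof. by move=> hs; rewrite /conjg 2!(AutG hs) (autV _ hs). Qed.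

Lemma autVM s b c x y : Aut s ->
  s ((b ^ x)^-1 * c ^ y) = (s b ^ s x)^-1 * s c ^ s y.
Proof. by move=> hs; rewrite (AutG hs) (autV _ hs) 2!(autJ _ _ hs). Qed.

Lemma autMV s b c x y : Aut s ->
  s (b ^ x * (c ^ y)^-1) = s b ^ s x * (s c ^ s y)^-1.
Proof. by move=> hs; rewrite (AutG hs) (autV _ hs) 2!(autJ _ _ hs). Qed.

Lemma KJ x y : K x -> K y -> K (x ^ y).
Proof. by move=> Kx Ky; rewrite /conjg; apply: KM; [exact: KV|exact: KM]. Qed.

Lemma gmono A A' x : A' `<=` A -> gen A x -> gen A' x.
Proof. exact: g_mono gG _ _ _. Qed.

Lemma mmono A A' I : A' `<=` A -> mor A I -> mor A' I.
Proof. exact: mor_mono gG _ _ _. Qed.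

Lemma gen_dcl1 A x y : sm A -> (forall s, Aut s -> fixes A s -> s y = y) ->
  gen A x -> gen (A `|` [set y]) x.
Proof.
move=> smA Ay; apply: (gen_dcl AS gG) => //; first exact: (small_set1 AS).
by move=> s hs sA _ ->; exact: Ay.
Qed.

Lemma mor_dcl1 A I y : sm A -> (forall s, Aut s -> fixes A s -> s y = y) ->
  mor A I -> mor (A `|` [set y]) I.
Proof.
move=> smA Ay; apply: (mor_dcl AS gG) => //; first exact: (small_set1 AS).
by move=> s hs sA _ ->; exact: Ay.
Qed.

Definition shift (i : nat) (L : nat -> gT) n := L (i + n).

Lemma shift_shift i j L : shift i (shift j L) = shift (j + i) L.
Proof. by apply/funext => n; rewrite /shift addnA. Qed.

Lemma shift_range i L : range (shift i L) `<=` range L.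
Proof. by move=> _ [n _ <-]; exists (i + n). Qed.

Lemma shift_range_le i j L : i <= j -> range (shift j L) `<=` range (shift i L).
Proof.
move=> ij; rewrite -(subnKC ij) -shift_shift; exact: shift_range.
Qed.

Lemma mor_shift A L i : mor A L -> mor A (shift i L).
Proof. by apply: (mor_sub gG (k := addn i)) => m n; rewrite ltn_add2l. Qed.

Lemma mor_shift_le A L i j : i <= j -> mor A (shift i L) -> mor A (shift j L).
Proof. by move=> ij; rewrite -(subnKC ij) -shift_shift; exact: mor_shift. Qed.

Lemma mor_head A L i : mor A (shift i L) ->
  gen A (L i) /\ mor (A `|` [set L i]) (shift i.+1 L).
Proof.
move=> mL; split; first by have := mL 0; rewrite {2}/shift addn0; apply: gmono; subs.
have := mor_drop gG 1 mL; rewrite -/(shift 1 (shift i L)) shift_shift addn1.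
apply: mmono; apply: setUS => _ ->; exists 0%N => //; by rewrite /shift addn0.
Qed.

(** All such quadruples are conjugate over [A] ([config_conj]), so what dp-minimality yields for a
    particular one holds for every one. *)
Record config A u w L z : Prop := Config {
  config_u : gen A u;
  config_w : gen (A `|` [set u]) w;
  config_L : mor (A `|` [set u] `|` [set w]) L;
  config_z : gen (A `|` [set u] `|` [set w] `|` range L) z
}.

Lemma fixes_image (A : set gT) (s : gT -> gT) : fixes A s -> s @` A = A.
Proof.
move=> sA; apply/seteqP; split=> [_ [a Aa <-]|a Aa]; first by rewrite sA.
by exists a; rewrite ?sA.
Qed.

Lemma ext_elt s A B x y : Aut s -> sm A -> gen A x -> gen B y -> s @` A `<=` B ->
  exists s', [/\ Aut s', (forall a, A a -> s' a = s a) & s' x = y].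
Proof.
by move=> hs smA rx ry sAB; apply: (step_elt AS gG) => //; exact: gmono ry.
Qed.

Lemma ext_seq s A B I J : Aut s -> sm A -> mor A I -> mor B J -> s @` A `<=` B ->
  exists s', [/\ Aut s', (forall a, A a -> s' a = s a) & forall i, s' (I i) = J i].
Proof.
by move=> hs smA mI mJ sAB; apply: (step_seq AS gG) => //; exact: mmono mJ.
Qed.

Lemma config_conj A u w L z u' w' L' z' : sm A -> config A u w L z -> config A u' w' L' z' ->
  exists s, [/\ Aut s, fixes A s, s u = u', s w = w' & s \o L = L' /\ s z = z'].
Proof.
move=> smA [ru rw mL rz] [ru' rw' mL' rz'].
have [|s1 [h1 s1A s1u]] := ext_elt AutI smA ru ru'; first by rewrite image_id.
have [||s2 [h2 s2D s2w]] := ext_elt h1 _ rw rw'; [by auto| |].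
  by move=> _ [a [Aa|->] <-]; [left; rewrite s1A|right; rewrite s1u].
have s2A : fixes A s2 by move=> a Aa; rewrite s2D ?s1A //; left.
have s2u : s2 u = u' by rewrite s2D ?s1u //; right.
have [||s3 [h3 s3D s3L]] := ext_seq h2 _ mL mL'; [by auto| |].
  by move=> _ [a [[Aa|->]|->] <-];
    [left; left; rewrite s2A|left; right; rewrite s2u|right; rewrite s2w].
have s3A : fixes A s3 by move=> a Aa; rewrite s3D ?s2A //; left; left.
have s3u : s3 u = u' by rewrite s3D ?s2u //; left; right.
have s3w : s3 w = w' by rewrite s3D ?s2w //; right.
have [||s4 [h4 s4D s4z]] := ext_elt h3 _ rz rz'; [by auto| |].
  by move=> _ [a [[[Aa|->]|->]|[i _ <-]] <-];
    [left; left; left; rewrite s3A|left; left; right; rewrite s3u|left; right; rewrite s3w|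
     right; rewrite s3L; exists i].
exists s4; split=> //; last split=> //.
- by move=> a Aa; rewrite s4D ?s3A //; left; left; left.
- by rewrite s4D ?s3u //; left; left; right.
- by rewrite s4D ?s3w //; left; right.
- by apply/funext => i /=; rewrite s4D ?s3L //; right; exists i.
Qed.

Lemma autX s x n : Aut s -> s (x ^+ n) = s x ^+ n.
Proof.
by move=> hs; elim: n => [|n IH]; [exact: aut1|rewrite !expgS (AutG hs) IH].
Qed.

Lemma gen_pair A x y x' y' : sm A -> gen A x -> gen (A `|` [set x]) y ->
  gen A x' -> gen (A `|` [set x']) y' ->
  exists s, [/\ Aut s, fixes A s, s x = x' & s y = y'].
Proof.
move=> smA rx ry rx' ry'.
have [|s1 [h1 s1A s1x]] := ext_elt AutI smA rx rx'; first by rewrite image_id.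
have [||s2 [h2 s2D s2y]] := ext_elt h1 _ ry ry'; [by auto| |].
  by move=> _ [a [Aa|->] <-]; [left; rewrite s1A|right; rewrite s1x].
exists s2; split=> //; last by rewrite s2D ?s1x //; right.
by move=> a Aa; rewrite s2D ?s1A //; left.
Qed.

Lemma gen_mull A k x y : sm A -> K k -> A k -> gen A x -> gen (A `|` [set x]) y ->
  gen (A `|` [set k * x]) y.
Proof.
move=> smA Kk Ak rx ry; apply: (gmono (A := A `|` [set x] `|` [set k * x])); first by subs.
apply: gen_dcl1 => //; first by auto.
by move=> s hs sf; rewrite (AutG hs) !sf //; [right|left].
Qed.

Lemma commuteMl (x y z : gT) : commute x (y * z) -> commute x z -> commute x y.
Proof. by move=> xyz xz; rewrite -[y](mulgK z); apply: commuteM => //; exact: commuteV. Qed.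

(** For independent generics x and y, some power of one commutes with the other. As left translation
    by d preserves genericity, the pair with y replaced by d y, or x by d x, has the same type over
    [A]; the same power then commutes with both y and d y, or both x and d x, hence with d. *)
Lemma generic_power A d z : sm A -> K d -> A d -> gen A z ->
  exists n, commute (z ^+ n.+1) d.
Proof.
move=> smA Kd Ad rz.
have [x rx] := g_ex gG smA; have [y ry] := g_ex gG (smU1 x smA).
have ryA : gen A y by apply: gmono ry; subs.
have [n [cn|cn]] := powK (genK rx) (genK ry); exists n.
  have [s [hs sA sx sy]] := gen_pair smA rx ry rx (genL (smU1 x smA) Kd (or_introl Ad) ry).
  have cd : commute (x ^+ n.+1) d.
    apply: (@commuteMl _ _ y) => //.
    by have := congr1 s cn; rewrite 2!(AutG hs) (autX _ _ hs) sx sy.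
  have [t [ht tA tx]] := g_uniq gG smA rx rz.
  by have := congr1 t cd; rewrite 2!(AutG ht) (autX _ _ ht) tx (tA _ Ad).
have [s [hs sA sx sy]] := gen_pair smA rx ry (genL smA Kd Ad rx) (gen_mull smA Kd Ad rx ry).
have cd : commute (y ^+ n.+1) d.
  apply: (@commuteMl _ _ x) => //.
  by have := congr1 s cn; rewrite 2!(AutG hs) (autX _ _ hs) sx sy.
have [t [ht tA ty]] := g_uniq gG smA ryA rz.
by have := congr1 t cd; rewrite 2!(AutG ht) (autX _ _ ht) ty (tA _ Ad).
Qed.

(** * The group D attached to an element b *)

Section OneElement.
Local Open Scope group_scope.
Variable b : gT.
Hypothesis Kb : K b.

(** The property is preserved by every automorphism fixing [A] and [L] ([precedes_aut]). It does not
    say how [u] was obtained, nor how it sits with respect to other elements. *)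
Definition precedes A L u : Prop := gen A u /\ mor (A `|` [set u]) L.

Definition ev_precedes A L u : Prop := exists i, precedes A (shift i L) u.

Definition diff_gens A L : set gT :=
  [set g | exists u v, [/\ ev_precedes A L u, ev_precedes A L v & g = b ^ u * (b ^ v)^-1]].

Lemma diff_gensV A L g : diff_gens A L g -> diff_gens A L g^-1.
Proof. by move=> [u [v [Qu Qv ->]]]; exists v, u; rewrite invgM invgK. Qed.

Lemma precedes_le A L u i j : i <= j -> precedes A (shift i L) u -> precedes A (shift j L) u.
Proof. by move=> ij [ru mu]; split=> //; exact: mor_shift_le mu. Qed.

Lemma precedes_aut A L u s : Aut s -> fixes A s -> (forall i, s (L i) = L i) -> precedes A L u -> precedes A L (s u).
Proof.
move=> hs sA sL [ru mu]; split.
  by have := g_aut gG hs ru; rewrite fixes_image.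
have := mor_aut gG hs mu; rewrite image_setU fixes_image // image_set1.
by congr morley; apply/funext.
Qed.

Lemma precedes_term A L i : mor A L -> precedes A (shift i.+1 L) (L i).
Proof. by move=> mL; have [h1 h2] := mor_head (mor_shift i mL). Qed.

(** Here distality enters: [z] is only assumed generic over the tail of [L], and [genT] adds [A],
    [u] and [L i] to its base. *)
Lemma config_of A L i u z : sm A -> precedes A (shift i L) u -> gen (range (shift i.+1 L)) z ->
  config A u (L i) (shift i.+1 L) z.
Proof.
move=> smA [ru mu] rz; have [h1 h2] := mor_head mu.
by split=> //; apply: genT => //; auto.
Qed.

Lemma dp_ref A Z I1 I2 c : sm A -> sm Z -> mor A I1 -> mor (A `|` range I1) I2 ->
  stationary Aut (A `|` range I1 `|` range I2) Z -> K c ->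
  (forall i j, exists s, [/\ Aut s, fixes A s, fixes Z s, s c = c & s (I1 i) = I1 j]) \/
  (forall i j, exists s, [/\ Aut s, fixes A s, fixes Z s, s c = c & s (I2 i) = I2 j]).
Proof.
move=> smA smZ m1 m2 st Kc.
have [i1 i2] := mor_mutual AS gG gG smA m1 m2 st.
by case: (dpK (smU smA smZ) i1 i2 Kc) => ind; [left|right] => i j;
  have [s [hs sf sij]] := indisc1 i j ind; exists s; split=> //;
  [move=> a Aa; apply: sf; left; left|move=> a Aa; apply: sf; left; right|apply: sf; right|
   move=> a Aa; apply: sf; left; left|move=> a Aa; apply: sf; left; right|apply: sf; right].
Qed.

(** A sequence [L] and an element [z], generic over the two Morley sequences, are frozen by
    stationarity before dp-minimality is applied. The first outcome is the source of D being
    contained in its conjugate by z, the second of the opposite inclusion. *)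
Lemma conj_dichotomy A : sm A -> A b ->
  (forall u w L z, config A u w L z -> exists v v', [/\ precedes A L v, precedes A L v' &
     b ^ u * (b ^ w)^-1 = (b ^ v * (b ^ v')^-1) ^ z]) \/
  (forall u w L z, config A u w L z -> exists v v', [/\ precedes A L v, precedes A L v' &
     (b ^ u * (b ^ w)^-1) ^ z = b ^ v * (b ^ v')^-1]).
Proof.
move=> smA Ab.
have [I1 m1] := mor_ex AS gG smA.
have [I2 m2] := mor_ex AS gG (smUr I1 smA).
have sm12 : sm (A `|` range I1 `|` range I2) by auto.
have [L mL] := mor_ex AS gG sm12.
have [z rz] := g_ex gG (smUr L sm12).
have st : stationary Aut (A `|` range I1 `|` range I2) (range L `|` [set z]).
  apply: stationary_setU; first exact: (stationary_seq AS gG).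
  by apply: (stationary_elt AS gG) rz; auto.
have KI1 i : K (I1 i) by exact: genK (m1 i).
have KI2 i : K (I2 i) by exact: genK (m2 i).
have Kc : K ((b ^ (I2 0%N * z))^-1 * b ^ (I1 0%N)).
  by apply: KM; [apply: KV|]; apply: KJ => //; apply: KM => //; exact: genK rz.
have smZ : sm (range L `|` [set z]) by apply: smU1; exact: (small_seqrange AS).
have Q1 i : precedes A L (I1 i).
  split; first by apply: gmono (m1 i); subs.
  by apply: mmono mL => x [Ax|->]; left; [left|right; exists i].
have Q2 i : precedes A L (I2 i).
  split; first by apply: gmono (m2 i); subs.
  by apply: mmono mL => x [Ax|->]; [left; left|right; exists i].
case: (dp_ref smA smZ m1 m2 st Kc) => swap; [left|right] => u w M y cf.
  have [s [hs sA sZ sc s01]] := swap 0%N 1%N.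
  have sL i : s (L i) = L i by apply: sZ; left; exists i.
  have sz : s z = z by apply: sZ; right.
  (* [s] fixes the element c and moves the term of [I1] that occurs in it, so the two expressions of
     c are compared by [eqVM]. *)
  have E : b ^ (I1 0%N) * (b ^ (I1 1%N))^-1 = (b ^ (I2 0%N) * (b ^ (s (I2 0%N)))^-1) ^ z.
    rewrite conjMg conjVg -!conjgM; apply: eqVM.
    by rewrite -{1}sc (autVM _ _ _ _ hs) (AutG hs) sz s01 (sA _ Ab).
  have c0 : config A (I1 0%N) (I1 1%N) L z.
    split; first exact: (Q1 0).1.
    - by apply: gmono (m1 1%N) => x [Ax|->]; [left|right; exists 0%N].
    - by apply: mmono mL => x [[Ax|->]|->]; left; [left|right; exists 0%N|right; exists 1%N].
    - apply: gmono rz => x [[[Ax|->]|->]|Lx]; [left|left|left|by right]; left;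
        by [left|right; exists 0%N|right; exists 1%N].
  have [t [ht tA tu tw [tL tz]]] := config_conj smA c0 cf.
  exists (t (I2 0%N)), (t (s (I2 0%N))).
  have Qt v : precedes A L v -> precedes A M (t v).
    move=> [rv mv]; split; first by have := g_aut gG ht rv; rewrite fixes_image.
    by have := mor_aut gG ht mv; rewrite image_setU fixes_image // image_set1 tL.
  split; [exact: Qt|by apply: Qt; exact: precedes_aut|].
  have := congr1 t E; by rewrite (autJ _ _ ht) 2!(autMV _ _ _ _ ht) tu tw tz (tA _ Ab).
have [s [hs sA sZ sc s01]] := swap 0%N 1%N.
have sL i : s (L i) = L i by apply: sZ; left; exists i.
have sz : s z = z by apply: sZ; right.
have E : (b ^ (I2 0%N) * (b ^ (I2 1%N))^-1) ^ z = b ^ (I1 0%N) * (b ^ (s (I1 0%N)))^-1.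
  rewrite conjMg conjVg -!conjgM; symmetry; apply: eqVM.
  by rewrite -{1}sc (autVM _ _ _ _ hs) (AutG hs) sz s01 (sA _ Ab).
have c0 : config A (I2 0%N) (I2 1%N) L z.
  split; first exact: (Q2 0).1.
  - by apply: gmono (m2 1%N) => x [Ax|->]; [left; left|right; exists 0%N].
  - by apply: mmono mL => x [[Ax|->]|->]; [left; left|right; exists 0%N|right; exists 1%N].
  - apply: gmono rz => x [[[Ax|->]|->]|Lx]; [left|left|left|by right];
      by [left; left|right; exists 0%N|right; exists 1%N].
have [t [ht tA tu tw [tL tz]]] := config_conj smA c0 cf.
exists (t (I1 0%N)), (t (s (I1 0%N))).
have Qt v : precedes A L v -> precedes A M (t v).
  move=> [rv mv]; split; first by have := g_aut gG ht rv; rewrite fixes_image.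
  by have := mor_aut gG ht mv; rewrite image_setU fixes_image // image_set1 tL.
split; [exact: Qt|by apply: Qt; exact: precedes_aut|].
have := congr1 t E; by rewrite (autJ _ _ ht) 2!(autMV _ _ _ _ ht) tu tw tz (tA _ Ab).
Qed.

(** The tails of the two elements may start at different places; a common later one is taken, beyond
    any prescribed [n]. *)
Lemma diff_gens_shift A L g n : diff_gens A L g -> exists i u v, [/\ n <= i, precedes A (shift i L) u, precedes A (shift i L) v &
  g = b ^ u * (b ^ v)^-1].
Proof.
move=> [u [v [[i Qu] [j Qv] ->]]]; exists (maxn n (maxn i j)), u, v.
split=> //; first exact: leq_maxl.
  by apply: precedes_le Qu; rewrite !leq_max leqnn orbT.
by apply: precedes_le Qv; rewrite !leq_max leqnn !orbT.
Qed.

Lemma diff_gens_precedes A L i u v : precedes A (shift i L) u -> precedes A (shift i L) v -> diff_gens A L (b ^ u * (b ^ v)^-1).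
Proof. by move=> Qu Qv; exists u, v; split=> //; exists i. Qed.

(* dp-minimality gives one of the inclusions D ^ z <= D and D <= D ^ z; since
   some power of z commutes with each generator, it is an equality. *)
Lemma span_diff_gens_conj A L z g : sm A -> A b -> mor A L -> gen (A `|` range L) z ->
  span (diff_gens A L) g -> span (diff_gens A L) (g ^ z) /\ span (diff_gens A L) (g ^ z^-1).
Proof.
move=> smA Ab mL rz.
have genz i : gen (range (shift i.+1 L)) z.
  by apply: gmono rz => x /shift_range; right.
(* [generic_power] wants its element among the parameters; the difference is definable from b, [u]
   and [L i], so adding it costs no genericity. *)
have tor u i : precedes A (shift i L) u -> exists n, commute (z ^+ n.+1) (b ^ u * (b ^ (L i))^-1).
  move=> Qu; have cf := config_of smA Qu (genz i).
  have Ku : K u := genK (config_u cf); have Kw : K (L i) := genK (config_w cf).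
  apply: (@generic_power (A `|` [set u] `|` [set L i] `|` [set b ^ u * (b ^ (L i))^-1])).
  - by auto.
  - by apply: KM; [|apply: KV]; apply: KJ.
  - by right.
  - apply: gen_dcl1; [by auto| |by apply: gmono (config_z cf); subs].
    move=> s hs sA; rewrite (autMV _ _ _ _ hs).
    by rewrite (sA b) ?(sA u) ?(sA (L i)) //; [right|left; right|left; left].
(* the differences with a term of L generate *)
suff H : (forall u i, precedes A (shift i L) u -> span (diff_gens A L) ((b ^ u * (b ^ (L i))^-1) ^ z)) /\
         (forall u i, precedes A (shift i L) u -> span (diff_gens A L) ((b ^ u * (b ^ (L i))^-1) ^ z^-1)).
  have red x : (forall u i, precedes A (shift i L) u -> span (diff_gens A L) ((b ^ u * (b ^ (L i))^-1) ^ x)) ->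
      span (diff_gens A L) g -> span (diff_gens A L) (g ^ x).
    move=> Hx; apply: span_conj => _ /(diff_gens_shift 0) [i [u [v [_ Qu Qv ->]]]].
    rewrite (divg_chain _ (b ^ L i)) conjMg conjVg; apply: span_mul; first exact: Hx.
    by apply: span_inv (@diff_gensV _ _) _; exact: Hx.
  by move=> sg; split; apply: red sg; [exact: H.1|exact: H.2].
have WL u i : precedes A (shift i L) u -> diff_gens A L (b ^ u * (b ^ (L i))^-1).
  by move=> Qu; apply: (@diff_gens_precedes A L i.+1); [exact: precedes_le Qu|exact: precedes_term].
have spX x n y : (forall h, span (diff_gens A L) h -> span (diff_gens A L) (h ^ x)) ->
    span (diff_gens A L) y -> span (diff_gens A L) (y ^ (x ^+ n)).
  move=> Hx sy; elim: n => [|n IH]; first by rewrite expg0 conjg1.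
  by rewrite expgSr conjgM; exact: Hx.
case: (conj_dichotomy smA Ab) => dich.
  have zV h : span (diff_gens A L) h -> span (diff_gens A L) (h ^ z^-1).
    apply: span_conj => _ /(diff_gens_shift 0) [i [u [v [_ Qu Qv ->]]]].
    have gW u' : precedes A (shift i L) u' -> diff_gens A L ((b ^ u' * (b ^ L i)^-1) ^ z^-1).
      move=> Qu'; have [x [y [Qx Qy ->]]] := dich _ _ _ _ (config_of smA Qu' (genz i)).
      by rewrite conjgK; exact: diff_gens_precedes Qx Qy.
    rewrite (divg_chain _ (b ^ L i)) conjMg conjVg; apply: span_mul; first exact/span_gen/gW.
    by apply/span_gen/diff_gensV/gW.
  split=> u i Qu; last by apply/zV/span_gen/WL.
  have [n cn] := tor u i Qu.
  (* D is stable under conjugation by the inverse of z. Since z to the power n + 1 commutes with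
     this generator, conjugating it by z amounts to conjugating it n times by that inverse. *)
  have -> : (b ^ u * (b ^ L i)^-1) ^ z = (b ^ u * (b ^ L i)^-1) ^ (z^-1 ^+ n).
    have E : (b ^ u * (b ^ L i)^-1) ^ (z ^+ n.+1) = b ^ u * (b ^ L i)^-1.
      by rewrite conjgE -cn mulKg.
    by rewrite -[in RHS]E -conjgM expgS expVgn mulgK.
  by apply: (spX _ _ _ zV); exact/span_gen/WL.
have zD h : span (diff_gens A L) h -> span (diff_gens A L) (h ^ z).
  apply: span_conj => _ /(diff_gens_shift 0) [i [u [v [_ Qu Qv ->]]]].
  have gW u' : precedes A (shift i L) u' -> diff_gens A L ((b ^ u' * (b ^ L i)^-1) ^ z).
    move=> Qu'; have [x [y [Qx Qy ->]]] := dich _ _ _ _ (config_of smA Qu' (genz i)).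
    exact: diff_gens_precedes Qx Qy.
  rewrite (divg_chain _ (b ^ L i)) conjMg conjVg; apply: span_mul; first exact/span_gen/gW.
  by apply/span_gen/diff_gensV/gW.
split=> u i Qu; first by apply/zD/span_gen/WL.
have [n cn] := tor u i Qu.
have -> : (b ^ u * (b ^ L i)^-1) ^ z^-1 = (b ^ u * (b ^ L i)^-1) ^ (z ^+ n).
  have E : (b ^ u * (b ^ L i)^-1) ^ (z ^+ n.+1) = b ^ u * (b ^ L i)^-1.
    by rewrite conjgE -cn mulKg.
  by rewrite -[in LHS]E -conjgM expgSr mulgK.
by apply: (spX _ _ _ zD); exact/span_gen/WL.
Qed.

(* The two outcomes of dp-minimality for c = (b ^ x)^-1 * b ^ y, with x a term of
   a Morley sequence I and y generic over I and a Morley sequence L over I: either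
   I stays indiscernible over L and c, or L is a Morley sequence over c. *)
Definition inner_type A : Prop := forall u w L y, config A u w L y ->
  (exists y', gen (A `|` range L) y' /\ b ^ u * (b ^ w)^-1 * b ^ y = b ^ y') /\
  (exists y', gen (A `|` range L) y' /\ b ^ w * (b ^ u)^-1 * b ^ y = b ^ y').

Definition outer_type A : Prop := forall x L y, gen A x -> mor (A `|` [set x]) L ->
  gen (A `|` [set x] `|` range L) y -> mor (A `|` [set (b ^ x)^-1 * b ^ y]) L.

Lemma config_seq A x L y : gen A x -> mor (A `|` [set x]) L ->
  gen (A `|` [set x] `|` range L) y -> config A x (L 0%N) (shift 1 L) y.
Proof.
move=> rx mL ry; have [h1 h2] := mor_head (i := 0%N) mL; split=> //.
apply: gmono ry => z [[[Az|->]|->]|[i _ <-]]; [by left; left|by left; right|by right; exists 0%N|].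
by right; exists i.+1.
Qed.

(** If the term of [I] inside c can be exchanged with both its neighbours over [L] and c, the
    outcome is [inner_type]. Otherwise [I] is not indiscernible over c, and dp-minimality makes a
    tail of [L] indiscernible over c, even when continued by [Y]. *)
Lemma type_dichotomy A : sm A -> A b -> inner_type A \/ outer_type A.
Proof.
move=> smA Ab.
have [I m1] := mor_ex AS gG smA.
have sm1 : sm (A `|` range I) by auto.
have [L mL] := mor_ex AS gG sm1.
have sm2 : sm (A `|` range I `|` range L) by auto.
have [Y mY] := mor_ex AS gG sm2.
have rY0 : gen (A `|` range I `|` range L) (Y 0%N) by apply: gmono (mY 0%N); subs.
(* Index 1 is chosen because it has a neighbour on each side: exchanging it with 0 and with 2 gives
   the two halves of [inner_type]. *)
pose c := (b ^ I 1%N)^-1 * b ^ Y 0%N.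
have Kc : K c.
  by apply: KM; [apply: KV|]; apply: KJ => //; [exact: genK (m1 _)|exact: genK rY0].
pose swap i := exists s, [/\ Aut s, fixes A s, fixes (range L) s, s c = c & s (I 1%N) = I i].
have [[sw0 sw2]|nsw] := pselect (swap 0%N /\ swap 2%N); [left|right].
  have sw i : swap i -> exists y', gen (A `|` range L) y' /\
      b ^ I i * (b ^ I 1%N)^-1 * b ^ Y 0%N = b ^ y'.
    move=> [s [hs sA sL sc sI]]; exists (s (Y 0%N)); split.
      have := g_aut gG hs (gmono (A' := A `|` range L) _ rY0).
      rewrite image_setU !fixes_image //; apply; subs.
    rewrite -(mulgA (b ^ I i)) -/c -sc (autVM _ _ _ _ hs) sI (sA _ Ab); exact: mulVKg.
  move=> u w M y cf.
  have c0 i : config A (I i) (I i.+1) L (Y 0%N).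
    split.
    - by apply: gmono (m1 i); subs.
    - by apply: gmono (m1 i.+1) => x [Ax|->]; [left|right; exists i].
    - by apply: mmono mL => x [[Ax|->]|->]; [left|right; exists i|right; exists i.+1].
    - by apply: gmono rY0 => x [[[Ax|->]|->]|Lx]; [left; left|left; right; exists i|
        left; right; exists i.+1|right].
  split.
    have [t [ht tA tu tw [tL tz]]] := config_conj smA (c0 0%N) cf.
    have [y' [ry' E]] := sw _ sw0; exists (t y'); split.
      have := g_aut gG ht ry'; rewrite image_setU fixes_image //.
      by rewrite image_comp tL.
    have := congr1 t E; rewrite (AutG ht) (autMV _ _ _ _ ht) 2!(autJ _ _ ht).
    by rewrite tu tw tz (tA _ Ab).
  have [t [ht tA tu tw [tL tz]]] := config_conj smA (c0 1%N) cf.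
  have [y' [ry' E]] := sw _ sw2; exists (t y'); split.
    have := g_aut gG ht ry'; rewrite image_setU fixes_image //.
    by rewrite image_comp tL.
  have := congr1 t E; rewrite (AutG ht) (autMV _ _ _ _ ht) 2!(autJ _ _ ht).
  by rewrite tu tw tz (tA _ Ab).
have [i nsi] : exists i, ~ swap i.
  by apply: contrapT => /forallNP h; apply: nsw; split; apply: contrapT; exact: h.
(* Compactness: an exchange possible over every initial segment of [L] would be possible over [L].
   The sequence [f] lists the term of [I] first and then [L], so that [as_seq] applies. *)
have [r nr] : exists r, ~ exists s, [/\ Aut s, fixes A s, fixes (before L r) s, s c = c &
    s (I 1%N) = I i].
  apply: contrapT => /forallNP h; apply: nsi.
  pose f (a : gT) n := if n is m.+1 then L m else a.
  have [|n|s [hs sA sf]] := @as_seq _ _ _ AS (A `|` [set c]) (f (I 1%N)) (f (I i)).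
  - by auto.
  - have /contrapT [s [hs sA sL sc sI]] := h n.
    exists s; split=> // [a [Aa|->//]|[|j] jn //=]; first exact: sA.
    by apply: sL; exists j => //; exact: ltnW.
  exists s; split=> // [a Aa|_ [j _ <-]||].
  - by apply: sA; left.
  - exact: (sf j.+1).
  - by apply: sA; right.
  - exact: (sf 0%N).
pose A' := A `|` before L r.
have smA' : sm A' by apply: smU => //; exact: (small_before AS).
(* A stretch of [L] from index r on, continued by [Y], is a Morley sequence over [A], [I] and the
   first r terms of [L]. Being mutually indiscernible with [I], which by the choice of r is not
   indiscernible over [A'] and c, it is itself indiscernible over [A'] and c. *)
pose Y' m k := if k < m then shift r L k else Y (k - m)%N.
have Y'sub m : range (Y' m) `<=` range L `|` range Y.
  move=> _ [k _ <-]; rewrite /Y'; case: ifP => _; first by left; exists (r + k)%N.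
  by right; exists (k - m)%N.
have indI m : indisc Aut (A' `|` range (Y' m)) I.
  apply: (@indisc_mono _ _ (A `|` (range L `|` range Y))).
    move=> x [[Ax|Lx]|Yx]; [by left|right; left|by right; exact: (Y'sub m)].
    exact: before_range Lx.
  apply: indisc_stat; first exact: (mor_indisc AS gG).
  by apply: stationary_setU; [exact: (stationary_seq AS gG)|apply: (stationary_seq AS gG) => //; auto].
have indY m : indisc Aut (A' `|` range I) (Y' m).
  apply: (@indisc_mono _ _ (A `|` range I `|` before L r)); first by rewrite /A'; subs.
  apply: (mor_indisc AS gG); first by apply: smU => //; exact: (small_before AS).
  apply: (mor_cat gG); first exact: (mor_drop gG r mL).
  apply: mmono mY => x [[h|h]|[j _ <-]]; [by left|by right; exact: before_range h|].
  by right; exists (r + j)%N.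
have indYc m : indisc Aut (A' `|` [set c]) (Y' m).
  case: (dpK smA' (indI m) (indY m) Kc) => // ind.
  have [s [hs sA sI]] := indisc1 1%N i ind; case: nr; exists s; split=> //.
  - by move=> a Aa; apply: sA; left; left.
  - by move=> a La; apply: sA; left; right.
  - by apply: sA; right.
(* Without its first term [Y] is a Morley sequence over c, because c is definable from b, [I 1] and
   [Y 0]. Indiscernibility of [Y'] over c carries this back to [L]. *)
pose YS n := Y n.+1.
have mYS : mor (A `|` [set c]) YS.
  have := mor_drop gG 1 mY; move/(mor_dcl1 (y := c)) => h.
  apply: (mmono _ (h _ _)).
  - by move=> x [Ax|->]; [left; left; left; left|right].
  - by apply: smU => //; exact: (small_before AS).
  move=> s hs sf; rewrite (autVM _ _ _ _ hs) !sf //.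
  - by right; exists 0%N.
  - by left; left; right; exists 1%N.
  - by left; left; left.
have mLc : mor (A `|` [set c]) (shift r L).
  move=> n.
  (* The stretch has n + 1 terms of [L], so index n + 2 + j of [Y'] is [Y] at j + 1, that is [YS] at
     j. *)
  have [||s [hs sf sY]] := indYc n.+1 n.+1 (fun j => j) (fun j => n.+2 + j)%N.
  - by [].
  - by move=> j k; rewrite ltn_add2l.
  have [t [ht sK tK]] := as_inv AS hs.
  have sL j : j <= n -> s (shift r L j) = YS j.
    rewrite -ltnS => jn; have := sY (Ordinal jn); rewrite /= /Y' jn.
    by rewrite addSnnS ltnNge leq_addr /= addKn.
  have := g_aut gG ht (mYS n); rewrite -(sL n (leqnn n)) sK; apply: gmono.
  move=> x [Acx|[j jn <-]].
    have sx : s x = x by apply: sf; case: Acx => [Ax|->]; [left; left|right].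
    by exists x; [left|rewrite -{1}sx sK].
  exists (YS j); first by right; exists j.
  by rewrite -sL ?sK //; exact: ltnW.
move=> x M y rx mM ry.
have rI1 : gen A (I 1%N) by apply: gmono (m1 1%N); subs.
have mI1 : mor (A `|` [set I 1%N]) (shift r L).
  by apply: mmono (mor_shift r mL) => z [Az|->]; [left|right; exists 1%N].
have rI1Y : gen (A `|` [set I 1%N] `|` range (shift r L)) (Y 0%N).
  apply: gmono rY0 => z [[Az|->]|/shift_range Lz]; [by left; left|by left; right; exists 1%N|].
  by right.
have [t [ht tA tu tw [tL tz]]] := config_conj smA (config_seq rI1 mI1 rI1Y) (config_seq rx mM ry).
have := mor_aut gG ht mLc; rewrite image_setU fixes_image // image_set1.
rewrite (autVM _ _ _ _ ht) tu tz (tA _ Ab); congr morley.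
apply/funext => -[|n]; first exact: tw.
exact: (congr1 (@^~ n) tL).
Qed.

Definition ev_generic L y : Prop := exists j, gen (range (shift j L)) y.

(** Each generator is split at a term of [L], and the two halves of [inner_type] absorb the two
    factors. Genericity over some tail is all that is kept, since different generators call for
    different tails. *)
Lemma inner_span A L d y : inner_type A -> sm A -> A b -> span (diff_gens A L) d -> ev_generic L y ->
  exists y', ev_generic L y' /\ d * b ^ y = b ^ y'.
Proof.
move=> inn smA Ab sd; elim: {d} sd y => [|d g sd IH Wg] y [j ry].
  by exists y; split; [exists j|rewrite mul1g].
have [i [u [v [ji Qu Qv ->]]]] := diff_gens_shift j Wg.
have rz : gen (range (shift i.+1 L)) y.
  by apply: gmono ry; apply: shift_range_le; exact: leqW.
have [_ [y1 [ry1 E1]]] := inn _ _ _ _ (config_of smA Qv rz).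
have rz1 : gen (range (shift i.+1 L)) y1 by apply: gmono ry1; subs.
have [[y2 [ry2 E2]] _] := inn _ _ _ _ (config_of smA Qu rz1).
have [|y3 [Py3 E3]] := IH y2; first by exists i.+1; apply: gmono ry2; subs.
by exists y3; split=> //; rewrite -E3 -E2 -E1; exact: mulg_chain.
Qed.

(** By [outer_type], [L] is a Morley sequence over c, so distality makes [y] and [u] generic over c
    and [L], hence conjugate over them; the automorphism from [y] to [u] moves [x] to the required
    element. *)
Lemma outer_swap A L x y u : outer_type A -> sm A -> A b -> precedes A L x ->
  gen (range L) y -> gen (range L) u ->
  exists x', precedes A L x' /\ b ^ u * (b ^ y)^-1 * b ^ x = b ^ x'.
Proof.
move=> out smA Ab [rx mL] ry ru.
have mLc := out _ _ _ rx mL (genT (smU1 x smA) mL ry).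
set c := (b ^ x)^-1 * b ^ y in mLc.
have smc : sm (A `|` [set c]) by auto.
have [s [hs sf sy]] := g_uniq gG (smUr L smc) (genT smc mLc ry) (genT smc mLc ru).
have sA : fixes A s by move=> a Aa; apply: sf; left; left.
exists (s x); split.
  by apply: precedes_aut => // i; apply: sf; right; exists i.
have : s c = c by apply: sf; left; right.
rewrite /c (autVM _ _ _ _ hs) sy (sA _ Ab) => E.
by rewrite (eqVM E) mulgVK.
Qed.

(** By [fin] it suffices to prove the claim after conjugation by one element of K, which can be
    taken generic; the difference then becomes a generator of D by [trans]. *)
Lemma class_shift k l : K k -> K l -> exists h, K h /\ b ^ k * (b ^ l)^-1 * b = b ^ h.
Proof.
move=> Kk Kl; pose A := [set b; k; l].
have smA : sm A by do !apply: smU1; exact: (small_set1 AS).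
have Ab : A b by left; left.
have Ak : A k by left; right.
have Al : A l by right.
have fin h y : K h -> K y -> (b ^ k * (b ^ l)^-1) ^ y * b ^ y = b ^ h ->
    exists h', K h' /\ b ^ k * (b ^ l)^-1 * b = b ^ h'.
  move=> Kh Ky E; exists (h * y^-1); split; first by apply: KM => //; exact: KV.
  by rewrite conjgM -E -conjMg conjgK.
(* Left multiplication of the generic x by k or l gives generics definable from x and the
   parameters, over which [L] is still a Morley sequence. *)
have trans A0 L x : sm A0 -> A `<=` A0 -> gen A0 x -> mor (A0 `|` [set x]) L ->
    span (diff_gens A0 L) ((b ^ k * (b ^ l)^-1) ^ x).
  move=> smA0 AA0 rx mL; apply: span_gen; rewrite conjMg conjVg -!conjgM.
  have Qm h : K h -> A h -> precedes A0 (shift 0%N L) (h * x).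
    move=> Kh /AA0 Ah; split; first exact: genL.
    apply: (mmono _ (mor_dcl1 (y := h * x) (smU1 x smA0) _ mL)); first by subs.
    by move=> s hs sf; rewrite (AutG hs) !sf //; [right|left].
  exact: (diff_gens_precedes (Qm _ Kk Ak) (Qm _ Kl Al)).
have [x rx] := g_ex gG smA.
have Kx := genK rx.
case: (type_dichotomy smA Ab) => [inn|out].
  have [L mL] := mor_ex AS gG (smU1 x smA).
  have [z rz] := g_ex gG (smUr L (smU1 x smA)).
  have rxz : gen (A `|` [set x] `|` range L) (x * z).
    by apply: genL => //; [auto|left; right].
  have rzL : gen (A `|` range L) z by apply: gmono rz; subs.
  have [] := span_diff_gens_conj smA Ab (mmono (@subsetUl _ A [set x]) mL) rzL (trans _ _ _ smA _ rx mL).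
    by [].
  rewrite -conjgM => h1 _.
  have [|y' [[j ry'] E]] := inner_span inn smA Ab h1 (y := x * z).
    by exists 0%N; apply: gmono rxz; subs.
  by apply: (fin _ (x * z)) E; [exact: genK ry'|exact: genK rxz].
have [L0 mL0] := mor_ex AS gG (smU1 x smA).
pose B := A `|` [set x] `|` range L0.
have smB : sm B by rewrite /B; auto.
have [m rm] := g_ex gG smB; have Km := genK rm.
have [L mL] := mor_ex AS gG (smU1 m smB).
have [z rz] := g_ex gG (smUr L (smU1 m smB)).
have Bb : B b by left; left.
have mLB : mor B L := mmono (@subsetUl _ B [set m]) mL.
(* Elements generic over B are generic over [L0], so [outer_swap] applies with [L0], and [x] stays
   among the elements preceding [L0]. *)
have Dx d : span (diff_gens B L) d -> exists x', precedes A L0 x' /\ d * b ^ x = b ^ x'.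
  move=> sd; have : precedes A L0 x by split.
  elim: {d} sd {rx mL0 Kx} (x) => [|d g sd IH [u [v [[i [ru _]] [j [rv _]] ->]]]] x1 Q1.
    by exists x1; split=> //; rewrite mul1g.
  have [| |x2 [Q2 E2]] := outer_swap out smA Ab Q1 (y := v) (u := u).
  - by apply: gmono rv; rewrite /B; subs.
  - by apply: gmono ru; rewrite /B; subs.
  have [x3 [Q3 E3]] := IH _ Q2; exists x3; split=> //.
  by rewrite -E3 -E2 -mulgA.
(* The difference conjugated by m is in D, whereas conjugation by x is wanted. The quotient of x by
   m is not generic over [L], but it is z' times the inverse of z, with z and z' both generic over
   [L], hence normalizing D. *)
pose y := x * z; pose z' := m^-1 * y.
have rz' : gen (B `|` [set m] `|` range L) z'.
  rewrite /z' /y mulgA.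
  apply: (gmono (A := B `|` [set m] `|` range L `|` [set m^-1 * x])); first by subs.
  apply: genL; [by auto| |by right|].
    by apply: KM => //; exact: KV.
  apply: gen_dcl1 => //; first by auto.
  move=> s hs sf; rewrite (AutG hs) (autV _ hs) !sf //; first by left; left; left; right.
  by left; right.
have sub : B `|` range L `<=` B `|` [set m] `|` range L by subs.
have AB : A `<=` B by rewrite /B; subs.
have [] := span_diff_gens_conj smB Bb mLB (gmono sub rz') (trans B L m smB AB rm mL).
rewrite -conjgM /z' mulVKg => h1 _.
have rzB : gen (B `|` range L) z by apply: gmono rz; subs.
have [_ h2] := span_diff_gens_conj smB Bb mLB rzB h1.
have [x' [Qx' E]] := Dx _ h2.
apply: (fin (x' * z) y); [| |].
- by apply: KM; [exact: genK Qx'.1|exact: genK rz].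
- by apply: KM => //; exact: genK rz.
by rewrite (conjgM b x' z) -E conjMg conjgKV -conjgM.
Qed.
End OneElement.

(** * The classes are normal subgroups and form a chain *)

(** Another form of [a,K]: the commutator of a and g is the conjugate of a by g a, times the inverse
    of a. *)
Definition diff_class a g : Prop := exists h, K h /\ g = a ^ h * a^-1.

Lemma diff_classMV a k l : K a -> K k -> K l -> diff_class a (a ^ k * (a ^ l)^-1).
Proof.
by move=> Ka Kk Kl; have [h [Kh E]] := class_shift Ka Kk Kl; exists h; rewrite -E mulgK.
Qed.

Lemma diff_classF a g g' : K a -> diff_class a g -> diff_class a g' -> diff_class a (g * g'^-1).
Proof.
move=> Ka [h [Kh ->]] [h' [Kh' ->]].
by rewrite -divg_chain; exact: diff_classMV.
Qed.

Lemma diff_classJ a g x : K a -> K x -> diff_class a g -> diff_class a (g ^ x).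
Proof.
move=> Ka Kx [h [Kh ->]]; rewrite conjMg conjVg -conjgM.
by apply: diff_classMV => //; exact: KM.
Qed.

(** An automorphism over [A] replaces [x0] by k [x0] and keeps [x1]. Dividing the two differences
    leaves a conjugate of the wanted element, and the class of a is a normal subgroup. *)
Lemma diff_class_transfer A a b k x0 x1 y y' : sm A -> A a -> A b -> A k ->
  K a -> K k -> gen A x0 -> gen (A `|` [set x0]) x1 -> gen A y -> gen A y' ->
  b ^ x0 * (b ^ x1)^-1 = a ^ y * (a ^ y')^-1 -> diff_class a (b ^ k * b^-1).
Proof.
move=> smA Aa Ab Ak Ka Kk r0 r1 ry ry' E.
have [s [hs sA s0 s1]] := gen_pair smA r0 r1 (genL smA Kk Ak r0) (gen_mull smA Kk Ak r0 r1).
have Es := congr1 s E; rewrite 2!(autMV _ _ _ _ hs) s0 s1 (sA _ Aa) (sA _ Ab) in Es.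
have X1 : diff_class a (b ^ x0 * (b ^ x1)^-1).
  by rewrite E; apply: diff_classMV => //; [exact: genK ry|exact: genK ry'].
have X2 : diff_class a (b ^ (k * x0) * (b ^ x1)^-1).
  by rewrite Es; apply: diff_classMV => //; [exact: genK (g_aut gG hs ry)|exact: genK (g_aut gG hs ry')].
have := diff_classJ Ka (KV (genK r0)) (diff_classF Ka X2 X1).
by rewrite -divg_chain conjgM -conjVg -conjMg conjgK.
Qed.

(** Counterexamples k and l to both inclusions are put among the parameters; whichever sequence
    dp-minimality keeps indiscernible over c, one of the two is refuted. *)
Lemma class_compare a b : K a -> K b ->
  (forall k, K k -> diff_class a (b ^ k * b^-1)) \/
  (forall k, K k -> diff_class b (a ^ k * a^-1)).
Proof.
move=> Ka Kb; apply: contrapT => /not_orP [/existsNP [k /not_implyP[Kk nk]]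
  /existsNP [l /not_implyP[Kl nl]]].
pose A := [set a; b; k; l].
have smA : sm A by do !apply: smU1; exact: (small_set1 AS).
have Aa : A a by left; left; left.
have Ab : A b by left; left; right.
have Ak : A k by left; right.
have Al : A l by right.
have [I m1] := mor_ex AS gG smA.
have [J m2] := mor_ex AS gG (smUr I smA).
have rI i : gen A (I i) by apply: gmono (m1 i); subs.
have rJ i : gen A (J i) by apply: gmono (m2 i); subs.
pose c := (b ^ I 0%N)^-1 * a ^ J 0%N.
have Kc : K c by apply: KM; [apply: KV|]; apply: KJ => //; [exact: genK (rI 0%N)|exact: genK (rJ 0%N)].
have [i1 i2] : indisc Aut (A `|` range J) I /\ indisc Aut (A `|` range I) J.
  split; last by apply: (mor_indisc AS gG) => //; auto.
  apply: indisc_stat; first exact: (mor_indisc AS gG).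
  by apply: (stationary_seq AS gG) => //; auto.
case: (dpK smA i1 i2 Kc) => /(indisc1 0%N 1%N) [s [hs sf s01]].
all: have sA : fixes A s by [move=> x Ax; apply: sf; left].
all: have : s c = c by [apply: sf; right].
all: rewrite /c (autVM _ _ _ _ hs) s01 (sA _ Aa) (sA _ Ab).
  have rs : gen A (s (J 0%N)) by have := g_aut gG hs (rJ 0%N); rewrite fixes_image.
  move=> E; apply: nk; apply: (diff_class_transfer smA Aa Ab Ak Ka Kk (rI 0%N) _ (rJ 0%N) rs).
    by apply: gmono (m1 1%N) => x [Ax|->]; [left|right; exists 0%N].
  by rewrite -(eqVM (esym E)); exact: erefl.
have rs : gen A (s (I 0%N)) by have := g_aut gG hs (rI 0%N); rewrite fixes_image.
move=> E; apply: nl; apply: (diff_class_transfer smA Ab Aa Al Kb Kl (rJ 0%N) _ (rI 0%N) rs).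
  by apply: gmono (m2 1%N) => x [Ax|->]; [left; left|right; exists 0%N].
by rewrite (eqVM (esym E)).
Qed.

End GroupPart.

(** * The commutator valuation *)

Section CommutatorValuation.
Local Open Scope group_scope.
Variable K : groupType.
Hypothesis shiftK : forall a k l : K, exists h, a ^ k * (a ^ l)^-1 * a = a ^ h.
Hypothesis compK : forall a b : K,
  (forall k, exists h, b ^ k * b^-1 = a ^ h * a^-1) \/
  (forall k, exists h, a ^ k * a^-1 = b ^ h * b^-1).

Lemma commsP (a x : K) : comms a x <-> exists h, x = a ^ h * a^-1.
Proof.
split=> [[g _ <-]|[h ->]].
  by exists (g * a); rewrite commgEl conjgM [in RHS]conjgE !mulgA mulgK.
exists (h * a^-1) => //.
by rewrite commgEl conjgM [(a ^ h) ^ _]conjgE invgK mulKg.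
Qed.

Lemma comms1 (a : K) : comms a 1.
Proof. by apply/commsP; exists 1; rewrite conjg1 mulgV. Qed.

Lemma commsMV (a k l : K) : comms a (a ^ k * (a ^ l)^-1).
Proof. by apply/commsP; have [h hE] := shiftK a k l; exists h; rewrite -hE mulgK. Qed.

Lemma commsF (a x y : K) : comms a x -> comms a y -> comms a (x * y^-1).
Proof. by move=> /commsP[h ->] /commsP[g ->]; rewrite invgM invgK mulgA mulgVK; exact: commsMV. Qed.

Lemma commsV (a x : K) : comms a x -> comms a x^-1.
Proof. by move=> ax; rewrite -[x^-1]mul1g; apply: commsF => //; exact: comms1. Qed.

Lemma commsM (a x y : K) : comms a x -> comms a y -> comms a (x * y).
Proof. by move=> ax ay; rewrite -[y]invgK; apply: commsF => //; exact: commsV. Qed.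

Lemma commsJ (a x g : K) : comms a x -> comms a (x ^ g).
Proof. by move=> /commsP[h ->]; rewrite conjMg conjVg -conjgM; exact: commsMV. Qed.

Lemma comms_sub (a x : K) : comms a x -> comms x `<=` comms a.
Proof. by move=> ax y /commsP[h ->]; apply: commsF => //; exact: commsJ. Qed.

Lemma comms_conj (a g : K) : comms (a ^ g) = comms a.
Proof.
have sub (b h : K) : comms (b ^ h) `<=` comms b.
  by move=> x /commsP[k ->]; rewrite -conjgM; exact: commsMV.
by apply/seteqP; split; [exact: sub|rewrite -{1}(conjgK g a); exact: sub].
Qed.

Lemma comms_inv (a : K) : comms a^-1 = comms a.
Proof.
have sub (b : K) : comms b^-1 `<=` comms b.
  move=> x /commsP[k ->]; rewrite invgK conjVg.
  have -> : (b ^ k)^-1 * b = [~ b, k]^-1 by rewrite commgEl [RHS]invgM invgK.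
  by apply: commsV; exists k.
by apply/seteqP; split; [exact: sub|rewrite -{1}(invgK a); exact: sub].
Qed.

Lemma comms_mul (a b c : K) : comms a `<=` comms c -> comms b `<=` comms c ->
  comms (a * b) `<=` comms c.
Proof.
move=> ac bc x /commsP[k ->].
have -> : (a * b) ^ k * (a * b)^-1 = (b ^ k * b^-1) ^ (a ^ k)^-1 * (a ^ k * a^-1).
  rewrite conjMg [(a * b)^-1]invgM [(_ * b^-1) ^ _]conjgE invgK.
  by move: (a ^ k) (b ^ k) => y z; rewrite !mulgA mulgVK.
apply: commsM; first by apply/commsJ/bc/commsP; exists k.
by apply/ac/commsP; exists k.
Qed.

Lemma comms_total (a b : K) : comms a `<=` comms b \/ comms b `<=` comms a.
Proof.
by case: (compK a b) => h; [right|left] => x /commsP[k ->]; apply/commsP; exact: h.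
Qed.

Lemma comms_trivial (a : K) : comms a `<=` [set 1] <-> coset (center K) a = 1.
Proof.
split=> [h|/coset_eqP].
  apply/coset_eqP; rewrite mulg1; apply/mem_set => g.
  suff ca : commute g a by apply/commute_sym/commuteV.
  have : [~ a, g] = 1 by apply: h; exists g.
  by move=> E; rewrite /commute [RHS]commgC E mulg1.
rewrite mulg1 => /set_mem ca _ [g _ <-].
have cg : commute g a by rewrite -[a]invgK; apply: commuteV; apply: commute_sym; exact: ca.
by rewrite commgEl conjgE -cg mulKg mulVg.
Qed.

Lemma comms_proper (a x : K) : coset (center K) a <> 1 -> comms a x ->
  comms x `<=` comms a /\ comms a <> comms x.
Proof.
move=> na ax; split; first exact: comms_sub.
move=> E; apply: na; apply/comms_trivial; rewrite E.
(* If the two sets agree, x belongs to its own commutator set, which is a group; its inverse is then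
   a conjugate of x times that inverse, forcing x = 1. *)
have /commsV /commsP [h hE] : comms x x by rewrite -E.
have : x ^ h = 1 by apply: (mulIg x^-1); rewrite -hE mul1g.
move/(congr1 (conjg^~ h^-1)); rewrite conjgK conj1g => ->.
by move=> _ /commsP[k ->]; rewrite conj1g invg1 mulg1.
Qed.

Lemma coset_mul (x y : K) : coset (center K) x * coset (center K) y = coset (center K) (x * y).
Proof. exact: cosetM. Qed.

Lemma coset_inv (x : K) : (coset (center K) x)^-1 = coset (center K) x^-1.
Proof. exact: cosetV. Qed.

Lemma coset_conj (x y : K) : coset (center K) x ^ coset (center K) y = coset (center K) (x ^ y).
Proof. by rewrite [LHS]conjgE coset_inv (coset_mul x y) coset_mul. Qed.

Lemma coset_commg (x y : K) :
  [~ coset (center K) x, coset (center K) y] = coset (center K) [~ x, y].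
Proof. by rewrite commgEl coset_conj coset_inv coset_mul. Qed.

Lemma comms_plain_valued : plain_valued_group (range (@comms K))
  (fun X Y : set K => Y `<=` X) (@comms_quot K).
Proof.
split.
- split.
  + by move=> X _.
  + by move=> X Y _ _ YX XY; apply/seteqP.
  + by move=> X Y Z _ _ _ YX ZY; exact: subset_trans ZY YX.
  + by move=> _ _ [a _ <-] [b _ <-]; case: (comms_total a b); [right|left].
  + apply/seteqP; split=> [_ [u _ <-]|_ [a _ <-]]; first by exists (repr u).
    by exists (coset (center K) a) => //; rewrite comms_quotE.
  + exists (comms 1); split; first by exists 1.
      by move=> _ [a _ <-]; apply: comms_sub; exact: comms1.
    have c11 : comms (1 : K) `<=` [set 1] by apply/comms_trivial.
    move=> u; rewrite -(coset_repr u) comms_quotE; split=> [E|/comms_trivial h].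
      by apply/comms_trivial; rewrite E.
    by apply/seteqP; split=> [x /h ->|x /c11 ->]; exact: comms1.
  + move=> g a b; rewrite -(coset_repr g) -(coset_repr a) -(coset_repr b).
    by rewrite 2!coset_conj !comms_quotE !comms_conj.
  + by move=> a; rewrite -(coset_repr a) coset_inv !comms_quotE comms_inv.
  + move=> a b; rewrite -(coset_repr a) -(coset_repr b) coset_mul !comms_quotE /omin.
    set x := repr a; set y := repr b; case: asboolP => h; first exact: comms_mul.
    by apply: comms_mul => //; case: (comms_total x y).
move=> a b; rewrite -(coset_repr a) -(coset_repr b); set x := repr a; set y := repr b.
move=> na nb; rewrite coset_commg !comms_quotE.
have cx : comms x [~ x, y] by exists y.
have cy : comms y [~ x, y].
  by rewrite -[[~ x, y]]invgK; apply: commsV; exists x => //; rewrite !commgEl !conjgE !invgM !invgK !mulgA.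
by rewrite /omax; case: asboolP => _; [case: (comms_proper nb cy)|case: (comms_proper na cx)].
Qed.

End CommutatorValuation.

(** * Definable relations on a definable group *)

Section Absorb.
Local Open Scope group_scope.
Variables (L : language) (C : structure L).

(* Parameters that are coordinates of the tuple need not be named. *)
Lemma tp_absorb V W (r : V -> W) (a b : W -> C) (E E0 : set C) :
  (forall e, E e -> E0 e \/ exists w, a w = e /\ b w = e) ->
  tp E0 a = tp E0 b -> tp E (a \o r) = tp E (b \o r).
Proof.
move=> EE0 /tpP ab; apply/tpP => X /definable_params [k [phi [d [dE ->]]]] /=.
have /choice[w wP] : forall i, exists w : W + C, match w with
    | inl w => a w = d i /\ b w = d i | inr c => E0 c /\ c = d i end.
  move=> i; have /EE0 [E0d|[w w_d]] : E (d i) by apply: dE; exists i.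
    by exists (inr (d i)).
  by exists (inl w).
pose t (x : V + 'I_k) : W + C := match x with inl v => inl (r v) | inr i => w i end.
pose Y := [set x : W -> C | sat phi (fun v => match t v with inl w => x w | inr c => c end)].
have dY : definable E0 Y.
  apply: (@definable_subst L C _ _ t E0 [set x | sat phi x]).
    by move=> [v|i] c //= wi; have := wP i; rewrite wi => -[].
  apply/definable_params; exists 0%N, (frename inl phi), (of_I0 C); split.
    by move=> x [i _ ix]; have := ltn_ord i; rewrite ltn0.
  apply/seteqP; split=> x /=; rewrite sat_rename => h;
    by apply: (iffLR (sat_ext_fv _) h).
have E1 : sat phi (tcat (a \o r) d) <-> Y a.
  apply: sat_ext_fv => -[v|i] //= _; have := wP i.
  by case: (w i) => [x [-> _]|c [_ ->]].
have E2 : sat phi (tcat (b \o r) d) <-> Y b.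
  apply: sat_ext_fv => -[v|i] //= _; have := wP i.
  by case: (w i) => [x [_ ->]|c [_ ->]].
by move=> h; apply/E2; apply: (ab Y dY); apply/E1.
Qed.

Lemma definable_finite V (E : set C) (X : set (V -> C)) : definable E X ->
  exists k (d : 'I_k -> C), range d `<=` E /\ definable (range d) X.
Proof.
move=> /definable_params [k [phi [d [dE ->]]]]; exists k, d; split=> //.
by apply/definable_params; exists k, phi, d; split.
Qed.

End Absorb.

Section DefinableRelations.
Local Open Scope group_scope.
Variables (L : language) (C : structure L) (Gt : definable_group C).
Local Notation emb := (@dg_emb L C Gt).
Local Notation n := (dg_dim Gt).
Implicit Types (E A N : set C) (V W : finType).

(** Relations on the group are handled with group variables named by a finite type, each standing
    for a block of coordinates, so definability is checked without writing formulas. *)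
Definition gset V (Psi : (V -> Gt) -> Prop) : set (V * 'I_n -> C) :=
  [set z | exists g : V -> Gt, (forall v i, z (v, i) = emb (g v) i) /\ Psi g].

Definition gdef E V (Psi : (V -> Gt) -> Prop) : Prop :=
  definable E (gset Psi).

Lemma gset_inj V (g g' : V -> Gt) (z : V * 'I_n -> C) :
  (forall v i, z (v, i) = emb (g v) i) -> (forall v i, z (v, i) = emb (g' v) i) -> g = g'.
Proof.
move=> zg zg'; apply/funext => v; apply: (@dg_emb_inj _ _ Gt); apply/funext => i.
by rewrite -zg -zg'.
Qed.

Variable N : set C.
Hypothesis gN : group_definable_over N emb.

Lemma definable_bigcap V E T (F : V -> set (T -> C)) (s : seq V) :
  (forall v, definable E (F v)) -> definable E [set z | forall v, v \in s -> F v z].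
Proof.
move=> dF; elim: s => [|v s IH].
  have -> : [set z | forall v : V, v \in [::] -> F v z] = setT by apply/seteqP.
  exact: definable_setT.
have -> : [set z | forall u, u \in v :: s -> F u z] = F v `&` [set z | forall v, v \in s -> F v z].
  apply/seteqP; split=> z /= H.
    by split=> [|u us]; apply: H; rewrite inE ?eqxx ?us ?orbT.
  by move=> u; rewrite inE => /orP[/eqP ->|us]; [exact: H.1|exact: H.2].
exact: definable_and.
Qed.

Lemma gdef_true E V : N `<=` E -> @gdef E V (fun=> True).
Proof.
move=> NE; have dr := definable_mono NE gN.1.
have := @definable_bigcap V E _ (fun v => [set z : V * 'I_n -> C | range emb (z \o pair v)])
  (enum V) (fun v => definable_rename (pair v) dr).
congr definable; apply/seteqP; split=> z /= H; last first.
  by have [g [zg _]] := H => v _; exists (g v) => //; apply/funext => i /=.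
have /choice[g gP] : forall v, exists g, emb g = z \o pair v.
  by move=> v; have [|g _ <-] := H v; [rewrite mem_enum|exists g].
by exists g; split=> // v i; rewrite gP.
Qed.

Lemma gdef_not E V (Psi : (V -> Gt) -> Prop) : N `<=` E -> gdef E Psi -> gdef E (fun g => ~ Psi g).
Proof.
move=> NE dP; have := definable_and (gdef_true V NE) (definable_not dP).
congr definable; apply/seteqP; split=> z /=.
  by move=> [[g [zg _]] nz]; exists g; split=> // Pg; apply: nz; exists g.
move=> [g [zg nP]]; split; first by exists g.
by move=> [g' [zg' Pg']]; apply: nP; rewrite (gset_inj zg zg').
Qed.

Lemma gdef_and E V (Psi Phi : (V -> Gt) -> Prop) : gdef E Psi -> gdef E Phi ->
  gdef E (fun g => Psi g /\ Phi g).
Proof.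
move=> dP dQ; have := definable_and dP dQ; congr definable; apply/seteqP; split=> z /=.
  by move=> [[g [zg Pg]] [g' [zg' Qg']]]; exists g; split=> //; split=> //; rewrite (gset_inj zg zg').
by move=> [g [zg [Pg Qg]]]; split; exists g.
Qed.

Lemma gdef_rename E V W (r : V -> W) (Psi : (V -> Gt) -> Prop) : N `<=` E -> gdef E Psi ->
  gdef E (fun g : W -> Gt => Psi (g \o r)).
Proof.
move=> NE dP.
have := definable_and (gdef_true W NE) (definable_rename (fun x => (r x.1, x.2)) dP).
congr definable; apply/seteqP; split=> z /=.
  move=> [[g [zg _]] [g' [zg' Pg']]]; exists g; split=> //.
  suff -> : g \o r = g' by [].
  by apply: (@gset_inj _ _ _ (fun x => z (r x.1, x.2))) => // v i; rewrite /= zg.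
move=> [g [zg Pg]]; split; first by exists g.
by exists (g \o r); split=> // v i /=.
Qed.

Lemma gdef_ex E V (Psi : (option V -> Gt) -> Prop) : gdef E Psi ->
  gdef E (fun g : V -> Gt => exists u, Psi (env_cons u g)).
Proof.
move=> dP.
pose t (x : option V * 'I_n) : V * 'I_n + 'I_n :=
  match x with (Some v, i) => inl (v, i) | (None, i) => inr i end.
have := definable_exn (definable_rename t dP).
congr definable; apply/seteqP; split=> z /=.
  move=> [b [g [zg Pg]]]; exists (g \o Some); split=> [v i|]; first by rewrite -zg.
  exists (g None); suff -> : env_cons (g None) (g \o Some) = g by [].
  by apply/funext => -[].
move=> [g [zg [u Pu]]]; exists (emb u), (env_cons u g); split=> // -[v|] i //=.
Qed.

Lemma gdef_plug E V (Psi : (option V -> Gt) -> Prop) (h : Gt) : range (emb h) `<=` E ->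
  gdef E Psi -> gdef E (fun g : V -> Gt => Psi (env_cons h g)).
Proof.
move=> hE dP.
pose t (x : option V * 'I_n) : V * 'I_n + C :=
  match x with (Some v, i) => inl (v, i) | (None, i) => inr (emb h i) end.
have tE x c : t x = inr c -> E c.
  by case: x => -[v|] i //= [<-]; apply: hE; exists i.
have := definable_subst tE dP.
congr definable; apply/seteqP; split=> z /=.
  move=> [g [zg Pg]]; exists (g \o Some); split=> [v i|]; first by rewrite -zg.
  suff -> : env_cons h (g \o Some) = g by [].
  apply/funext => -[//|] /=; apply: (@dg_emb_inj _ _ Gt); apply/funext => i.
  by rewrite -(zg None i).
by move=> [g [zg Pg]]; exists (env_cons h g); split=> // -[v|] i /=.
Qed.

Lemma gdef_mul E V (a b c : V) : N `<=` E -> gdef E (fun g : V -> Gt => g a * g b = g c).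
Proof.
move=> NE.
pose t (x : 'I_n + ('I_n + 'I_n)) : V * 'I_n :=
  match x with inl i => (a, i) | inr (inl i) => (b, i) | inr (inr i) => (c, i) end.
have := definable_and (gdef_true V NE) (definable_rename t (definable_mono NE gN.2)).
congr definable; apply/seteqP; split=> z /=.
  move=> [[g [zg _]] [x [y zxy]]]; exists g; split=> //.
  have H w k s : (forall i, t (s i) = (w, i)) ->
      (forall i, tcat (emb x) (tcat (emb y) (emb (x * y))) (s i) = emb k i) -> g w = k.
    move=> ts sk; apply: (@dg_emb_inj _ _ Gt); apply/funext => i.
    by rewrite -zg -sk -zxy /= ts.
  rewrite (H a x inl) // (H b y (fun i => inr (inl i))) //.
  by rewrite (H c (x * y) (fun i => inr (inr i))).
move=> [g [zg E']]; split; first by exists g.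
exists (g a), (g b); rewrite E'.
by apply/funext => -[i|[i|i]] /=; rewrite zg.
Qed.

Lemma gdef_pre E V (X : set ('I_n -> C)) (v : V) : N `<=` E -> definable E X ->
  gdef E (fun g : V -> Gt => X (emb (g v))).
Proof.
move=> NE dX; have := definable_and (gdef_true V NE) (definable_rename (pair v) dX).
congr definable; apply/seteqP; split=> z /=.
  move=> [[g [zg _]] Xz]; exists g; split=> //.
  by move: Xz; congr X; apply/funext => i /=.
move=> [g [zg Xg]]; split; first by exists g.
by move: Xg; congr X; apply/funext => i /=.
Qed.

(** Multiplication is a definable graph and not a term, so a product is substituted through an
    existentially quantified variable equal to it. *)
Lemma gdef_mulsub E V (a b : V) (Psi : (option V -> Gt) -> Prop) : N `<=` E -> gdef E Psi ->
  gdef E (fun g : V -> Gt => Psi (env_cons (g a * g b) g)).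
Proof.
move=> NE dP.
have := gdef_ex (gdef_and (gdef_mul (Some a) (Some b) None NE) dP).
congr gdef; apply/funext => g; apply/propext; split=> /=.
  by move=> [u [-> ?]].
by exists (g a * g b).
Qed.

Lemma gdef_unit E (Psi : Gt -> Prop) : gdef E (fun g : unit -> Gt => Psi (g tt)) ->
  definable E (emb @` [set x | Psi x]).
Proof.
move=> /(definable_rename (fun x : unit * 'I_n => x.2)); congr definable.
apply/seteqP; split=> [z [g [zg Pg]]|_ [x Px <-]].
  by exists (g tt) => //; apply/funext => i; rewrite -(zg tt i).
by exists (fun=> x).
Qed.

Lemma gdef_bool E (Psi : Gt -> Gt -> Prop) :
  gdef E (fun g : bool -> Gt => Psi (g false) (g true)) ->
  definable E [set z : 'I_n + 'I_n -> C | exists x y, z = tcat (emb x) (emb y) /\ Psi x y].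
Proof.
pose t (x : bool * 'I_n) : 'I_n + 'I_n := if x.1 then inr x.2 else inl x.2.
move=> /(definable_rename t); congr definable.
apply/seteqP; split=> z /=.
  move=> [g [zg Pg]]; exists (g false), (g true); split=> //.
  by apply/funext => -[i|i] /=; [rewrite -(zg false i)|rewrite -(zg true i)].
by move=> [x [y [-> Pxy]]]; exists (fun b => if b then y else x); split=> // -[] i.
Qed.

End DefinableRelations.

(** * Group automorphisms induced by the monster model *)

Section GroupAutomorphisms.
Local Open Scope group_scope.
Variables (L : language) (C : structure L) (kappa : Type) (Gt : definable_group C).
Local Notation emb := (@dg_emb L C Gt).
Local Notation n := (dg_dim Gt).
Local Notation sm := (small kappa).
Hypothesis SL : strong_limit kappa.
Hypothesis smallN : sm [set: nat].
Hypothesis satC : saturated C kappa.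
Hypothesis homC : strongly_homogeneous C kappa.

Definition AutG (N : set C) (tau : Gt -> Gt) : Prop :=
  exists s, [/\ automorphism s, fixes N s & forall g, emb (tau g) = s \o emb g].

Definition coords (A : set Gt) : set C := \bigcup_(g in A) range (emb g).

Lemma emb_inj : injective emb. Proof. exact: dg_emb_inj. Qed.

Lemma coordsU A B : coords (A `|` B) = coords A `|` coords B.
Proof. exact: bigcup_setU. Qed.

Lemma coords1 g : coords [set g] = range (emb g).
Proof. exact: bigcup_set1. Qed.

Lemma coords_sub A B : A `<=` B -> coords A `<=` coords B.
Proof. by move=> AB c [g Ag cg]; exists g => //; exact: AB. Qed.

Lemma small_coords A : sm A -> sm (coords A).
Proof.
move=> smA; have smI : sm [set: 'I_n] by apply: small_countable => //; exact: countableP.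
apply: small_sub (small_image (fun x : Gt * 'I_n => emb x.1 x.2) (small_setX SL smallN smA smI)).
by move=> _ [g Ag [i _ <-]]; exists (g, i).
Qed.

Lemma small_emb g : sm (range (emb g)).
Proof. by apply: small_range => //; exact: countableP. Qed.

Lemma small_coordsU N A : sm N -> sm A -> sm (N `|` coords A).
Proof. by move=> smN smA; apply: small_setU => //; exact: small_coords. Qed.

Lemma AutG_lift N s : group_definable_over N emb -> automorphism s -> fixes N s ->
  exists tau, AutG N tau /\ forall g, emb (tau g) = s \o emb g.
Proof.
move=> [dN _] hs sN.
have /choice[tau tauE] : forall g, exists h, emb h = s \o emb g.
  move=> g; have : range emb (s \o emb g) by apply/(definable_aut _ hs sN dN); exists g.
  by move=> [h _ <-]; exists h.
by exists tau; split=> //; exists s.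
Qed.

Lemma AutG_morph N tau : group_definable_over N emb -> AutG N tau ->
  {morph tau : x y / x * y}.
Proof.
move=> [_ dm] [s [hs sN st]] x y.
have : mul_graph emb (s \o tcat (emb x) (tcat (emb y) (emb (x * y)))).
  by apply/(definable_aut _ hs sN dm); exists x, y.
move=> [a [b E]].
have Ea : tau x = a.
  by apply: emb_inj; apply/funext => i; rewrite st; exact: (congr1 (@^~ (inl i)) E).
have Eb : tau y = b.
  by apply: emb_inj; apply/funext => i; rewrite st; exact: (congr1 (@^~ (inr (inl i))) E).
by apply: emb_inj; apply/funext => i; rewrite st Ea Eb; exact: (congr1 (@^~ (inr (inr i))) E).
Qed.

Lemma AutG_type_definable N (H : set Gt) tau : type_definable N (emb @` H) -> AutG N tau ->
  forall g, H g <-> H (tau g).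
Proof.
move=> dH [s [hs sN st]] g.
have HE h : H h <-> (emb @` H) (emb h).
  by split=> [Hh|[h' Hh' /emb_inj <-//]]; exists h.
by rewrite !HE st; split=> h; apply/(type_definable_aut _ hs sN dH).
Qed.

Lemma fixes_coords s tau A : (forall g, emb (tau g) = s \o emb g) ->
  fixes (coords A) s <-> fixes A tau.
Proof.
move=> st; split=> [sA g Ag|tA _ [g Ag [i _ <-]]].
  apply: emb_inj; rewrite st; apply/funext => i /=; apply: sA.
  by exists g => //; exists i.
by rewrite -[in RHS](tA _ Ag) st.
Qed.

Definition flat I (f : I -> Gt) (x : I * 'I_n) : C := emb (f x.1) x.2.

Lemma tp_AutG I N A (f g : I -> Gt) : group_definable_over N emb -> countable [set: I] ->
  sm N -> sm A -> tp (N `|` coords A) (flat f) = tp (N `|` coords A) (flat g) ->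
  conj_over (AutG N) A f g.
Proof.
move=> gN cI smN smA E.
have smE : sm ((N `|` coords A) `|` range (flat f)).
  apply: small_setU => //; first exact: small_coordsU.
  apply: small_sub (small_coords (small_range smallN f cI)) => //.
  by move=> _ [[i j] _ <-]; exists (f i); [exists i|exists j].
have [s [hs sN sfg]] := tp_conj homC smE E.
have sN' : fixes N s by move=> c Nc; apply: sN; left.
have [tau [ht tE]] := AutG_lift gN hs sN'.
exists tau; split=> //.
  by apply/(fixes_coords _ tE) => c Ac; apply: sN; right.
move=> i; apply: emb_inj; rewrite tE; apply/funext => j.
exact: (congr1 (@^~ (i, j)) sfg).
Qed.

Lemma AutG_autsys N : group_definable_over N emb -> sm N -> autsys kappa (AutG N).
Proof.
move=> gN smN; split=> //.
- by exists idfun; split=> //; exact: aut_id.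
- move=> t u [s [hs sN st]] [r [hr rN ru]]; exists (s \o r); split.
  + exact: aut_comp.
  + by move=> c Nc /=; rewrite rN ?sN.
  + by move=> g /=; rewrite st ru.
- move=> t [s [hs sN st]]; have [r [hr sK rK]] := aut_inv hs.
  have rN : fixes N r by move=> c Nc; rewrite -{1}(sN _ Nc) sK.
  have [u [hu uE]] := AutG_lift gN hr rN; exists u; split=> // g; apply: emb_inj;
    rewrite ?uE ?st ?uE ?st; apply/funext => i /=; [exact: sK|exact: rK].
- move=> A f g smA fin.
  apply: (@tp_AutG nat N A f g) => //.
  (* A formula sees finitely many terms of the sequence, so an automorphism matching a long enough
     initial segment decides it. *)
  apply/tpP => X [phi [o ->]] /=.
  have [k [d dE]] := finite_set_ord_range (fv_finite phi).
  pose bnd := \max_(i < k) (if d i is inl (j, _) then j else 0%N).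
  have [tau [[s [hs sN st]] tA fg]] := fin bnd.+1.
  have so : fixes (N `|` coords A) s.
    by move=> c [Nc|Ac]; [exact: sN|move: c Ac; apply/(fixes_coords A st)].
  move/(psat_aut (flat f) hs so o); apply: (iffLR (sat_ext_fv _)) => -[[i j]|c] //= fi.
  have ib : i < bnd.+1.
    have : range d (inl (i, j)) by rewrite -dE.
    move=> [l _ dl]; rewrite ltnS.
    have := leq_bigmax (F := fun l => if d l is inl (j, _) then j else 0%N) l.
    by rewrite dl.
  by rewrite /flat /= -fg // st.
Qed.

Definition realg (P : set (set ('I_n -> C))) (N : set C) (A : set Gt) (g : Gt) : Prop :=
  real P (N `|` coords A) (emb g).

Lemma realg_grel P N : group_definable_over N emb -> sm N -> gtype P -> ginv N P ->
  (forall A y, N `<=` A -> real P A y -> range emb y) -> grel kappa (AutG N) (realg P N).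
Proof.
move=> gN smN gP iP PG; split.
- move=> A A' x AA; apply: real_mono; apply: setUS; exact: coords_sub.
- move=> A smA; have [y ry] := real_ex SL smallN satC gP (small_coordsU smN smA).
  have [|g _ gy] := PG _ _ _ ry; first exact: subsetUl.
  by exists g; rewrite /realg gy.
- move=> A x y smA rx ry.
  have cu : countable [set: unit] by exact: countableP.
  have Exy : tp (N `|` coords A) (flat (fun=> x)) = tp (N `|` coords A) (flat (fun _ : unit => y)).
    by apply: (@tp_rename _ _ _ _ _ (fun z : unit * 'I_n => z.2) (emb x) (emb y)); exact: real_tp gP rx ry.
  have [tau [ht tA txy]] := tp_AutG gN cu smN smA Exy.
  by exists tau; split=> //; exact: (txy tt).
- move=> tau A x [s [hs sN st]] rx; have := real_aut iP hs sN rx.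
  rewrite /realg st image_setU; congr real; congr setU.
    apply/seteqP; split=> [_ [c Nc <-]|c Nc]; first by rewrite sN.
    by exists c; rewrite ?sN.
  apply/seteqP; split=> [_ [_ [g Ag [i _ <-]] <-]|_ [_ [g Ag <-] [i _ <-]]].
    by exists (tau g); [exists g|exists i; rewrite ?st].
  by rewrite st; exists (emb g i) => //; exists g => //; exists i.
Qed.

(** Constants attached to each term act as parameters of the base. This is how dp-minimality, given
    over one fixed set, is used over larger sets. *)
Definition pad (I : nat -> Gt) k (d : 'I_k -> C) i (x : 'I_(n + k)) : C :=
  match fintype.split x with inl j => emb (I i) j | inr j => d j end.

Lemma pad_inl I k (d : 'I_k -> C) i j : pad I d i (unsplit (inl j)) = emb (I i) j.
Proof. by rewrite /pad unsplitK. Qed.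

Lemma pad_inr I k (d : 'I_k -> C) i j : pad I d i (unsplit (inr j)) = d j.
Proof. by rewrite /pad unsplitK. Qed.

Lemma indisc_frozen N A (I : nat -> Gt) k (d : 'I_k -> C) E : indisc (AutG N) A I ->
  E `<=` N `|` coords A -> range d `<=` N `|` coords A ->
  indiscernible E (pad I d).
Proof.
move=> ind EN dN m f g finc ginc.
have [tau [[s [hs sN st]] tA fg]] := ind m f g finc ginc.
have so : fixes (N `|` coords A) s.
  by move=> c [Nc|Ac]; [exact: sN|move: c Ac; apply/(fixes_coords A st)].
set a := subtuple _ f; set b := subtuple _ g.
have -> : b = s \o a.
  apply/funext => -[i x]; rewrite /a /b /subtuple /= /pad; case: (fintype.split x) => j.
    by have /= <- := fg i; rewrite st.
  by rewrite so //; apply: dN; exists j.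
by rewrite tp_aut // => c /EN/so.
Qed.

Lemma dp_minimal_indisc (G : set Gt) B :
  (forall m p (I1 : nat -> 'I_m -> C) (I2 : nat -> 'I_p -> C),
    mutually_indiscernible B I1 I2 -> forall a, G a ->
    indiscernible (B `|` range (emb a)) I1 \/ indiscernible (B `|` range (emb a)) I2) ->
  forall N A I1 I2 c, group_definable_over N emb -> sm N -> B `<=` N -> sm A ->
    indisc (AutG N) (A `|` range I2) I1 -> indisc (AutG N) (A `|` range I1) I2 -> G c ->
    indisc (AutG N) (A `|` [set c]) I1 \/ indisc (AutG N) (A `|` [set c]) I2.
Proof.
move=> dp N A I1 I2 c gN smN BN smA i1 i2 Gc.
(* a failure of indiscernibility over A and c only involves finitely many
   parameters of N and A, which are appended to the sequence *)
have bad I : ~ indisc (AutG N) (A `|` [set c]) I -> exists k (d : 'I_k -> C),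
    range d `<=` N `|` coords A /\
    ~ indiscernible (B `|` range (emb c)) (pad I d).
  move=> /existsNP[m /existsNP[f /existsNP[g /not_implyP[finc /not_implyP[ginc nc]]]]].
  (* Empty tuples are conjugate by the identity, and a tuple with at least one term displays the
     constants [d]. *)
  have m0 : 0 < m.
    case: m f g finc ginc nc => // f g _ _ []; exists id; split=> //; last by case.
    by exists idfun; split=> //; exact: aut_id.
  have : ~ (tp (N `|` coords (A `|` [set c])) (flat (I \o f)) =
            tp (N `|` coords (A `|` [set c])) (flat (I \o g))).
    move=> E; apply: nc; apply: tp_AutG => //.
    by apply: small_setU => //; apply: small_countable => //; exact: countable1.
  move/tpP/existsNP => [X /not_implyP[dX /not_implyP[Xf nXg]]].
  have [k1 [d1 [d1E dX1]]] := definable_finite dX.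
  have [k [d dE]] : exists k (d : 'I_k -> C), range d1 `&` (N `|` coords A) = range d.
    have [|k [d dE]] := @finite_set_ord_range _ (range d1 `&` (N `|` coords A)).
      by apply: finite_setIl; apply: finite_image; exact: finite_finset.
    by exists k, d.
  exists k, d; split=> [x|ind]; first by rewrite -dE => -[].
  have Ed := ind m f g finc ginc.
  pose r (x : 'I_m * 'I_n) : 'I_m * 'I_(n + k) := (x.1, unsplit (inl x.2)).
  have : tp (range d1) (flat (I \o f)) = tp (range d1) (flat (I \o g)).
    set a := subtuple _ f in Ed; set b := subtuple _ g in Ed.
    have -> : flat (I \o f) = a \o r.
      by apply/funext => -[i j]; rewrite /a /subtuple [RHS]pad_inl.
    have -> : flat (I \o g) = b \o r.
      by apply/funext => -[i j]; rewrite /b /subtuple [RHS]pad_inl.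
    apply: (@tp_absorb _ _ _ _ r a b _ _ _ Ed) => e d1e; have := d1E _ d1e; rewrite coordsU coords1.
    have [[j _ dj]|nd] := pselect (range d e).
      move=> _; right; exists (Ordinal m0, unsplit (inr j)).
      by split; rewrite -dj; exact: pad_inr.
    case=> [Ne|[Ae|ce]].
    - by case: nd; rewrite -dE; split=> //; left.
    - by case: nd; rewrite -dE; split=> //; right.
    - by left; right.
  by move/tpP => /(_ X dX1 Xf).
apply: contrapT => /not_orP [/bad [k1 [d1 [d1E nd1]]] /bad [k2 [d2 [d2E nd2]]]].
have el I k (d : 'I_k -> C) : range d `<=` N `|` coords A ->
    B `|` elts (pad I d) `<=` N `|` coords (A `|` range I).
  move=> dA x [/BN|[i _ [y _ <-]]]; first by left.
  rewrite coordsU /pad; case: (fintype.split y) => j.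
    by right; right; exists (I i); [exists i|exists j].
  by have [|h|h] := dA (d j); [exists j|left|right; left].
have dd I k (d : 'I_k -> C) : range d `<=` N `|` coords A ->
    range d `<=` N `|` coords (A `|` range I).
  by move=> h x /h; rewrite coordsU => -[]; [left|right; left].
have m12 : mutually_indiscernible B (pad I1 d1) (pad I2 d2).
  by split; [apply: indisc_frozen i1 _ _|apply: indisc_frozen i2 _ _]; by [exact: el|exact: dd].
by case: (dp _ _ _ _ m12 c Gc).
Qed.

(** For a finite tuple [d] of [A], weak orthogonality says that the type over [B] and [J] of [d]
    with a realization does not depend on the realization. Comparing [x] with one over [A] and [J]
    settles every formula with parameters in [A] and [J]. *)
Lemma distal_transfer (p : set (pformula C 'I_n)) B : global_type p ->
  (forall m (c : 'I_m -> C) (I : nat -> 'I_n -> C), morley_sequence p (B `|` range c) I ->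
     weakly_orthogonal (B `|` elts I) (tp (B `|` elts I) c) (restr p (B `|` elts I))) ->
  forall A (J : nat -> Gt) x, sm A -> B `<=` A ->
    (forall i, real (ptype p) (A `|` coords (before J i)) (emb (J i))) ->
    real (ptype p) (B `|` coords (range J)) x -> real (ptype p) (A `|` coords (range J)) x.
Proof.
move=> gp dis A J x smA BA mJ rx X dX PX.
have smE : sm (A `|` coords (range J)) by apply: small_coordsU => //; apply: small_range => //; exact: countableP.
have [y ry] := real_ex SL smallN satC (ptype_gtype gp) smE.
have [k1 [d1 [d1E dX1]]] := definable_finite dX.
have [k [d dE]] : exists k (d : 'I_k -> C), range d1 `&` A = range d.
  have [|k [d dE]] := @finite_set_ord_range _ (range d1 `&` A).
    by apply: finite_setIl; apply: finite_image; exact: finite_finset.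
  by exists k, d.
pose I i := emb (J i).
have EI : elts I = coords (range J).
  apply/seteqP; split=> [c [i _ ci]|c [_ [i _ <-] ci]]; first by exists (J i) => //; exists i.
  by exists i.
have dA : range d `<=` A by rewrite -dE; exact: subIsetr.
have mI : morley_sequence p (B `|` range d) I.
  move=> i; apply/(ptype_real _ _ gp); apply: real_mono (mJ i).
  move=> c [[/BA|/dA]|[j ji cj]]; [by left|by left|right].
  by exists (J j) => //; exists j.
have h E a : real (ptype p) E a -> realizes a (restr p E) by move/(ptype_real _ _ gp).
have ryB : real (ptype p) (B `|` coords (range J)) y.
  by apply: real_mono ry; exact: setSU.
have := dis _ d I mI d d x y; rewrite EI => /(_ _ _ (h _ _ rx) (h _ _ ryB)) E.
have Exy : tp (B `|` coords (range J)) (tcat d x) = tp (B `|` coords (range J)) (tcat d y).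
  by apply: E => phi [].
have : tp (range d1) (tcat d y \o inr) = tp (range d1) (tcat d x \o inr).
  apply: tp_absorb (esym Exy) => e d1e.
  have [[j _ dj]|nd] := pselect (range d e).
    by right; exists (inl j) => /=.
  case: (d1E _ d1e) => [Ae|Je]; last by left; right.
  by case: nd; rewrite -dE.
by move/tpP => /(_ X dX1); apply; exact: ry.
Qed.

End GroupAutomorphisms.

(** * The stabilizer of the distal type *)

Section Stabilizer.
Local Open Scope group_scope.
Variables (L : language) (C : structure L) (kappa : Type) (Gt : definable_group C).
Local Notation emb := (@dg_emb L C Gt).
Local Notation n := (dg_dim Gt).
Local Notation sm := (small kappa).
Hypothesis SL : strong_limit kappa.
Hypothesis smallL : sm [set: formula L nat].
Hypothesis satC : saturated C kappa.
Hypothesis homC : strongly_homogeneous C kappa.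
Variable G : subgroup Gt.
Variable N0 : set C.
Hypothesis smN0 : sm N0.
Hypothesis gN0 : group_definable_over N0 emb.
Hypothesis tG : type_definable N0 (emb @` (G : set Gt)).
Hypothesis dpG : forall N A I1 I2 c, group_definable_over N emb -> sm N -> N0 `<=` N -> sm A ->
  indisc (AutG N) (A `|` range I2) I1 -> indisc (AutG N) (A `|` range I1) I2 ->
  (G : set Gt) c ->
  indisc (AutG N) (A `|` [set c]) I1 \/ indisc (AutG N) (A `|` [set c]) I2.

Let smallN : sm [set: nat] := small_nat smallL.

Lemma G1 : (G : set Gt) 1. Proof. by have /set_mem := (sg_closed G).1. Qed.

Lemma GV x : (G : set Gt) x -> (G : set Gt) x^-1.
Proof. by move=> Gx; apply/set_mem/(group_closedV (sg_closed G))/mem_set. Qed.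

Lemma GM x y : (G : set Gt) x -> (G : set Gt) y -> (G : set Gt) (x * y).
Proof.
move=> Gx Gy; apply/set_mem/(group_closedM (sg_closed G)); exact: mem_set.
Qed.

Lemma GX x i : (G : set Gt) x -> (G : set Gt) (x ^+ i).
Proof. by move=> Gx; elim: i => [|i IH]; [exact: G1|rewrite expgS; exact: GM]. Qed.

Lemma gdefN N : N0 `<=` N -> group_definable_over N emb.
Proof. by move=> NN; split; [exact: definable_mono gN0.1|exact: definable_mono gN0.2]. Qed.

Lemma smU2 T (A B : set T) : sm A -> sm B -> sm (A `|` B).
Proof. exact: small_setU. Qed.

Lemma sm_seq (I : nat -> Gt) : sm (range I).
Proof. by apply: small_range => //; exact: countableP. Qed.

Lemma sm_coords (A : set Gt) : sm A -> sm (coords A).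
Proof. exact: small_coords. Qed.

Lemma sm_emb (g : Gt) : sm (range (emb g)).
Proof. exact: small_emb. Qed.

Hint Resolve smU2 sm_seq sm_coords sm_emb smN0 : core.

Lemma AutG_fix N tau (g : Gt) : AutG N tau -> range (emb g) `<=` N -> tau g = g.
Proof.
move=> [s [hs sN st]] gN; apply: emb_inj; rewrite st; apply/funext => i /=.
by apply: sN; apply: gN; exists i.
Qed.

Lemma autsysN N : N0 `<=` N -> sm N -> autsys kappa (@AutG L C Gt N).
Proof. by move=> NN smN; apply: AutG_autsys => //; exact: gdefN. Qed.

Lemma gdef_comm E (V : finType) (b : Gt) (v : V) : N0 `<=` E -> range (emb b) `<=` E ->
  gdef E (fun g : V -> Gt => g v * b = b * g v).
Proof.
move=> NE bE.
have d1 : gdef E (fun g : option V -> Gt => g None * g (Some v) = g (Some v) * g None).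
  apply: (gdef_mulsub (gdefN NE) (Some v) None
    (Psi := fun h => h (Some None) * h (Some (Some v)) = h None)) => //.
  exact: (gdef_mul (gdefN NE)).
have := gdef_plug bE d1; congr gdef; apply/funext => g.
by apply/propext; split=> /=.
Qed.

Lemma definable_section E (Psi : Gt -> Gt -> Prop) a : N0 `<=` E -> range (emb a) `<=` E ->
  gdef E (fun g : bool -> Gt => Psi (g false) (g true)) ->
  definable E (emb @` [set y | Psi a y]) /\ definable E (emb @` [set x | Psi x a]).
Proof.
move=> NE aE dP; split; apply: gdef_unit.
  pose r (b : bool) : option unit := if b then Some tt else None.
  have := gdef_plug aE (gdef_rename (gdefN NE) r (@subset_refl _ E) dP).
  by congr gdef.
pose r (b : bool) : option unit := if b then None else Some tt.
have := gdef_plug aE (gdef_rename (gdefN NE) r (@subset_refl _ E) dP).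
by congr gdef.
Qed.

Lemma gdef_preM E (V : finType) (X : set ('I_n -> C)) (v w : V) : N0 `<=` E -> definable E X ->
  gdef E (fun g : V -> Gt => X (emb (g v * g w))).
Proof.
move=> NE dX; apply: (gdef_mulsub (gdefN NE) v w (Psi := fun h => X (emb (h None)))) => //.
exact: (gdef_pre (gdefN NE)).
Qed.

Lemma gdef_preL E (V : finType) (X : set ('I_n -> C)) (a : Gt) (v : V) : N0 `<=` E ->
  range (emb a) `<=` E -> definable E X -> gdef E (fun g : V -> Gt => X (emb (a * g v))).
Proof.
move=> NE aE dX; have := gdef_plug aE (gdef_preM None (Some v) NE dX).
by congr gdef.
Qed.

(** * Averages of sequences in G, and commuting powers *)

Section Averages.
Local Open Scope group_scope.
Variable (U : set_system nat).
Hypothesis uU : UltraFilter U.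
Hypothesis npU : forall i, U [set j | j != i].
Variables (f : nat -> Gt) (N : set C).
Hypothesis fG : forall i, (G : set Gt) (f i).
Hypothesis NN : N0 `<=` N.
Hypothesis smN : sm N.
Hypothesis fN : forall i, range (emb (f i)) `<=` N.

Let q := avtype U (fun i => emb (f i)).

Lemma av_concentrated A y : N0 `<=` A -> real q A y -> (emb @` (G : set Gt)) y.
Proof.
move=> NA ry; have [S [SN GS]] := tG; rewrite GS => phi Sphi.
apply: (ry [set a | psat phi a]); first by exists phi; split=> //; apply: over_mono (SN _ Sphi).
split; first by exists phi.
have -> : [set i | [set a | psat phi a] (emb (f i))] = setT; last exact: filterT.
apply/seteqP; split=> // i _ /=.
have : (emb @` (G : set Gt)) (emb (f i)) by exists (f i).
by rewrite GS; apply.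
Qed.

Lemma av_grel : grel kappa (AutG N) (realg q N).
Proof.
apply: realg_grel => //; first exact: gdefN.
- exact: avtype_gtype.
- exact: avtype_inv.
- move=> A y NA ry; have [g _ <-] := av_concentrated (subset_trans NN NA) ry.
  by exists g.
Qed.

Lemma av_G A g : realg q N A g -> (G : set Gt) g.
Proof.
move=> rg; have [|h Gh /emb_inj <- //] := av_concentrated _ rg.
by move=> c /NN; left.
Qed.

Lemma av_closed A (Psi : Gt -> Prop) h : definable (N `|` coords A) (emb @` [set y | Psi y]) ->
  (exists i, forall j, j <> i -> Psi (f j)) -> realg q N A h -> Psi h.
Proof.
move=> dP [i Pf] rh; have [|h' Ph' /emb_inj <-//] := rh _ dP.
split; first exact: definable_setTS dP.
apply: filterS (npU i) => j /eqP ji; exists (f j) => //; exact: Pf.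
Qed.

(** The ultrafilter is nonprincipal, so for a fixed term the excluded index is negligible. [h 0] is
    handled first against the terms of [f], then [h 1] against [h 0], which explains the reversed
    order. *)
Lemma av_pairs (Psi : Gt -> Gt -> Prop) h :
  gdef N (fun g : bool -> Gt => Psi (g false) (g true)) ->
  (forall i j, i <> j -> Psi (f i) (f j)) -> morley (realg q N) set0 h -> Psi (h 1%N) (h 0%N).
Proof.
move=> dP Pf mh.
have P0 i : Psi (f i) (h 0%N).
  apply: (@av_closed (set0 `|` before h 0) (Psi (f i)) (h 0%N)) (mh 0%N).
    exact: definable_mono (@subsetUl _ _ _) (@definable_section N Psi (f i) NN (@fN i) dP).1.
  by exists i => j ji; apply: Pf => /esym.
apply: (@av_closed (set0 `|` before h 1) (Psi^~ (h 0%N)) (h 1%N)) (mh 1%N).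
  have h0 : range (emb (h 0%N)) `<=` N `|` coords (set0 `|` before h 1).
    by move=> c hc; right; exists (h 0%N) => //; right; exists 0%N.
  apply: (definable_section _ h0 _).2; first by move=> c /NN; left.
  apply: definable_mono dP; exact: subsetUl.
by exists 0%N.
Qed.

End Averages.

Lemma nonprincipal : exists U : set_system nat, UltraFilter U /\ forall i, U [set j | j != i].
Proof.
have [U [uU eU]] := ultraFilterLemma eventually_filter.
exists U; split=> // i; apply: eU; exists i.+1 => // j /= ij.
by rewrite gtn_eqF.
Qed.

Lemma commute_pow_diff (a b : Gt) i j w : i <> j -> a ^+ i * w = a ^+ j -> commute w b ->
  exists n, commute (a ^+ n.+1) b.
Proof.
move=> ij E cw; have [lt_ij|lt_ji|//] := ltngtP i j.
  exists (j - i).-1; rewrite prednK ?subn_gt0 //.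
  suff <- : w = a ^+ (j - i) by [].
  by apply: (mulgI (a ^+ i)); rewrite E -expgnDr subnKC // ltnW.
exists (i - j).-1; rewrite prednK ?subn_gt0 //.
suff <- : w^-1 = a ^+ (i - j) by apply/commute_sym/commuteV/commute_sym.
apply: (mulgI (a ^+ j)); rewrite -expgnDr (subnKC (ltnW lt_ji)) -E.
by rewrite mulgK.
Qed.

(* Two averages of powers of a and of b are mutually indiscernible; the product
   of their first terms breaks the indiscernibility of both. *)
Lemma generic_powers_commute a b : (G : set Gt) a -> (G : set Gt) b ->
  exists m, commute (a ^+ m.+1) b \/ commute (b ^+ m.+1) a.
Proof.
move=> Ga Gb; apply: contrapT => nab.
have na m : ~ commute (a ^+ m.+1) b by move=> h; apply: nab; exists m; left.
have nb m : ~ commute (b ^+ m.+1) a by move=> h; apply: nab; exists m; right.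
have [U [uU npU]] := nonprincipal.
pose N := N0 `|` coords (range (fun i : nat => a ^+ i)) `|` coords (range (fun i : nat => b ^+ i)).
have smN : sm N by rewrite /N; auto 6.
have NN : N0 `<=` N by move=> c; left; left.
have aN i : range (emb (a ^+ i)) `<=` N.
  by move=> c hc; left; right; exists (a ^+ i) => //; exists i.
have bN i : range (emb (b ^+ i)) `<=` N.
  by move=> c hc; right; exists (b ^+ i) => //; exists i.
have Gai i := GX i Ga; have Gbi i := GX i Gb.
have g1 := av_grel uU Gai NN smN aN; have g2 := av_grel uU Gbi NN smN bN.
have AS := autsysN NN smN.
have sm0 : sm (set0 : set Gt) by apply: small_countable => //; exact: countable0.
have [al mal] := mor_ex AS g1 sm0.
have sm1 : sm (set0 `|` range al) by auto.
have [be mbe] := mor_ex AS g2 sm1.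
have Gal i : (G : set Gt) (al i) by exact: (av_G uU Gai NN (mal i)).
have Gbe i : (G : set Gt) (be i) by exact: (av_G uU Gbi NN (mbe i)).
have i2 := mor_indisc AS g2 sm1 mbe.
have i1 : indisc (AutG N) (set0 `|` range be) al.
  apply: indisc_stat; first exact: (mor_indisc AS g1).
  by apply: (stationary_seq AS g2).
have comm_al x y (h : commute x y) : commute x y^-1 := commuteV h.
have AM tau (ht : AutG N tau) := AutG_morph (gdefN NN) ht.
case: (dpG (gdefN NN) smN NN sm0 i1 i2 (GM (Gal 0%N) (Gbe 0%N))) => /(indisc1 0%N 1%N) [tau [ht tc t01]].
  have tE : tau (al 0%N * be 0%N) = al 0%N * be 0%N by apply: tc; right.
  have tb : tau b = b by apply: AutG_fix ht _; have := bN 1%N; rewrite expg1.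
  have cb : commute (be 0%N) b.
    apply: (av_closed uU npU (f := fun i => b ^+ i) (Psi := fun y => commute y b) _ _ (mbe 0%N)).
      apply: gdef_unit; apply: gdef_comm; first by move=> c /NN; left.
      by have := bN 1%N; rewrite expg1 => h c /h; left.
    by exists 0%N => j _; rewrite /commute -expgS expgSr.
  have ctb : commute (tau (be 0%N)) b.
    by rewrite /commute -{1}tb -(AM _ ht) cb (AM _ ht) tb.
  (* Since the product is fixed, [al 1] times an element commuting with b equals [al 0]. Between two
     distinct powers of a this relation would make a power of a commute with b, and averages inherit
     its failure. *)
  have := @av_pairs U uU npU (fun i => a ^+ i) N NN aN
    (fun x y => ~ exists w, x * w = y /\ w * b = b * w) al _ _ mal; apply.
  - apply: (gdef_not (gdefN NN)) => //.
    pose Phi (g : option bool -> Gt) := g (Some false) * g None = g (Some true) /\ g None * b = b * g None.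
    have : gdef N (fun g : bool -> Gt => exists w, Phi (env_cons w g)).
      apply: gdef_ex; apply: gdef_and; first exact: (gdef_mul (gdefN NN)).
      by apply: gdef_comm => //; have := bN 1%N; rewrite expg1.
    by congr gdef.
  - move=> i j ij [w [E cw]].
    by have [m cm] := commute_pow_diff ij E cw; exact: (na m).
  exists (tau (be 0%N) * (be 0%N)^-1); split.
    by rewrite mulgA -t01 -(AM _ ht) tE mulgK.
  exact/commute_sym/(commuteM (commute_sym ctb))/comm_al/commute_sym.
have tE : tau (al 0%N * be 0%N) = al 0%N * be 0%N by apply: tc; right.
have ta : tau a = a by apply: AutG_fix ht _; have := aN 1%N; rewrite expg1.
have ca : commute (al 0%N) a.
  apply: (av_closed uU npU (f := fun i => a ^+ i) (Psi := fun y => commute y a) _ _ (mal 0%N)).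
    apply: gdef_unit; apply: gdef_comm; first by move=> c /NN; left.
    by have := aN 1%N; rewrite expg1 => h c /h; left.
  by exists 0%N => j _; rewrite /commute -expgS expgSr.
have cta : commute (tau (al 0%N)) a.
  by rewrite /commute -{1}ta -(AM _ ht) ca (AM _ ht) ta.
have mbe0 : morley (realg (avtype U (fun i => emb (b ^+ i))) N) set0 be.
  by apply: (mor_mono g2) mbe; exact: sub0set.
have := @av_pairs U uU npU (fun i => b ^+ i) N NN bN
  (fun x y => ~ exists w, w * x = y /\ w * a = a * w) be _ _ mbe0; apply.
- apply: (gdef_not (gdefN NN)) => //.
  pose Phi (g : option bool -> Gt) := g None * g (Some false) = g (Some true) /\ g None * a = a * g None.
  have : gdef N (fun g : bool -> Gt => exists w, Phi (env_cons w g)).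
    apply: gdef_ex; apply: gdef_and; first exact: (gdef_mul (gdefN NN)).
    by apply: gdef_comm => //; have := aN 1%N; rewrite expg1.
  by congr gdef.
- move=> i j ij [w [E cw]].
  have cbi : b ^+ i * w = b ^+ j.
    by apply: (mulIg (b ^+ i)); rewrite -mulgA E -!expgnDr addnC.
  by have [m cm] := commute_pow_diff ij cbi cw; exact: (nb m).
exists ((al 0%N)^-1 * tau (al 0%N)); split.
  by rewrite -t01 -mulgA -(AM _ ht) tE mulKg.
apply/commute_sym/commuteM; last exact: commute_sym.
exact/comm_al/commute_sym.
Qed.

(** * The left stabilizer of the distal type *)

Variable p : set (pformula C 'I_n).
Hypothesis gp : global_type p.
Let P := ptype p.
Hypothesis iP : ginv N0 P.
Hypothesis PG : forall A y, N0 `<=` A -> real P A y -> (emb @` (G : set Gt)) y.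
Hypothesis distP : forall A (J : nat -> Gt) x, sm A -> N0 `<=` A ->
  (forall i, real P (A `|` coords (before J i)) (emb (J i))) ->
  real P (N0 `|` coords (range J)) x -> real P (A `|` coords (range J)) x.
Hypothesis fP : forall A, sm A -> f_generic_partial kappa G (restr p A).

Let gP : gtype P := ptype_gtype gp.

Definition rP (A : set C) (x : Gt) : Prop := real P A (emb x).

Lemma rP_G A x : N0 `<=` A -> rP A x -> (G : set Gt) x.
Proof. by move=> NA rx; have [y Gy /emb_inj <-] := PG NA rx. Qed.

Lemma ginv_mono N N' (q : set (set ('I_n -> C))) : N `<=` N' -> ginv N q -> ginv N' q.
Proof. by move=> NN iq s hs sN; apply: iq => // c /NN/sN. Qed.

Lemma P_grel N : N0 `<=` N -> sm N -> grel kappa (AutG N) (realg P N).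
Proof.
move=> NN smN; apply: realg_grel => //; first exact: gdefN.
- exact: ginv_mono iP.
- by move=> A y NA ry; have [g _ <-] := PG (subset_trans NN NA) ry; exists g.
Qed.

Lemma coords0 : coords (set0 : set Gt) = set0. Proof. exact: bigcup_set0. Qed.

Lemma realg0 q N x : realg q N set0 x = real q N (emb x).
Proof. by rewrite /realg coords0 setU0. Qed.

Lemma sm0 T : sm (set0 : set T).
Proof. by apply: small_countable => //; exact: countable0. Qed.

Lemma rP_ex N : N0 `<=` N -> sm N -> exists x, rP N x.
Proof.
move=> NN smN; have [x] := g_ex (P_grel NN smN) (@sm0 _).
by rewrite realg0; exists x.
Qed.

Lemma rP_conj N x y : N0 `<=` N -> sm N -> rP N x -> rP N y ->
  exists tau, AutG N tau /\ tau x = y.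
Proof.
move=> NN smN; rewrite /rP -!realg0 => rx ry.
by have [tau [ht _ txy]] := g_uniq (P_grel NN smN) (@sm0 _) rx ry; exists tau.
Qed.

Lemma rP_aut N x tau : N0 `<=` N -> sm N -> AutG N tau -> rP N x -> rP N (tau x).
Proof.
move=> NN smN ht; rewrite /rP -!realg0 => /(g_aut (P_grel NN smN) ht).
by rewrite image_set0.
Qed.

Lemma rP_mono A A' x : A' `<=` A -> rP A x -> rP A' x.
Proof. exact: real_mono. Qed.

(* Left stabilizer of p; asking for one x suffices, by homogeneity. *)
Definition stab : set Gt := [set k | (G : set Gt) k /\
  forall A, sm A -> exists x, rP A x /\ rP A (k * x)].

Lemma stabP k A x : stab k -> sm A -> N0 `<=` A -> range (emb k) `<=` A ->
  rP A x -> rP A (k * x).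
Proof.
move=> [_ Sk] smA NA kA rx; have [y [ry rky]] := Sk _ smA.
have [tau [ht tyx]] := rP_conj NA smA ry rx.
have := rP_aut NA smA ht rky.
by rewrite (AutG_morph (gdefN NA) ht) (AutG_fix ht kA) tyx.
Qed.

Lemma stab1 : stab 1.
Proof.
split; first exact: G1.
move=> A smA; have [|x rx] := @rP_ex (N0 `|` A) (@subsetUl _ _ _); first by auto.
have rxA : rP A x by apply: rP_mono rx; exact: subsetUr.
by exists x; rewrite mul1g.
Qed.

Lemma stabM k l : stab k -> stab l -> stab (k * l).
Proof.
move=> Sk Sl; split; first by apply: GM; [exact: Sk.1|exact: Sl.1].
move=> A smA; pose B := N0 `|` A `|` range (emb k) `|` range (emb l).
have smB : sm B by rewrite /B; auto 7.
have NB : N0 `<=` B by move=> c; left; left; left.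
have AB : A `<=` B by move=> c; left; left; right.
have [x rx] := rP_ex NB smB; exists x; split; first exact: rP_mono AB rx.
rewrite -mulgA; apply: (rP_mono AB); apply: stabP => //; first by move=> c; left; right.
by apply: stabP => // c; right.
Qed.

Lemma stabV k : stab k -> stab k^-1.
Proof.
move=> [Gk Sk]; split; first exact: GV.
move=> A smA; have [x [rx rkx]] := Sk A smA.
by exists (k * x); rewrite mulKg.
Qed.

(* If no x and k x realize p together, a formula of p has pairwise disjoint
   translates along the sequence, and then along the average of the sequence over a
   model, where this is dividing; distality extends the base from J to A and J. *)
Lemma stab_morley M R g : sm M -> N0 `<=` M -> grel kappa (AutG M) R -> morley R set0 g ->
  (forall i, (G : set Gt) (g i)) -> stab (g 0%N * (g 1%N)^-1).
Proof.
move=> smM NM gR mg Gg; split; first by apply: GM => //; exact: GV.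
move=> A0 smA0; pose A := A0 `|` M `|` coords (range g).
have smA : sm A by rewrite /A; auto 7.
have NA : N0 `<=` A by move=> c /NM; left; right.
have [J mJ] := mor_ex (autsysN NA smA) (P_grel NA smA) (@sm0 _).
have rJ i : real P (A `|` coords (before J i)) (emb (J i)).
  by have := mJ i; rewrite set0U.
pose E := N0 `|` coords (range J).
have smE : sm E by rewrite /E; auto.
have NE : N0 `<=` E by move=> c; left.
(* It is enough to realize p over [N0] and [J]: distality extends the base to [A], which contains
   the arbitrary set [A0]. *)
suff [u [r0 r1]] : exists u, rP E (g 0%N * u) /\ rP E (g 1%N * u).
  have AA : A0 `<=` A `|` coords (range J) by move=> c; left; left; left.
  exists (g 1%N * u); split; first exact: real_mono AA (distP smA NA rJ r1).
  by rewrite -mulgA mulKg; exact: real_mono AA (distP smA NA rJ r0).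
apply: contrapT => nu.
(* Saturation: if every set of p over E met its translate, some u would realize all these conditions
   at once. *)
have [Phi [dPhi [PPhi disj]]] : exists Phi, definable E Phi /\
    (P Phi /\ forall u, ~ (Phi (emb (g 0%N * u)) /\ Phi (emb (g 1%N * u)))).
  apply: contrapT => nPhi; apply: nu.
  pose E' := E `|` coords (range g).
  have smE' : sm E' by rewrite /E'; auto.
  have NE' : N0 `<=` E' by move=> c /NE; left.
  pose Y (X : set ('I_n -> C)) := emb @` [set u | X (emb (g 0%N * u)) /\ X (emb (g 1%N * u))].
  have gE i : range (emb (g i)) `<=` E' by move=> c hc; right; exists (g i) => //; exists i.
  have [|||y yY] := @saturatedn L C kappa SL smallN satC n E'
    (Y @` [set X | definable E X /\ P X]) smE'.
  - move=> _ [X [dX PX] <-].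
    have dX' := definable_mono (@subsetUl _ E (coords (range g))) dX.
    by apply: gdef_unit; apply: gdef_and; apply: gdef_preL => //; exact: gE.
  - move=> _ [X [dX PX] <-]; apply: contrapT => nY; apply: nPhi.
    by exists X; do 2!split=> //; move=> u Xu; apply: nY; exists (emb u), u.
  - move=> _ _ [X [dX PX] <-] [X' [dX' PX'] <-]; exists (Y (X `&` X')); split.
      exists (X `&` X') => //; split; first exact: definable_and.
      exact: gt_and.
    by move=> _ [u [[h1 h2] [h3 h4]] <-]; split; exists u.
  have [u _ uy] : Y setT y.
    apply: yY; exists setT => //; split; first exact: definable_setT.
    have dT : definable setT [set: 'I_n -> C] by exact: definable_setT.
    by case: (gt_compl gP dT) => //; rewrite setCT => /(gt_ne gP) [].
  have uX X : definable E X -> P X -> X (emb (g 0%N * u)) /\ X (emb (g 1%N * u)).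
    move=> dX PX; have [|u' h E1] := yY (Y X); first by exists X.
    by have -> : u = u' by apply: emb_inj; rewrite uy E1.
  by exists u; split=> X dX PX; [exact: (uX X dX PX).1|exact: (uX X dX PX).2].
(* [J] is Morley over [A], which contains [g], so [g] is indiscernible over [M] and [J], hence over
   the parameters of [Phi]; disjointness at 0 and 1 spreads to all pairs. *)
have disjg i j : i <> j -> ~ exists u, Phi (emb (g i * u)) /\ Phi (emb (g j * u)).
  have lt i' j' : i' < j' -> ~ exists u, Phi (emb (g i' * u)) /\ Phi (emb (g j' * u)).
    move=> ij [u [ui uj]].
    have AS := autsysN NM smM.
    have ind : indisc (AutG M) (set0 `|` range J) g.
      apply: indisc_stat; first exact: (mor_indisc AS gR (@sm0 _)).
      apply: (stationary_seq AS (P_grel NM smM)); first by rewrite set0U.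
      move=> k; apply: real_mono (rJ k) => c [Mc|]; first by left; left; right.
      rewrite set0U coordsU => -[h|h]; last by right.
      by left; right.
    have [||tau [[s [hs sM st]] tJ tg]] := ind 2 (fun x : 'I_2 => if val x == 0%N then i' else j') val.
    - by move=> [[|[|x]] hx] [[|[|y]] hy].
    - by [].
    have sE : fixes E s.
      move=> c [/NM Mc|Jc]; first exact: sM.
      by move: c Jc; apply/(fixes_coords (range J) st) => c hc; apply: tJ; right.
    have ht : AutG M tau by exists s.
    have tM := AutG_morph (gdefN NM) ht.
    have t0 : tau (g i') = g 0%N := tg ord0.
    have t1 : tau (g j') = g 1%N := tg (lift ord0 ord0).
    apply: (disj (tau u)); split.
      by rewrite -t0 -tM st; apply/(definable_aut _ hs sE dPhi).
    by rewrite -t1 -tM st; apply/(definable_aut _ hs sE dPhi).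
  move=> ij; case: (ltngtP i j) => [|ji|//]; first exact: lt.
  by move=> [u [h1 h2]]; apply: (lt _ _ ji); exists u.
have [U [uU npU]] := nonprincipal.
(* Forking is tested over a model containing E, over which [g] need not be indiscernible. As [g]
   lies in the model, its average is invariant over it, and a Morley sequence [h] of the average
   replaces [g]. *)
have [|M1 [AM1 smM1 elM1]] := loewenheim_skolem SL smallL (A := E `|` coords (range g)).
  by auto.
have EM1 : E `<=` M1 by move=> c Ec; apply: AM1; left.
have NM1 : N0 `<=` M1 by move=> c /NE/EM1.
have gM1 i : range (emb (g i)) `<=` M1.
  by move=> c hc; apply: AM1; right; exists (g i) => //; exists i.
have gq := av_grel uU Gg NM1 smM1 gM1.
have AS1 := autsysN NM1 smM1.
have [h mh] := mor_ex AS1 gq (@sm0 _).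
have Gh i : (G : set Gt) (h i) := av_G uU Gg NM1 (mh i).
have disjh : ~ exists u, Phi (emb (h 1%N * u)) /\ Phi (emb (h 0%N * u)).
  apply: (av_pairs uU npU NM1 gM1 (Psi := fun x y => ~ exists u, Phi (emb (x * u)) /\ Phi (emb (y * u)))
    _ disjg mh).
  apply: (gdef_not (gdefN NM1)) => //.
  pose Psi (z : option bool -> Gt) := Phi (emb (z (Some false) * z None)) /\ Phi (emb (z (Some true) * z None)).
  have dPhi1 := definable_mono EM1 dPhi.
  have : gdef M1 (fun z : bool -> Gt => exists w, Psi (env_cons w z)).
    by apply: gdef_ex; apply: gdef_and; apply: gdef_preM.
  by congr gdef.
have dT : definable E [set z : 'I_n + 'I_n -> C | exists x y, z = tcat (emb x) (emb y) /\ Phi (emb (y * x))].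
  by apply: gdef_bool; apply: gdef_preM.
have [k [phi [d [dE TE]]]] := iffLR (definable_params _ _) dT.
pose t (x : 'I_n + 'I_n + 'I_k) : 'I_n + 'I_(n + k) := match x with
  | inl (inl i) => inl i | inl (inr i) => inr (unsplit (inl i)) | inr i => inr (unsplit (inr i)) end.
have satE a i : sat (frename t phi) (tcat a (pad h d i)) <->
    exists x y, tcat a (emb (h i)) = tcat (emb x) (emb y) /\ Phi (emb (y * x)).
  rewrite sat_rename.
  have -> : (exists x y, tcat a (emb (h i)) = tcat (emb x) (emb y) /\ Phi (emb (y * x))) =
    sat phi (tcat (tcat a (emb (h i))) d).
    exact: (congr1 (fun X : set _ => X (tcat a (emb (h i)))) TE).
  apply: sat_ext_fv => -[[x|x]|x] _ //; [exact: pad_inl|exact: pad_inr].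
have tcatI a b x y : tcat a b = tcat (emb x) (emb y) -> a = emb x /\ b = emb y.
  move=> E1; split; apply/funext => x'; first exact: (congr1 (@^~ (inl x')) E1).
  exact: (congr1 (@^~ (inr x')) E1).
(* The translate of p over E by the inverse of [h 0] lies in the set of u with [h 0] u in [Phi]; the
   instances of this set along [h] are disjoint, so it divides. *)
apply: (fP smE smM1 elM1 _ _ (GV (Gh 0%N))).
- by exists (restr p E); split=> // psi [_]; exact: over_mono.
- split; first exact: gdefN.
  by have [S [SN GS]] := tG; exists S; split=> // psi /SN; exact: over_mono.
exists 1%N, (fun=> emb @` [set u | Phi (emb (h 0%N * u))]); split.
  move=> _; exists (n + k)%N, (frename t phi), (pad h d); split.
  - apply/seteqP; split=> [_ [u Pu <-]|a /satE [x [y [/tcatI [-> /emb_inj ->] Pxy]]]].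
      by apply/satE; exists u, (h 0%N).
    by exists x.
  - have ind := mor_indisc AS1 gq (@sm0 _) mh.
    by apply: (indisc_frozen ind); rewrite coords0 setU0 // => c /dE/EM1.
  - move=> [a aP].
    have /satE [x [y [/tcatI [ax /emb_inj <-] Px]]] := aP 0%N.
    have /satE [x' [y' [/tcatI [ax' /emb_inj <-] Px']]] := aP 1%N.
    have xx' : x' = x by apply: emb_inj; rewrite -ax -ax'.
    by apply: disjh; exists x; split=> //; rewrite -xx'.
move=> _ [_ [x [Gx rx] <-] <-]; exists ord0 => //; exists ((h 0%N)^-1 * x) => //.
rewrite /= mulVKg.
have := iffRL (ptype_real _ _ gp) rx; apply => //.
Qed.

(* a and b start two Morley sequences with the same tail, for a coheir of their type. *)
Lemma stab_conj M a b tau : sm M -> elementary_substructure M -> N0 `<=` M ->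
  (G : set Gt) a -> AutG M tau -> tau a = b -> stab (b * a^-1).
Proof.
move=> smM elM NM Ga ht tab.
pose I := {d : 'I_n -> C | range d `<=` M}.
(* The traces on M of the sets of the type of a over M; they are nonempty because M is an elementary
   substructure. An ultrafilter above them gives a coheir, invariant over M. *)
pose F : set_system I := [set Y | exists X, [/\ definable M X, X (emb a) & forall i : I, X (sval i) -> Y i]].
have pF : ProperFilter F.
  split.
    move=> [X [dX Xa XF]]; have [|d [Xd dM]] := elementary_witness elM dX; first by exists (emb a).
    exact: (XF (exist _ d dM)).
  split.
  - by exists setT; split=> //; exact: definable_setT.
  - move=> Y Z [X [dX Xa XY]] [X' [dX' Xa' XZ]]; exists (X `&` X'); split=> //.
      exact: definable_and.
    by move=> i [Xi X'i]; split; [exact: XY|exact: XZ].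
  - by move=> Y Z YZ [X [dX Xa XY]]; exists X; split=> // i /XY/YZ.
have [U [uU FU]] := ultraFilterLemma pF.
pose q := avtype U (fun i : I => sval i).
have gq : gtype q by exact: avtype_gtype.
have iq : ginv M q by apply: avtype_inv => i; exact: (svalP i).
have qa X : definable M X -> X (emb a) -> q X.
  move=> dX Xa; split; first exact: definable_setTS dX.
  by apply: FU; exists X.
have ra : real q M (emb a).
  move=> X dX qX; apply: contrapT => nXa.
  by have [y [Xy nXy]] := gt_ne gq (gt_and gq qX (qa _ (definable_not dX) nXa)).
have qG A y : M `<=` A -> real q A y -> (emb @` (G : set Gt)) y.
  move=> MA ry; have [S [SN GS]] := tG; rewrite GS => phi Sphi.
  have oM : over M phi by apply: over_mono (SN _ Sphi).
  apply: (ry [set y | psat phi y]); first by exists phi; split=> //; exact: over_mono oM.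
  apply: qa; first by exists phi.
  by have : (emb @` (G : set Gt)) (emb a); [exists a|rewrite GS; apply].
have gR : grel kappa (AutG M) (realg q M).
  apply: realg_grel => //; first exact: gdefN.
  by move=> A y MA ry; have [g _ <-] := qG _ _ MA ry; exists g.
have rb : real q M (emb b).
  have : realg q M set0 a by rewrite realg0.
  by move/(g_aut gR ht); rewrite image_set0 realg0 tab.
have AS := autsysN NM smM.
have sab : sm ([set a; b] : set Gt).
  by apply: small_setU => //; apply: small_countable => //; exact: countable1.
have [h mh] := mor_ex AS gR sab.
have Gr A g : realg q M A g -> (G : set Gt) g.
  by move=> rg; have [|g' Gg' /emb_inj <-] := qG _ _ _ rg; first exact: subsetUl.
have main x : [set a; b] x -> real q M (emb x) -> stab (x * (h 0%N)^-1).
  move=> abx rx; have mx : morley (realg q M) set0 (fun i => if i is j.+1 then h j else x).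
    apply: (mor_cons gR); first by rewrite realg0.
    by apply: (mor_mono gR) mh => y [//|->].
  by apply: (stab_morley smM NM gR mx) => i; exact: Gr (mx i).
have -> : b * a^-1 = (b * (h 0%N)^-1) * (a * (h 0%N)^-1)^-1 by rewrite invgM invgK mulgA mulgVK.
apply: stabM; first by apply: main => //; right.
by apply/stabV/main => //; left.
Qed.

Lemma tp_AutG1 M a b : sm M -> N0 `<=` M -> tp M (emb a) = tp M (emb b) ->
  exists tau, AutG M tau /\ tau a = b.
Proof.
move=> smM NM E.
have cu : countable [set: unit] by exact: countableP.
have Eab : tp (M `|` coords (set0 : set Gt)) (flat (fun=> a)) =
    tp (M `|` coords (set0 : set Gt)) (flat (fun _ : unit => b)).
  by rewrite coords0 setU0; exact: (@tp_rename _ _ _ _ _ (fun z : unit * 'I_n => z.2)).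
have [tau [ht _ tab]] := tp_AutG SL smallN homC (gdefN NM) cu smM (@sm0 _) Eab.
by exists tau; split=> //; exact: (tab tt).
Qed.

(** A point satisfying every formula over M true on the stabilizer yields, by saturation, an x such
    that x and k x both realize p over M. These are conjugate over M, and [stab_conj] applied to
    them returns k. *)
Lemma stab_type_definable M : sm M -> elementary_substructure M -> N0 `<=` M ->
  type_definable M (emb @` stab).
Proof.
move=> smM elM NM.
exists [set phi | over M phi /\ forall k, stab k -> psat phi (emb k)].
split; first by move=> phi [].
apply/seteqP; split=> [_ [k Sk <-] phi [_]|y yS]; first exact.
have yX X : definable M X -> (forall k, stab k -> X (emb k)) -> X y.
  by move=> [phi [o ->]] H; exact: yS.
have [k _ ky] : range emb y by apply: yX; [exact: (gdefN NM).1|move=> k _; exists k].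
pose Y (X : set ('I_n -> C)) := emb @` [set x | X (emb x) /\ X (emb (k * x))].
have smE : sm (M `|` range (emb k)) by auto.
have kE : range (emb k) `<=` M `|` range (emb k) by exact: subsetUr.
have NE : N0 `<=` M `|` range (emb k) by move=> c /NM; left.
have [|||z zY] := @saturatedn L C kappa SL smallN satC n (M `|` range (emb k))
    (Y @` [set X | definable M X /\ P X]) smE.
- move=> _ [X [dX PX] <-].
  have dX' := definable_mono (@subsetUl _ M (range (emb k))) dX.
  apply: gdef_unit; apply: gdef_and; first exact: (gdef_pre (gdefN NE)).
  exact: gdef_preL.
- move=> _ [X [dX PX] <-].
  have : (emb @` [set l | exists x, X (emb x) /\ X (emb (l * x))]) y.
    apply: yX.
      apply: gdef_unit.
      pose Psi (z : option unit -> Gt) := X (emb (z None)) /\ X (emb (z (Some tt) * z None)).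
      have : gdef M (fun z : unit -> Gt => exists w, Psi (env_cons w z)).
        apply: gdef_ex; apply: gdef_and; first exact: (gdef_pre (gdefN NM)).
        exact: gdef_preM.
      by congr gdef.
    move=> l [Gl Sl]; exists l => //; have [x [rx rlx]] := Sl M smM.
    by exists x; split; [exact: rx|exact: rlx].
  move=> [l [x [Xx Xlx]] ly]; have kl : k = l by apply: emb_inj; rewrite ky ly.
  by exists (emb x), x => //; split=> //; rewrite kl.
- move=> _ _ [X [dX PX] <-] [X' [dX' PX'] <-]; exists (Y (X `&` X')); split.
    exists (X `&` X') => //; split; first exact: definable_and.
    exact: gt_and.
  by move=> _ [u [[h1 h2] [h3 h4]] <-]; split; exists u.
have dT : definable setT [set: 'I_n -> C] by exact: definable_setT.
have PT : P setT by case: (gt_compl gP dT) => //; rewrite setCT => /(gt_ne gP) [].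
have [x _ xz] : Y setT z by apply: zY; exists setT => //; split=> //; exact: definable_setT.
have xX X : definable M X -> P X -> X (emb x) /\ X (emb (k * x)).
  move=> dX PX; have [|x' h E1] := zY (Y X); first by exists X.
  by have -> : x = x' by apply: emb_inj; rewrite xz E1.
have rx : rP M x by move=> X dX PX; exact: (xX X dX PX).1.
have rkx : rP M (k * x) by move=> X dX PX; exact: (xX X dX PX).2.
have [tau [ht txk]] := rP_conj NM smM rx rkx.
exists k => //; rewrite -[k](mulgK x).
exact: (stab_conj smM elM NM (rP_G NM rx) ht txk).
Qed.

(** By [stab_conj], applied to inverses, a left coset is determined by the type over a small model M
    of a representative. Such a type is coded as a set of pairs of a formula and a list from M. *)
Lemma small_left_cosets : sm (left_cosets G stab).
Proof.
have [M [NM smM elM]] := loewenheim_skolem SL smallL smN0.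
have [c0] := dom_inh C.
have /choice[rep repP] : forall Y : set Gt, exists a, left_cosets G stab Y ->
    (G : set Gt) a /\ Y = [set a * h | h in stab].
  move=> Y; have [[a Ga <-]|nY] := pselect (left_cosets G stab Y); first by exists a.
  by exists 1.
pose env (a : Gt) (s : seq M) (i : nat) : C :=
  nth c0 ([seq emb a j | j <- enum 'I_n] ++ [seq val x | x <- s]) i.
pose code a : set (formula L nat * seq M) := [set z | sat z.1 (env a z.2)].
have smZ : sm [set: formula L nat * seq M].
  rewrite -setXTT; apply: (small_setX SL smallN) => //.
  by apply: (small_seq SL smallN); apply/small_setT.
apply: small_le (small_pow SL smallN smZ).
apply: (@card_le_fun _ _ _ _ (fun Y => code (rep Y))) => // Y Z YS ZS E.
have [Ga Ya] := repP Y YS; have [Gb Zb] := repP Z ZS.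
set a := rep Y in E Ga Ya; set b := rep Z in E Gb Zb.
have tpab : tp M (emb a) = tp M (emb b).
  apply/tpP => X /definable_params [k [phi [d [dM ->]]]] /=.
  pose t (x : 'I_n + 'I_k) : nat := match x with inl i => i | inr j => n + j end.
  pose s : seq M := [seq exist _ (d i) (mem_set (dM _ (imageP d (I : setT i)))) | i <- enum 'I_k].
  have envE (g : Gt) : sat phi (tcat (emb g) d) <-> code g (frename t phi, s).
    rewrite /code /= sat_rename; apply: sat_ext_fv => -[i|j] _ /=; rewrite /env nth_cat size_map size_enum_ord.
      by rewrite ltn_ord (nth_map i) ?size_enum_ord // nth_ord_enum.
    rewrite ltnNge leq_addr /= addKn -map_comp (nth_map j) ?size_enum_ord //.
    by rewrite nth_ord_enum.
  by move=> /envE h; apply/envE; rewrite -E.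
have [tau [ht tab]] := tp_AutG1 smM NM tpab.
have tV : tau a^-1 = b^-1.
  have tM := AutG_morph (gdefN NM) ht.
  have t1 : tau 1 = 1 by apply: (mulgI (tau 1)); rewrite -tM !mulg1.
  by apply: (mulgI b); rewrite mulgV -tab -tM mulgV.
have Sba : stab (b^-1 * a).
  by have := stab_conj smM elM NM (GV Ga) ht tV; rewrite invgK.
rewrite Ya Zb; apply/seteqP; split=> _ [h Sh <-].
  by exists (b^-1 * a * h); [exact: stabM|rewrite !mulgA mulgV mul1g].
exists ((b^-1 * a)^-1 * h); first by apply: stabM => //; exact: stabV.
by rewrite invgM invgK !mulgA mulgV mul1g.
Qed.

Lemma stab_group : group_closed (fun x => x \in stab).
Proof.
split=> [|x y /set_mem Sx /set_mem Sy]; apply/mem_set; first exact: stab1.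
by apply: stabM => //; exact: stabV.
Qed.

Lemma G00_stab (H : subgroup Gt) : is_G00 kappa G H -> (H : set Gt) `<=` stab.
Proof.
move=> [_ minH]; apply: (minH (Subgroup stab_group)); split=> /=.
- by move=> k [].
- have [M [NM smM elM]] := loewenheim_skolem SL smallL smN0.
  exists M; split=> //; split; first exact: gdefN.
  exact: stab_type_definable.
- exact: small_left_cosets.
Qed.

End Stabilizer.

(** * Generic elements of the connected component *)

Section GenericElements.
Local Open Scope group_scope.
Variables (L : language) (C : structure L) (kappa : Type) (Gt : definable_group C).
Local Notation emb := (@dg_emb L C Gt).
Local Notation n := (dg_dim Gt).
Local Notation sm := (small kappa).
Hypothesis SL : strong_limit kappa.
Hypothesis smallL : sm [set: formula L nat].
Hypothesis satC : saturated C kappa.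
Hypothesis homC : strongly_homogeneous C kappa.
Variable G : subgroup Gt.
Variable N0 : set C.
Hypothesis smN0 : sm N0.
Hypothesis gN0 : group_definable_over N0 emb.
Hypothesis tG : type_definable N0 (emb @` (G : set Gt)).
Hypothesis dpG : forall N A I1 I2 c, group_definable_over N emb -> sm N -> N0 `<=` N -> sm A ->
  indisc (AutG N) (A `|` range I2) I1 -> indisc (AutG N) (A `|` range I1) I2 ->
  (G : set Gt) c ->
  indisc (AutG N) (A `|` [set c]) I1 \/ indisc (AutG N) (A `|` [set c]) I2.
Variable p : set (pformula C 'I_n).
Hypothesis gp : global_type p.
Let P := ptype p.
Hypothesis iP : ginv N0 P.
Hypothesis PG : forall A y, N0 `<=` A -> real P A y -> (emb @` (G : set Gt)) y.
Hypothesis distP : forall A (J : nat -> Gt) x, sm A -> N0 `<=` A ->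
  (forall i, real P (A `|` coords (before J i)) (emb (J i))) ->
  real P (N0 `|` coords (range J)) x -> real P (A `|` coords (range J)) x.
Hypothesis fP : forall A, sm A -> f_generic_partial kappa G (restr p A).
Variable K : subgroup Gt.
Hypothesis tK : type_definable N0 (emb @` (K : set Gt)).
Hypothesis cK : sm (left_cosets G K).
Hypothesis KG : (K : set Gt) `<=` G.
Hypothesis K_G00 : is_G00 kappa G K.

Let smallN : sm [set: nat] := small_nat smallL.

Let K_stab : (K : set Gt) `<=` stab kappa G p :=
  G00_stab SL smallL satC homC smN0 gN0 tG gp iP PG distP fP K_G00.

Lemma coset_representatives : exists S : set Gt, [/\ sm S, S `<=` G &
  forall g, (G : set Gt) g -> exists2 r, S r & (K : set Gt) (g * r^-1)].
Proof.
have /choice[rep repP] : forall Y : set Gt, exists a, left_cosets G K Y ->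
    (G : set Gt) a /\ Y = [set a * h | h in (K : set Gt)].
  move=> Y; have [[a Ga <-]|nY] := pselect (left_cosets G K Y); first by exists a.
  by exists 1.
exists [set (rep Y)^-1 | Y in left_cosets G K]; split.
- exact: small_image.
- by move=> _ [Y /repP [Ga _] <-]; exact: GV.
move=> g Gg; pose Y := [set g^-1 * h | h in (K : set Gt)].
have YG : left_cosets G K Y by exists g^-1 => //; exact: GV.
have [Ga YE] := repP Y YG.
exists (rep Y)^-1; first by exists Y.
have : Y g^-1 by exists 1; [exact: G1|rewrite mulg1].
rewrite {1}YE => -[h Kh E]; rewrite invgK.
have -> : g * rep Y = h^-1 by rewrite -[g]invgK -E invgM -mulgA mulVg mulg1.
exact: GV.
Qed.

Lemma commutators_of_G00 :
  (forall a k l : sg_type K, exists h, a ^ k * (a ^ l)^-1 * a = a ^ h) /\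
  (forall a b : sg_type K, (forall k, exists h, b ^ k * b^-1 = a ^ h * a^-1) \/
     (forall k, exists h, a ^ k * a^-1 = b ^ h * b^-1)).
Proof.
have [S [smS SG SK]] := coset_representatives.
pose N := N0 `|` coords S.
have smN : sm N by apply: small_setU => //; exact: small_coords.
have NN : N0 `<=` N by exact: subsetUl.
have [j0 rj0] := rP_ex SL smallL satC homC gN0 gp iP PG NN smN.
(* The right coset of x is that of some r named in N. An automorphism over N from x to y fixes r and
   preserves K, so y is in the same coset. *)
have Kq x y : rP p N x -> rP p N y -> (K : set Gt) (x * y^-1).
  move=> rx ry; have [r Sr Kxr] := SK _ (rP_G PG NN rx).
  have [tau [ht txy]] := rP_conj SL smallL satC homC gN0 gp iP PG NN smN rx ry.
  have tM := AutG_morph (gdefN gN0 NN) ht.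
  have tr : tau r = r by apply: AutG_fix ht _ => c hc; right; exists r.
  have Kyr : (K : set Gt) (y * r^-1).
    have : (K : set Gt) (tau (x * r^-1)).
      have tKN : type_definable N (emb @` (K : set Gt)).
        by have [T [TN TE]] := tK; exists T; split=> // phi /TN; exact: over_mono.
      exact: (iffLR (AutG_type_definable tKN ht _) Kxr).
    have t1 : tau 1 = 1 by apply: (mulgI (tau 1)); rewrite -tM !mulg1.
    have tV : tau r^-1 = r^-1 by apply: (mulgI r); rewrite -{1}tr -tM !mulgV.
    by rewrite tM txy tV.
  have -> : x * y^-1 = (x * r^-1) * (y * r^-1)^-1 by exact: divg_chain.
  by apply: GM => //; exact: GV.
pose N1 := N `|` range (emb j0).
have smN1 : sm N1 by apply: small_setU => //; exact: small_emb.
have NN1 : N0 `<=` N1 by move=> c /NN; left.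
have j0N1 : range (emb j0) `<=` N1 by exact: subsetUr.
have gN1 := gdefN gN0 NN1.
have AS : autsys kappa (AutG N1) := autsysN SL smallL homC gN0 NN1 smN1.
have AM tau (ht : AutG N1 tau) := AutG_morph gN1 ht.
have gR := P_grel SL smallL satC homC gN0 gp iP PG NN1 smN1.
(* [j0] is among the parameters in [N1], so right translation by it commutes with the automorphisms
   and [gen] inherits the calculus of realizations of p. *)
pose gen (A : set Gt) (x : Gt) := realg (ptype p) N1 A (x * j0).
have gG : grel kappa (AutG N1) gen.
  split.
  - by move=> A A' x AA; exact: (g_mono gR AA).
  - move=> A smA; have [x rx] := g_ex gR smA.
    by exists (x * j0^-1); rewrite /gen mulgVK.
  - move=> A x y smA rx ry; have [tau [ht tA txy]] := g_uniq gR smA rx ry.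
    exists tau; split=> //; apply: (mulIg j0).
    by rewrite -txy (AM _ ht) (AutG_fix ht j0N1).
  - by move=> tau A x ht rx; have := g_aut gR ht rx; rewrite (AM _ ht) (AutG_fix ht j0N1).
have genK A x : gen A x -> (K : set Gt) x.
  move=> rx; rewrite -[x](mulgK j0); apply: Kq => //.
  by apply: real_mono rx => c Nc; left; left.
have genL A k x : sm A -> (K : set Gt) k -> A k -> gen A x -> gen A (k * x).
  move=> smA Kk Ak rx; rewrite /gen -mulgA.
  apply: (stabP SL smallL satC homC gN0 gp iP PG (K_stab Kk)) => //.
  - exact: small_coordsU.
  - by move=> c /NN1; left.
  - by move=> c hc; right; exists k.
have small_seqG (J : nat -> Gt) : sm (range J) by apply: small_range => //; exact: countableP.
(* Distality speaks of the realizations [J'] rather than of [J]; the two sequences are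
   interdefinable over [j0], so [gen_dcl] passes from one to the other. *)
have genT A J x : sm A -> morley gen A J -> gen (range J) x -> gen (A `|` range J) x.
  move=> smA mJ rx; pose J' i := J i * j0.
  have fixJ' (I : set nat) tau : AutG N1 tau -> fixes (J @` I) tau -> fixes (J' @` I) tau.
    by move=> ht tJ _ [i Ii <-]; rewrite /J' (AM _ ht) (AutG_fix ht j0N1) tJ //; exists i.
  have fixJ (I : set nat) tau : AutG N1 tau -> fixes (J' @` I) tau -> fixes (J @` I) tau.
    move=> ht tJ _ [i Ii <-]; apply: (mulIg j0).
    by rewrite -{1}(AutG_fix ht j0N1) -(AM _ ht) tJ //; exists i.
  have beforeE (I : nat -> Gt) i : before I i = I @` [set j | j < i].
    by apply/seteqP; split=> _ [j ji <-]; exists j.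
  have rJ' i : real (ptype p) ((N1 `|` coords A) `|` coords (before J' i)) (emb (J' i)).
    have := gen_dcl AS gR (B := before J' i) _ (small_before AS J' i) _ (mJ i).
    rewrite /realg !coordsU => h; apply: (real_mono _ (h _ _)).
    - by move=> c [[Nc|Ac]|Jc]; [left|right; left; left|right; right].
    - by apply: small_setU => //; exact: (small_before AS).
    - move=> tau ht tAJ; rewrite beforeE; apply: fixJ' => // y Jy.
      by apply: tAJ; right; rewrite beforeE.
  have rx' : real (ptype p) (N0 `|` coords (range J')) (emb (x * j0)).
    have := gen_dcl AS gR (B := range J') (small_seqG J) (small_seqG J') _ rx.
    rewrite /realg coordsU => h; apply: (real_mono _ (h _)).
    - by move=> c [/NN1 Nc|Jc]; [left|right; right].
    - by move=> tau ht; exact: fixJ'.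
  have smNA : sm (N1 `|` coords A) by exact: small_coordsU.
  have NNA : N0 `<=` N1 `|` coords A by move=> c /NN1; left.
  have := distP smNA NNA rJ' rx'.
  have -> : (N1 `|` coords A) `|` coords (range J') = N1 `|` coords (A `|` range J').
    by rewrite coordsU setUA.
  move=> rAJ'.
  have := gen_dcl AS gR (B := range J) _ (small_seqG J) _ rAJ'.
  move=> h; apply: (g_mono gR _ (h _ _)).
  - by move=> y [Ay|Jy]; [left; left|right].
  - by apply: small_setU.
  - move=> tau ht tAJ; apply: fixJ => // y Jy.
    by apply: tAJ; right.
have KM x y := @GM _ _ _ K x y; have KV x := @GV _ _ _ K x.
have dpK A I1 I2 c : sm A -> indisc (AutG N1) (A `|` range I2) I1 ->
    indisc (AutG N1) (A `|` range I1) I2 -> (K : set Gt) c ->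
    indisc (AutG N1) (A `|` [set c]) I1 \/ indisc (AutG N1) (A `|` [set c]) I2.
  by move=> smA i1 i2 /KG; exact: dpG.
have powK x y : (K : set Gt) x -> (K : set Gt) y ->
    exists m, commute (x ^+ m.+1) y \/ commute (y ^+ m.+1) x.
  move=> /KG Gx /KG Gy.
  exact: (generic_powers_commute SL smallL satC homC smN0 gN0 tG dpG Gx Gy).
have vK (x : sg_type K) : (K : set Gt) (val x) by exact: (set_mem (valP x)).
have vV (x : sg_type K) : val x^-1 = (val x)^-1.
  by apply: (mulgI (val x)); rewrite -valM !mulgV val1.
have vJ (x y : sg_type K) : val (x ^ y) = val x ^ val y.
  by rewrite !conjgE !valM vV.
split.
  move=> a k l.
  have [h [Kh E]] := class_shift AS AM gG KM KV genK genL genT dpK powK (vK a) (vK k) (vK l).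
  exists (exist _ h (mem_set Kh) : sg_type K); apply: val_inj.
  by rewrite (valM _ a) (valM (a ^ k)) vV !vJ E.
move=> a b.
case: (class_compare AS AM gG KM KV genK genL genT dpK powK (vK a) (vK b)) => H; [left|right];
  move=> k; have [h [Kh E]] := H _ (vK k);
  exists (exist _ h (mem_set Kh) : sg_type K); apply: val_inj;
  by rewrite 2!(valM (_ ^ _)) !vV !vJ E.
Qed.

End GenericElements.

Theorem theorem5p18 (L : language) (T : theory L) (kappa : Type)
    (C : structure L) (Gt : definable_group C) (G G00 : subgroup Gt)
    (T_complete : complete_theory T) (T_NIP : NIP T)
    (C_monster : monster C kappa T)
    (G_type_definable : small_type_definable kappa G)
    (G_dp_minimal : dp_minimal kappa G)
    (G_distal_f_generic : exists p : set (pformula C 'I_(dg_dim Gt)),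
      [/\ global_type p, distal kappa p, concentrated_on kappa G p &
          f_generic kappa G p])
    (G00_def : is_G00 kappa G G00) :
  plain_valued_group
    (range (@comms (sg_type G00)))
    (fun X Y : set (sg_type G00) => Y `<=` X)
    (@comms_quot (sg_type G00)).
Proof.
have [_ SL smL satC homC] := C_monster.
have smallN := small_nat smL.
have [AG [smAG [gAG tAG]]] := G_type_definable.
have [Bdp [smBdp _ dp]] := G_dp_minimal.
have [p [gp [Bd [smBd ip dis]] [Ac [Sc [smAc ScA GSc Scp]]] fg]] := G_distal_f_generic.
have [[KG [AK [smAK [_ tAK]]] cK] _] := G00_def.
(* One small base for everything: the group law, G and G00 are defined over it, p is invariant over
   it and concentrated on G by formulas over it, and it contains the base witnessing
   dp-minimality. *)
pose N0 := AG `|` Bdp `|` Bd `|` Ac `|` AK.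
have smN0 : small kappa N0 by do !apply: (small_setU SL smallN).
have sG : AG `<=` N0 by move=> c; do 4!left.
have sB : Bdp `<=` N0 by move=> c; left; left; left; right.
have sD : Bd `<=` N0 by move=> c; left; left; right.
have sA : Ac `<=` N0 by move=> c; left; right.
have sK : AK `<=` N0 by move=> c; right.
have gN0 : group_definable_over N0 (@dg_emb _ _ Gt).
  by split; [exact: definable_mono gAG.1|exact: definable_mono gAG.2].
have tmono A (X : set ('I_(dg_dim Gt) -> C)) : A `<=` N0 -> type_definable A X -> @type_definable L C _ N0 X.
  by move=> AN [S [SA ->]]; exists S; split=> // phi /SA; exact: over_mono.
have iP : ginv N0 (ptype p).
  exact: ginv_mono sD (ptype_inv gp ip).
have PG A y : N0 `<=` A -> real (ptype p) A y -> (@dg_emb _ _ Gt @` (G : set Gt)) y.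
  move=> NA /(ptype_real _ _ gp) ry; rewrite GSc => phi Sphi; apply: ry; split; first exact: Scp.
  by apply: over_mono (ScA _ Sphi) => c /sA/NA.
have distP A (J : nat -> Gt) x : small kappa A -> N0 `<=` A ->
    (forall i, real (ptype p) (A `|` coords (before J i)) (dg_emb (J i))) ->
    real (ptype p) (N0 `|` coords (range J)) x -> real (ptype p) (A `|` coords (range J)) x.
  move=> smA NA mJ rx.
  apply: (distal_transfer SL smallN satC gp dis smA _ mJ); first by move=> c /sD/NA.
  by apply: real_mono rx; exact: setSU.
have dpG N A I1 I2 c : group_definable_over N (@dg_emb _ _ Gt) -> small kappa N -> N0 `<=` N ->
    small kappa A -> indisc (@AutG _ _ Gt N) (A `|` range I2) I1 ->
    indisc (@AutG _ _ Gt N) (A `|` range I1) I2 -> (G : set Gt) c ->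
    indisc (@AutG _ _ Gt N) (A `|` [set c]) I1 \/ indisc (@AutG _ _ Gt N) (A `|` [set c]) I2.
  move=> gN smN NN; apply: (dp_minimal_indisc SL smallN homC dp gN smN) => // c' /sB/NN.
  by [].
have [H1 H2] := commutators_of_G00 SL smL satC homC smN0 gN0 (tmono _ _ sG tAG) dpG gp iP PG
  distP fg (tmono _ _ sK tAK) cK KG G00_def.
exact: comms_plain_valued H1 H2.
Qed.
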